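(* Let $\pi:(M,g)\to(B,\check g)$ be a Riemannian submersion whose total space $M$ is compact, and suppose that the fibers of $\pi$, equipped with the metrics induced from $g$, have positive second H. Weyl curvature invariant. Then the manifold $M$ admits a Riemannian metric with positive second H. Weyl curvature invariant.
   Context: For a smooth Riemannian manifold $(M,g)$ of dimension $n\ge 4$ with Riemann curvature tensor $R$, Ricci tensor $cR$ and scalar curvature $c^2R$, the second H. Weyl curvature invariant is the function on $M$ defined by $$h_4=\|R\|^2-\|cR\|^2+\tfrac14\|c^2R\|^2,$$ where, in an orthonormal basis $(e_i)$ of the tangent space, $\|R\|^2=\sum_{i<j,\;k<l}R(e_i,e_j,e_k,e_l)^2$, $\|cR\|^2=\sum_{i,j}\mathrm{Ric}(e_i,e_j)^2$ and $\|c^2R\|^2=\mathrm{scal}^2$. (Thus $h_4=\frac{n(n-1)(n-2)(n-3)}{4}\lambda^2$ when $(M,g)$ has constant sectional curvature $\lambda$.) A Riemannian metric has positive second H. Weyl curvature invariant if $h_4>0$ at every point. Having positive $h_4$ presupposes dimension at least 4, so in the statement the fibers have dimension at least 4. *)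

(* Defs.v *)
(* Vectors are row vectors, so a linear map v |-> v *m J is applied on the
   right; this agrees with the library Jacobian: v *m 'J f x = 'd f x v. *)
From HB Require Import structures.
From mathcomp Require Import all_boot all_order all_algebra.
From mathcomp Require Import all_classical all_reals all_analysis.
Set Implicit Arguments.
Unset Strict Implicit.
Unset Printing Implicit Defensive.
Import Order.TTheory GRing.Theory Num.Theory.
Import numFieldNormedType.Exports.
Local Open Scope classical_set_scope.
Local Open Scope ring_scope.

(** * Smooth functions on open subsets of R^n *)

(* On an open set A: since the source is finite dimensional, requiring
   continuity of every x |-> 'D_v f x (rather than of x |-> 'd f x) is the
   usual class C^k. *)
Fixpoint Ck_on (R : realType) (n : nat) (W : normedModType R) (k : nat)
    (A : set 'rV[R]_n) (f : 'rV[R]_n -> W) : Prop :=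
  if k is k'.+1 then
    (forall x, A x -> differentiable f x) /\
    (forall v, Ck_on k' A (fun x => 'D_v f x))
  else forall x, A x -> {for x, continuous f}.

Definition smooth_on (R : realType) (n : nat) (W : normedModType R)
    (A : set 'rV[R]_n) (f : 'rV[R]_n -> W) : Prop :=
  forall k, Ck_on k A f.

(** * Smooth manifolds *)

(* Only the values of [chart_map] on [chart_dom] and of [chart_inv] on the
   image are meaningful. *)
Record chart (R : realType) (n : nat) (T : topologicalType) := Chart {
  chart_dom : set T;
  chart_map : T -> 'rV[R]_n;
  chart_inv : 'rV[R]_n -> T;
  chart_dom_open : open chart_dom;
  chart_img_open : open (chart_map @` chart_dom);
  chart_mapK : forall p, chart_dom p -> chart_inv (chart_map p) = p;
  chart_map_continuous : {within chart_dom, continuous chart_map};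
  chart_inv_continuous :
    {within chart_map @` chart_dom, continuous chart_inv}
}.

Definition chart_img (R : realType) (n : nat) (T : topologicalType)
    (c : chart R n T) : set 'rV[R]_n :=
  chart_map c @` chart_dom c.

Definition overlap (R : realType) (n : nat) (T : topologicalType)
    (c d : chart R n T) : set 'rV[R]_n :=
  [set x | chart_img c x /\ chart_dom d (chart_inv c x)].

Definition transition (R : realType) (n : nat) (T : topologicalType)
    (c d : chart R n T) : 'rV[R]_n -> 'rV[R]_n :=
  fun x => chart_map d (chart_inv c x).

(* Without boundary, not assumed connected; the atlas need not be maximal. *)
Record manifold (R : realType) (n : nat) := Manifold {
  carrier :> topologicalType;
  manifold_hausdorff : hausdorff_space carrier;
  manifold_second_countable : @second_countable carrier;
  atlas_index : Type;
  atlas : atlas_index -> chart R n carrier;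
  atlas_cover : forall p, exists i, chart_dom (atlas i) p;
  atlas_smooth : forall i j,
    smooth_on (overlap (atlas i) (atlas j)) (transition (atlas i) (atlas j))
}.

Section LocalRep.
Context (R : realType) (n b : nat) (M : manifold R n) (B : manifold R b).

Definition local_rep (f : M -> B) (i : atlas_index M) (j : atlas_index B) :
    'rV[R]_n -> 'rV[R]_b :=
  fun x => chart_map (atlas j) (f (chart_inv (atlas i) x)).

Definition local_rep_dom (f : M -> B) (i : atlas_index M)
    (j : atlas_index B) : set 'rV[R]_n :=
  [set x | chart_img (atlas i) x /\
           chart_dom (atlas j) (f (chart_inv (atlas i) x))].

Definition smooth_map (f : M -> B) : Prop :=
  continuous f /\
  forall i j, smooth_on (local_rep_dom f i j) (local_rep f i j).

End LocalRep.

(** * Riemannian metrics *)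

Definition bform (R : realType) (n : nat) (G : 'M[R]_n) (u v : 'rV[R]_n) : R :=
  (u *m G *m v^T) 0 0.

Definition pullback (R : realType) (m n : nat) (f : 'rV[R]_m -> 'rV[R]_n)
    (G : 'rV[R]_n -> 'M[R]_n) : 'rV[R]_m -> 'M[R]_m :=
  fun x => 'J f x *m G (f x) *m ('J f x)^T.

(* [metric i x] is the Gram matrix of the coordinate frame of the i-th chart
   at the point with coordinates x; it is meaningful for x in the image of
   that chart. *)
Record riemannian_metric (R : realType) (n : nat) (M : manifold R n) :=
    RiemannianMetric {
  metric : atlas_index M -> 'rV[R]_n -> 'M[R]_n;
  metric_smooth : forall i, smooth_on (chart_img (atlas i)) (metric i);
  metric_sym : forall i x, chart_img (atlas i) x ->
    (metric i x)^T = metric i x;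
  metric_pos : forall i x, chart_img (atlas i) x ->
    forall v, v != 0 -> 0 < bform (metric i x) v v;
  metric_compat : forall i j x, overlap (atlas i) (atlas j) x ->
    metric i x = pullback (transition (atlas i) (atlas j)) (metric j) x
}.

(** * Riemannian submersions *)

(* [J] is the matrix of the differential, so its kernel is the vertical
   space. *)
Definition horizontal (R : realType) (n b : nat) (G : 'M[R]_n)
    (J : 'M[R]_(n, b)) (u : 'rV[R]_n) : Prop :=
  forall w : 'rV[R]_n, w *m J = 0 -> bform G u w = 0.

(* [row_full J] says that v |-> v *m J is onto, i.e. that the differential is
   surjective. *)
Definition riemannian_submersion (R : realType) (n b : nat)
    (M : manifold R n) (B : manifold R b)
    (gM : riemannian_metric M) (gB : riemannian_metric B) (f : M -> B) : Prop :=
  smooth_map f /\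
  forall i j x, local_rep_dom f i j x ->
    let J := 'J (local_rep f i j) x in
    row_full J /\
    forall u v, horizontal (metric gM i x) J u ->
      horizontal (metric gM i x) J v ->
      bform (metric gB j (local_rep f i j x)) (u *m J) (v *m J) =
      bform (metric gM i x) u v.

(** * Curvature of a metric given by its Gram matrix G on an open set of R^n *)

Section Curvature.
Context (R : realType) (n : nat).
Implicit Types (G : 'rV[R]_n -> 'M[R]_n) (x u v w z : 'rV[R]_n).
Implicit Types (E : 'M[R]_n).

Definition partial (i : 'I_n) (f : 'rV[R]_n -> R^o) x : R :=
  'D_(delta_mx 0 i) f x.

(* [christoffel G k i j] is Gamma^k_ij of the Levi-Civita connection. *)
Definition christoffel G (k i j : 'I_n) x : R :=
  2^-1 * \sum_(l < n) (invmx (G x)) k l *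
    (partial i (fun y => G y j l) x + partial j (fun y => G y i l) x
     - partial l (fun y => G y i j) x).

(* The l-th component of R(d_i, d_j) d_k, where
   R(X, Y) = [nabla_X, nabla_Y] - nabla_[X, Y]. *)
Definition curvature_op G (i j k l : 'I_n) x : R :=
  partial i (christoffel G l j k) x - partial j (christoffel G l i k) x
  + \sum_(p < n) (christoffel G p j k x * christoffel G l i p x
                  - christoffel G p i k x * christoffel G l j p x).

(* R(u, v, w, z) = g(R(u, v) z, w), so that R(u, v, u, v) is the sectional
   curvature of the plane spanned by orthonormal vectors u and v. *)
Definition riemann G x u v w z : R :=
  \sum_(i < n) \sum_(j < n) \sum_(k < n) \sum_(l < n)
    u 0 i * v 0 j * w 0 k * z 0 l *
    \sum_(p < n) G x k p * curvature_op G i j l p x.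

(* The basis vectors are the rows of E. *)
Definition orthonormal_basis (A : 'M[R]_n) E : Prop := E *m A *m E^T = 1%:M.

Definition ricci G x E u v : R :=
  \sum_(k < n) riemann G x u (row k E) v (row k E).

Definition scal G x E : R :=
  \sum_(i < n) ricci G x E (row i E) (row i E).

(* The value at x of the second H. Weyl curvature invariant, computed in the
   orthonormal basis E. *)
Definition h4 G x E : R :=
  \sum_(i < n) \sum_(j < n | (i < j)%N) \sum_(k < n) \sum_(l < n | (k < l)%N)
    riemann G x (row i E) (row j E) (row k E) (row l E) ^+ 2
  - \sum_(i < n) \sum_(j < n) ricci G x E (row i E) (row j E) ^+ 2
  + 4^-1 * scal G x E ^+ 2.

(* The sign does not depend on the basis E. *)
Definition positive_h4_on (A : set 'rV[R]_n) G : Prop :=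
  forall x, A x -> forall E, orthonormal_basis (G x) E -> 0 < h4 G x E.

End Curvature.

Definition positive_h4 (R : realType) (n : nat) (M : manifold R n)
    (g : riemannian_metric M) : Prop :=
  forall i, positive_h4_on (chart_img (atlas i)) (metric g i).

(** * Submanifolds with the induced metric *)

(* A local parametrization of an m-dimensional embedded submanifold S of M
   (the inverse of a chart of S), written in the coordinates of the i-th chart
   of M: an immersion s on the open set V of R^m which is a homeomorphism from
   V onto a relatively open subset of S contained in the domain of that
   chart. *)
Definition local_parametrization (R : realType) (n m : nat) (M : manifold R n)
    (S : set M) (i : atlas_index M) (V : set 'rV[R]_m)
    (s : 'rV[R]_m -> 'rV[R]_n) : Prop :=
  [/\ open V,
      s @` V `<=` chart_img (atlas i),
      smooth_on V s /\ (forall y, V y -> row_free ('J s y)),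
      exists2 r : 'rV[R]_n -> 'rV[R]_m,
        (forall y, V y -> r (s y) = y) & {within s @` V, continuous r} &
      exists2 W : set M, open W &
        [set chart_inv (atlas i) (s y) | y in V] = S `&` W].

(* [pullback s (metric g i)] is the induced metric of S in the coordinates
   given by s. *)
Definition submanifold_positive_h4 (R : realType) (n m : nat)
    (M : manifold R n) (g : riemannian_metric M) (S : set M) : Prop :=
  forall (i : atlas_index M) (V : set 'rV[R]_m) (s : 'rV[R]_m -> 'rV[R]_n),
    local_parametrization S i V s ->
    positive_h4_on V (pullback s (metric g i)).

(* Main.v *)
Require Import Defs.
From HB Require Import structures.
From mathcomp Require Import all_boot all_order all_algebra.
From mathcomp Require Import all_classical all_reals all_analysis.
From mathcomp Require Import ring lra.
Set Implicit Arguments.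
Unset Strict Implicit.
Unset Printing Implicit Defensive.
Import Order.TTheory GRing.Theory Num.Theory.
Import numFieldNormedType.Exports.
Local Open Scope classical_set_scope.
Local Open Scope ring_scope.

(** The metric is found by stretching the base: for s > 0 let g_s be the metric
    g + s f^*g_B, where f : M -> B is the submersion.  The added term vanishes
    on vectors tangent to the fibres, so every g_s induces on the fibres the
    metric that g induces, while distances across the fibres grow with s.  As
    s tends to infinity the curvature of g_s, measured in g_s-orthonormal
    frames, tends to the curvature of the fibre extended by zero, and h_4 of
    g_s tends to h_4 of the fibre, which is positive.  The convergence is
    locally uniform and M is compact, hence h_4 is positive on all of M for one
    large s.

    The limit is computed as follows.  The inverse function theorem
    ([inverse_function]) gives coordinates z = (x, y) near a point of M in
    which f is (x, y) |-> x.  Write s = tau^-2.  The Gram matrix of g_s is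
    G(z) + tau^-2 diag(g_B(x), 0).  Multiply the base vectors of the
    coordinate frame by tau.  The Gram matrix then becomes
    diag(g_B(x), 0) plus G(z) with its base rows and columns multiplied by tau,
    and its first and second derivatives along the rescaled frame are
    polynomials in tau too: the block g_B(x) has derivatives in the directions
    of x only, and each such direction contributes a factor tau.  Hence the whole rescaled 2-jet extends
    continuously to tau = 0, where it is the jet of diag(g_B, fibre metric)
    with all derivatives in base directions removed ([stretched_positive]).

    For this to control h_4, h_4 must be a continuous function of the 2-jet
    (metric, first and second derivatives) that does not see the chosen frame.
    In coordinates, the curvature with all indices lowered is
      1/2 (d_i d_l g_jk - d_i d_k g_jl - d_j d_l g_ik + d_j d_k g_il)
        - <Gamma_ik, Gamma_jl> + <Gamma_jk, Gamma_il>,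
    where Gamma are the Christoffel symbols of the first kind and < , > is the
    pairing by the inverse metric ([riemannE]), and h_4 is a full contraction of
    that tensor with the inverse metric ([h4_orthonormal]).  Such a contraction
    changes under a linear map E only through K |-> E^T K E ([weyl_h4_push]).
    This single fact yields the independence of orthonormal frames, the
    invariance under coordinate changes ([h4_coord_pullback], which also needs
    the tensoriality of the curvature, [riem_form_change]), the effect of the
    rescaling by tau, and the reduction to the fibre at tau = 0
    ([h4jet_change], applied to a matrix that is not square).

    Positivity near each point for all small tau ([local_positive]) and the
    compactness of M then finish the proof. *)

(** * Calculus of C^k maps between open sets *)

Lemma near_open (T : topologicalType) (A : set T) (x : T) :
  open A -> A x -> \forall y \near x, A y.
Proof. by move=> oA Ax; apply: open_nbhs_nbhs; split. Qed.

Section DiffCriterion.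
Context {R : realType} {V W : normedModType R}.

(** Differentiability with a prescribed candidate for the differential, in the
    form in which the chain of estimates of the inverse function theorem
    delivers it. *)
Lemma differentiable_eps (f : V -> W) (x : V) (L : {linear V -> W}) :
  continuous L ->
  (forall e, 0 < e -> \forall h \near (0 : V), `|f (h + x) - f x - L h| <= e * `|h|) ->
  differentiable f x /\ 'd f x = L :> (V -> W).
Proof.
move=> cL H.
have E : f \o shift x = cst (f x) + L +o_ (0 : V) id.
  apply/eqaddoP => e e0; near=> h.
  rewrite /= opprD addrA; near: h.
  exact: H.
have dE := diff_unique cL E; split=> //.
by apply/diff_locallyP; rewrite dE.
Unshelve. all: by end_near. Qed.

Lemma near_eq_differentiable (f g : V -> W) (x : V) :
  (\forall y \near x, f y = g y) -> differentiable f x -> differentiable g x.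
Proof.
move=> fg df; apply: (proj1 (differentiable_eps (L := 'd f x) _ _)).
  exact: diff_continuous.
move=> e e0.
have gx : f x = g x by exact: nbhs_singleton fg.
have /diff_locallyP[_ /eqaddoP/(_ e e0) dfe] := df.
have fg0 : \forall h \near (0 : V), f (h + x) = g (h + x).
  have := fg; rewrite (near_shift 0 x) /=; apply: filterS => h.
  by rewrite /= subr0.
rewrite -gx; near=> h; rewrite -(near fg0 h) //.
have : `|(f \o shift x - (cst (f x) + 'd f x)) h| <= e * `|h| by near: h.
by rewrite /= [X in `|X|](_ : _ = f (h + x) - f x - 'd f x h) // opprD addrA.
Unshelve. all: by end_near. Qed.

End DiffCriterion.

Section CkBasics.
Context {R : realType} {n : nat} {W : normedModType R}.
Implicit Types (A B : set 'rV[R]_n) (f g : 'rV[R]_n -> W).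

Lemma Ck_onS k A f : Ck_on k.+1 A f -> Ck_on k A f.
Proof.
elim: k f => [|k IH] f [df Df].
  by move=> x /df; exact: differentiable_continuous.
by split=> // v; exact: IH.
Qed.

Lemma Ck_on_sub k A B f : A `<=` B -> Ck_on k B f -> Ck_on k A f.
Proof.
move=> AB; elim: k f => [|k IH] f; first by move=> H x /AB/H.
by move=> [df Df]; split=> [x /AB Bx|v]; [exact: df|exact: IH (Df v)].
Qed.

(** Being of class C^k depends only on the values on the open set, since
    derivatives are local; this is how all the closure properties below
    replace a derivative by the formula that computes it. *)
Lemma Ck_on_eq k A f g : open A -> (forall x, A x -> f x = g x) ->
  Ck_on k A f -> Ck_on k A g.
Proof.
move=> oA; elim: k f g => [|k IH] f g fg.
  move=> cf x Ax; have nfg : \forall y \near x, f y = g y.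
    by apply: filterS (near_open oA Ax) => y /fg.
  suff : g @ x --> f x by rewrite (fg _ Ax).
  apply: cvg_trans (cf x Ax). exact: (near_eq_cvg (F := nbhs x) nfg).
move=> [df Df].
have nfg x : A x -> \forall y \near x, f y = g y.
  by move=> Ax; apply: filterS (near_open oA Ax) => y /fg.
split=> [x Ax|v]; first exact: near_eq_differentiable (nfg x Ax) (df x Ax).
by apply: IH (Df v) => x Ax; apply: near_eq_derive; exact: nfg.
Qed.

Lemma Ck_cst k A (a : W) : Ck_on k A (fun=> a).
Proof.
elim: k a => [|k IH] a; first by move=> x _; exact: cst_continuous.
split=> [x _|v]; first exact: differentiable_cst.
have -> : 'D_v (fun=> a) = (fun=> 0) :> ('rV[R]_n -> W); last exact: IH.
by apply/funext => x; exact: derive_cst.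
Qed.

Lemma CkD k A f g : open A -> Ck_on k A f -> Ck_on k A g ->
  Ck_on k A (fun x => f x + g x).
Proof.
move=> oA; elim: k f g => [|k IH] f g.
  by move=> cf cg x Ax; exact: (continuousD (cf x Ax) (cg x Ax)).
move=> [df Df] [dg Dg]; split=> [x Ax|v].
  by apply: differentiableD; [exact: df|exact: dg].
apply: (Ck_on_eq oA _ (IH _ _ (Df v) (Dg v))) => x Ax.
by rewrite deriveD //; apply: diff_derivable; [exact: df|exact: dg].
Qed.

Lemma Ck_sum k A I (r : seq I) (P : pred I) (F : I -> 'rV[R]_n -> W) : open A ->
  (forall i, Ck_on k A (F i)) -> Ck_on k A (fun x => \sum_(i <- r | P i) F i x).
Proof.
move=> oA H; elim: r => [|i r IH].
  by rewrite (_ : (fun x => _) = fun=> 0); [exact: Ck_cst|apply/funext => x; rewrite big_nil].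
rewrite (_ : (fun x => _) = fun x => (if P i then F i x else 0) + \sum_(i <- r | P i) F i x).
  by apply: CkD => //; case: (P i) => //; exact: Ck_cst.
by apply/funext => x; rewrite big_cons; case: (P i) => //; rewrite add0r.
Qed.

Lemma Ck_derive k A f v : Ck_on k.+1 A f -> Ck_on k A ('D_v f).
Proof. by move=> [_]; exact. Qed.

Lemma Ck_differentiable k A f x : Ck_on k.+1 A f -> A x -> differentiable f x.
Proof. by move=> [+ _]; exact. Qed.

Lemma Ck_continuous k A f x : Ck_on k A f -> A x -> {for x, continuous f}.
Proof.
case: k => [|k]; first by move=> + ?; exact.
by move=> H Ax; exact: (differentiable_continuous (Ck_differentiable H Ax)).
Qed.
End CkBasics.

Section CkScalar.
Context {R : realType} {n : nat}.
Implicit Types (A B : set 'rV[R]_n) (f g : 'rV[R]_n -> R^o).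

Lemma CkM k A f g : open A -> Ck_on k A f -> Ck_on k A g ->
  Ck_on k A (fun x => f x * g x : R^o).
Proof.
move=> oA; elim: k f g => [|k IH] f g.
  by move=> cf cg x Ax; exact: (continuousM (cf x Ax) (cg x Ax)).
move=> Cf Cg; have [df Df] := Cf; have [dg Dg] := Cg; split=> [x Ax|v].
  by apply: differentiableM; [exact: df|exact: dg].
apply: (Ck_on_eq oA _ (CkD oA (IH _ _ (Ck_onS Cf) (Dg v)) (IH _ _ (Ck_onS Cg) (Df v)))) => x Ax.
by rewrite [RHS]deriveM //; apply: diff_derivable; [exact: df|exact: dg].
Qed.

Lemma CkN k A f : open A -> Ck_on k A f -> Ck_on k A (fun x => - f x : R^o).
Proof.
move=> oA Cf; apply: (Ck_on_eq oA _ (CkM oA (Ck_cst k A (-1 : R^o)) Cf)) => x _.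
by rewrite mulN1r.
Qed.

Lemma Ck_prod k A I (r : seq I) (P : pred I) (F : I -> 'rV[R]_n -> R^o) : open A ->
  (forall i, Ck_on k A (F i)) ->
  Ck_on k A (fun x => \prod_(i <- r | P i) F i x : R^o).
Proof.
move=> oA H; elim: r => [|i r IH].
  by rewrite (_ : (fun x => _) = fun=> 1); [exact: Ck_cst|apply/funext => x; rewrite big_nil].
rewrite (_ : (fun x => _) = fun x => (if P i then F i x else 1) * \prod_(i <- r | P i) F i x).
  by apply: CkM => //; case: (P i) => //; exact: Ck_cst.
by apply/funext => x; rewrite big_cons; case: (P i) => //; rewrite mul1r.
Qed.

Lemma CkV k A f : open A -> (forall x, A x -> f x != 0) -> Ck_on k A f ->
  Ck_on k A (fun x => (f x)^-1 : R^o).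
Proof.
move=> oA f0; elim: k => [|k IH] Cf.
  by move=> x Ax; exact: (continuousV (f0 x Ax) (Cf x Ax)).
have [df Df] := Cf; split=> [x Ax|v].
  by apply: differentiableV; [exact: df|exact: f0].
have CV := IH (Ck_onS Cf).
apply: (Ck_on_eq oA _ (CkN oA (CkM oA (CkM oA CV CV) (Df v)))) => x Ax.
rewrite [RHS]deriveV //; [|exact: f0|by apply: diff_derivable; exact: df].
by rewrite /GRing.scale /= expr2 invfM mulNr.
Qed.
End CkScalar.

Section CkMatrix.
Context {R : realType} {n : nat}.
Implicit Types (A B : set 'rV[R]_n).

Lemma derive_lin (W W' : normedModType R) (l : {linear W -> W'}) (f : 'rV[R]_n -> W) x v :
  continuous l -> differentiable f x -> 'D_v (l \o f) x = l ('D_v f x).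
Proof.
move=> cl df; have dl : differentiable l (f x) by exact: linear_differentiable.
rewrite deriveE; last exact: differentiable_comp.
by rewrite diff_comp //= diff_lin // deriveE.
Qed.

Lemma Ck_lin (W W' : normedModType R) (l : {linear W -> W'}) k A (f : 'rV[R]_n -> W) :
  open A -> continuous l -> Ck_on k A f -> Ck_on k A (l \o f).
Proof.
move=> oA cl; elim: k f => [|k IH] f.
  by move=> cf x Ax; exact: (continuous_comp (cf x Ax) (cl (f x))).
move=> [df Df]; split=> [x Ax|v].
  by apply: differentiable_comp; [exact: df|exact: linear_differentiable].
apply: (Ck_on_eq oA _ (IH _ (Df v))) => x Ax.
by rewrite derive_lin //; exact: df.
Qed.

Lemma Ck_entry p q k A (F : 'rV[R]_n -> 'M[R]_(p, q)) i j :
  open A -> Ck_on k A F -> Ck_on k A (fun x => F x i j : R^o).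
Proof.
move=> oA CF.
have @l : {linear 'M[R]_(p, q) -> R^o}.
  by exists (fun N : 'M[R]_(_, _) => N i j); do 2![eexists]; do ?[constructor];
     rewrite ?mxE// => ? *; rewrite ?mxE//; move=> ?; rewrite !mxE.
exact: (@Ck_lin _ _ l k A F oA (@coord_continuous _ _ _ i j) CF).
Qed.

Lemma Ck_scalel (W : normedModType R) k A (f : 'rV[R]_n -> R^o) (w : W) :
  open A -> Ck_on k A f -> Ck_on k A (fun x => f x *: w).
Proof.
move=> oA; elim: k f => [|k IH] f.
  by move=> cf x Ax; exact: (continuous_comp (cf x Ax) (@scalel_continuous _ _ w (f x))).
move=> [df Df]; split=> [x Ax|v].
  by apply: differentiableZl; exact: df.
apply: (Ck_on_eq oA _ (IH _ (Df v))) => x Ax.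
have dfx := df x Ax.
by rewrite [RHS]deriveE ?diffZl ?deriveE //; exact: differentiableZl.
Qed.

(** A matrix-valued map is the sum of its entries times constant matrices,
    which reduces its regularity to that of real functions. *)
Lemma Ck_mx p q k A (F : 'rV[R]_n -> 'M[R]_(p, q)) :
  open A -> (forall i j, Ck_on k A (fun x => F x i j : R^o)) -> Ck_on k A F.
Proof.
move=> oA H.
have E : forall x, A x -> \sum_i \sum_j F x i j *: delta_mx i j = F x.
  by move=> x _; rewrite -matrix_sum_delta.
apply: (Ck_on_eq oA E); apply: Ck_sum => // i; apply: Ck_sum => // j.
exact: Ck_scalel.
Qed.

Lemma Ck_mulmx p q r k A (F : 'rV[R]_n -> 'M[R]_(p, q)) (G : 'rV[R]_n -> 'M[R]_(q, r)) :
  open A -> Ck_on k A F -> Ck_on k A G -> Ck_on k A (fun x => F x *m G x).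
Proof.
move=> oA CF CG; apply: Ck_mx => // i j.
rewrite (_ : (fun x => _) = fun x => \sum_l F x i l * G x l j).
  by apply: Ck_sum => // l; apply: CkM => //; exact: Ck_entry.
by apply/funext => x; rewrite mxE.
Qed.

Lemma Ck_trmx p q k A (F : 'rV[R]_n -> 'M[R]_(p, q)) :
  open A -> Ck_on k A F -> Ck_on k A (fun x => (F x)^T).
Proof.
move=> oA CF; apply: Ck_mx => // i j.
rewrite (_ : (fun x => _) = fun x => F x j i); first exact: Ck_entry.
by apply/funext => x; rewrite mxE.
Qed.

Lemma Ck_det p k A (F : 'rV[R]_n -> 'M[R]_p) :
  open A -> (forall i j, Ck_on k A (fun x => F x i j : R^o)) ->
  Ck_on k A (fun x => \det (F x) : R^o).
Proof.
move=> oA CF; rewrite /determinant; apply: Ck_sum => // s.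
by apply: CkM => //; [exact: Ck_cst|apply: Ck_prod].
Qed.

(** Cramer's rule writes the entries of the inverse as polynomials in the
    entries of the matrix divided by its determinant. *)
Lemma Ck_invmx p k A (F : 'rV[R]_n -> 'M[R]_p) :
  open A -> (forall x, A x -> F x \in unitmx) -> Ck_on k A F ->
  Ck_on k A (fun x => invmx (F x)).
Proof.
move=> oA Fu CF.
have E : forall x, A x -> (\det (F x))^-1 *: \adj (F x) = invmx (F x).
  by move=> x Ax; rewrite /invmx Fu.
apply: (Ck_on_eq oA E); apply: Ck_mx => // i j.
rewrite (_ : (fun x => _) = fun x => (\det (F x))^-1 * cofactor (F x) j i); last first.
  by apply/funext => x; rewrite !mxE.
apply: CkM => //.
  apply: CkV => //; last by apply: Ck_det => // *; exact: Ck_entry.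
  by move=> x /Fu; rewrite unitmxE unitfE.
apply: CkM => //; first exact: Ck_cst.
apply: Ck_det => // a b.
rewrite (_ : (fun x => _) = fun x => F x (lift j a) (lift i b)); first exact: Ck_entry.
by apply/funext => x; rewrite !mxE.
Qed.

Lemma derive_coordE (W : normedModType R) (f : 'rV[R]_n -> W) x v :
  differentiable f x -> 'D_v f x = \sum_a v 0 a *: 'D_(delta_mx 0 a) f x.
Proof.
move=> df; rewrite deriveE // {1}[v]row_sum_delta linear_sum.
by apply: eq_bigr => a _; rewrite linearZ deriveE.
Qed.

Lemma derive_entry p q (F : 'rV[R]_n -> 'M[R]_(p, q)) x v i j :
  differentiable F x -> 'D_v F x i j = 'D_v (fun y => F y i j : R^o) x.
Proof. by move=> dF; rewrite derive_mx ?mxE //; exact: diff_derivable. Qed.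

Lemma row_jacobian p (F : 'rV[R]_n -> 'rV[R]_p) x i :
  differentiable F x -> row i ('J F x) = 'D_(delta_mx 0 i) F x.
Proof. by move=> dF; rewrite deriveEjacobian // rowE. Qed.

Lemma jacobianE p (F : 'rV[R]_n -> 'rV[R]_p) x i j :
  differentiable F x -> 'J F x i j = partial i (fun y => F y 0 j) x.
Proof. by move=> dF; rewrite /partial -derive_entry // -row_jacobian // [RHS]mxE. Qed.

Lemma Ck_jacobian p k A (F : 'rV[R]_n -> 'rV[R]_p) :
  open A -> Ck_on k.+1 A F -> Ck_on k A (fun x => 'J F x).
Proof.
move=> oA CF; apply: Ck_mx => // i j.
have E : forall x, A x -> ('D_(delta_mx 0 i) F x) 0 j = 'J F x i j.
  by move=> x Ax; rewrite -row_jacobian ?mxE //; exact: Ck_differentiable CF Ax.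
by apply: (Ck_on_eq oA E); apply: Ck_entry => //; exact: Ck_derive.
Qed.

End CkMatrix.

Section CkComp.
Context {R : realType} {p n : nat}.

Lemma derive_comp_rV (W : normedModType R) (phi : 'rV[R]_p -> 'rV[R]_n) (f : 'rV[R]_n -> W) y v :
  differentiable phi y -> differentiable f (phi y) ->
  'D_v (fun y => f (phi y)) y = \sum_a ('D_v phi y) 0 a *: 'D_(delta_mx 0 a) f (phi y).
Proof.
move=> dphi df; rewrite -[fun y => _]/(f \o phi) deriveE; last exact: differentiable_comp.
by rewrite diff_comp //= -deriveE // -deriveE // derive_coordE.
Qed.

Lemma jacobian_comp q (phi : 'rV[R]_p -> 'rV[R]_n) (f : 'rV[R]_n -> 'rV[R]_q) y :
  differentiable phi y -> differentiable f (phi y) ->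
  'J (fun y => f (phi y)) y = 'J phi y *m 'J f (phi y).
Proof.
move=> dphi df; apply/row_matrixP => i.
rewrite row_jacobian; last exact: (differentiable_comp dphi df).
by rewrite derive_comp_rV // row_mul row_jacobian // -derive_coordE // deriveEjacobian.
Qed.

(** By induction on k: the chain rule expresses a directional derivative of the
    composite by products of derivatives of the inner map and composites of
    partial derivatives of the outer one, which are of class C^k-1. *)
Lemma Ck_comp_scalar k B A (phi : 'rV[R]_p -> 'rV[R]_n) (f : 'rV[R]_n -> R^o) :
  open B -> (forall y, B y -> A (phi y)) -> Ck_on k B phi -> Ck_on k A f ->
  Ck_on k B (fun y => f (phi y)).
Proof.
move=> oB BA; elim: k f => [|k IH] f.
  by move=> cphi cf y By; exact: (continuous_comp (cphi y By) (cf _ (BA y By))).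
move=> Cphi [df Df]; have [dphi Dphi] := Cphi; split=> [y By|v].
  by apply: differentiable_comp; [exact: dphi|exact/df/BA].
have E : forall y, B y -> \sum_a ('D_v phi y) 0 a * 'D_(delta_mx 0 a) f (phi y) =
    'D_v (fun y => f (phi y)) y.
  by move=> y By; rewrite derive_comp_rV //; [exact: dphi|exact/df/BA].
apply: (Ck_on_eq oB E); apply: Ck_sum => // a; apply: CkM => //.
  exact: (Ck_entry 0 a oB (Ck_derive v Cphi)).
exact: (IH _ (Ck_onS Cphi) (Df _)).
Qed.

Lemma Ck_comp_mx k B A (phi : 'rV[R]_p -> 'rV[R]_n) q r (f : 'rV[R]_n -> 'M[R]_(q, r)) :
  open B -> open A -> (forall y, B y -> A (phi y)) -> Ck_on k B phi -> Ck_on k A f ->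
  Ck_on k B (fun y => f (phi y)).
Proof.
move=> oB oA BA Cphi Cf; apply: Ck_mx => // i j.
exact: (@Ck_comp_scalar k B A phi (fun x => f x i j) oB BA Cphi (Ck_entry i j oA Cf)).
Qed.
End CkComp.

(** * Symmetry of second derivatives *)

Section Schwarz.
Context {R : realType} {n : nat}.
Implicit Types (A : set 'rV[R]_n) (f : 'rV[R]_n -> R^o).

Lemma near_dist (V W : normedModType R) (f : V -> W) x e :
  {for x, continuous f} -> 0 < e -> \forall y \near x, `|f x - f y| <= e.
Proof. by move=> cf e0; move/cvgrPdist_le : cf; apply. Qed.

Lemma near_norm (V : normedModType R) (P : set V) (x : V) :
  nbhs x P -> exists2 r, 0 < r & forall y, `|y - x| < r -> P y.
Proof.
move=> /nbhs_ballP[r /= r0 H]; exists r => // y yx; apply: H.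
by rewrite -ball_normE /= distrC.
Qed.

(** The one-variable mean value theorem along a segment. The segment is
    parametrized by t in [0, 1] with a separate factor s of arbitrary sign,
    so that increments in negative directions need no separate treatment. *)
Lemma line_MVT f (a w : 'rV[R]_n) (s : R) :
  (forall t, 0 <= t <= 1 -> differentiable f (a + (t * s) *: w)) ->
  exists2 t, 0 <= t <= 1 & f (a + s *: w) - f a = s * 'D_w f (a + (t * s) *: w).
Proof.
move=> df; pose line (t : R) := a + (t * s) *: w.
have dline t : is_diff t line ( *:%R ^~ (s *: w)).
  have -> : line = cst a + ( *:%R ^~ (s *: w)).
    by apply/funext => z; rewrite /line -scalerA.
  have := is_diffD (is_diff_cst a t) (is_diff_scalel t (s *: w)).
  by rewrite add0r.
have dh (t : R) : t \in `]0, 1[ ->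
    is_derive t 1 (f \o line : R -> R) (s * 'D_w f (line t)).
  rewrite in_itv /= => /andP[t0 t1].
  have dfl : differentiable f (line t) by apply: df; rewrite !ltW.
  have dl : differentiable line t by [].
  have dc : differentiable (f \o line) t by exact: differentiable_comp.
  apply: DeriveDef; first exact: diff_derivable.
  rewrite deriveE // diff_comp //= (@diff_val _ _ _ _ _ _ _ (dline t)) scale1r.
  by rewrite linearZ deriveE.
have [|t t01 E] := @MVT_segment R (f \o line) _ 0 1 ler01 dh.
  apply: continuous_in_subspaceT => t; rewrite inE /= in_itv /= => t01.
  apply: differentiable_continuous; apply: differentiable_comp => //.
  exact: df.
exists t; first by move: t01; rewrite in_itv.
by move: E; rewrite /= /line mul1r mul0r scale0r addr0 subr0 mulr1.
Qed.

Lemma derive_translate f (u c y : 'rV[R]_n) : 'D_u (fun z => f (z + c)) y = 'D_u f (y + c).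
Proof.
rewrite /derive.
have -> : (fun h : R => h^-1 *: (((fun z => f (z + c)) \o shift y) (h *: u) - f (y + c))) =
    (fun h => h^-1 *: ((f \o shift (y + c)) (h *: u) - f (y + c))).
  by apply/funext => h /=; rewrite addrA.
by [].
Qed.

(** Two applications of the mean value theorem: to the difference z |-> f (z +
    s v) - f z in the direction u, then to the derivative of f in the
    direction u along v. The left-hand side is symmetric in u and v, which
    is what makes mixed derivatives commute. *)
Lemma second_difference A f (x u v : 'rV[R]_n) (s : R) : open A -> Ck_on 2 A f ->
  (forall a b : R, `|a| <= `|s| -> `|b| <= `|s| -> A (x + a *: u + b *: v)) ->
  exists a b : R, [/\ `|a| <= `|s|, `|b| <= `|s| &
    f (x + s *: u + s *: v) - f (x + s *: u) - (f (x + s *: v) - f x) =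
    s * (s * 'D_v ('D_u f) (x + a *: u + b *: v))].
Proof.
move=> oA Cf Axy; pose g y : R^o := f (y + s *: v) - f y.
(* The point of the segment with parameter t corresponds to the coefficient t
   s of u or v. *)
have ts t : 0 <= t <= 1 -> `|t * s| <= `|s|.
  by move=> /andP[t0 t1]; rewrite normrM (ger0_norm t0) ler_piMl.
have s0 : `|0 : R| <= `|s| by rewrite normr0.
have df z : A z -> differentiable f z by exact: Ck_differentiable Cf.
have dfs z : A (z + s *: v) -> differentiable (fun y => f (y + s *: v)) z.
  move=> Az; apply: (@differentiable_comp _ _ _ _ (fun y => y + s *: v) f) => //.
  by apply: df.
have A1 t : 0 <= t <= 1 -> A (x + (t * s) *: u + s *: v).
  by move=> t01; apply: Axy => //; exact: ts.
have A0 t : 0 <= t <= 1 -> A (x + (t * s) *: u).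
  by move=> t01; rewrite -[_ + _]addr0 -(scale0r v); apply: Axy => //; exact: ts.
have [t t01|t t01 E] := @line_MVT g x u s.
  by apply: differentiableB; [apply/dfs/A1|apply/df/A0].
have [t' t01'|t' t01' E'] := @line_MVT ('D_u f) (x + (t * s) *: u) v s.
  by apply: (Ck_differentiable (Ck_derive u Cf)); apply: Axy; exact: ts.
exists (t * s), (t' * s); split; [exact: ts|exact: ts|].
rewrite -E' -derive_translate -deriveB; last 2 first.
- by apply: diff_derivable; apply/dfs/A1.
- by apply: diff_derivable; apply/df/A0.
rewrite -[X in s * X]/('D_u g (x + (t * s) *: u)) -E /g.
by [].
Qed.

(** Schwarz's theorem. The second difference of f along u and v equals s^2
    times either mixed derivative at two points close to x; both mixed
    derivatives are continuous at x, hence they agree there up to any e >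
    0. *)
Lemma derive_comm A f x u v : open A -> A x -> Ck_on 2 A f ->
  'D_u ('D_v f) x = 'D_v ('D_u f) x.
Proof.
move=> oA Ax Cf; apply/eqP; rewrite -subr_eq0 -normr_le0; apply/ler_addgt0Pr => e e0.
rewrite add0r.
have c1 : {for x, continuous ('D_u ('D_v f))}.
  exact: (Ck_continuous (Ck_derive u (Ck_derive v Cf)) Ax).
have c2 : {for x, continuous ('D_v ('D_u f))}.
  exact: (Ck_continuous (Ck_derive v (Ck_derive u Cf)) Ax).
have e2 : 0 < e / 2 by rewrite divr_gt0.
have n1 := near_dist c1 e2.
have n2 := near_dist c2 e2.
have [r /= r0 Br] : exists2 r, 0 < r & forall y, `|y - x| < r ->
   [/\ A y, `|'D_u ('D_v f) x - 'D_u ('D_v f) y| <= e / 2 &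
       `|'D_v ('D_u f) x - 'D_v ('D_u f) y| <= e / 2].
  have [r r0 H] := near_norm (filterI (near_open oA Ax) (filterI n1 n2)).
  exists r; first exact: r0.
  move=> y yx; have [Ay [H1 H2]] := H y yx.
  by split; [exact Ay|exact H1|exact H2].
(* Small enough for all points x + a u + b v with |a|, |b| <= s to stay within
   distance r of x. *)
pose s := r / (2 * (1 + `|u| + `|v|)).
have D0 : 0 < 1 + `|u| + `|v| by rewrite ltr_pwDl // addr_ge0 //.
have s0 : 0 < s by rewrite divr_gt0 // mulr_gt0.
have near_x u' v' a b : `|u'| + `|v'| = `|u| + `|v| -> `|a| <= `|s| -> `|b| <= `|s| ->
    `|x + a *: u' + b *: v' - x| < r.
  move=> uv as_ bs.
  have -> : x + a *: u' + b *: v' - x = a *: u' + b *: v'.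
    by rewrite addrAC (addrC x) addrK.
  apply: (le_lt_trans (ler_normD _ _)); rewrite !normrZ.
  apply: (@le_lt_trans _ _ (s * (`|u'| + `|v'|))).
    rewrite mulrDr lerD // ler_wpM2r // -(gtr0_norm s0) //.
  rewrite uv /s mulrAC ltr_pdivrMr ?mulr_gt0 //.
  by rewrite ltr_pM2l //; have := normr_ge0 u; have := normr_ge0 v; lra.
have [a b as_ bs|a [b [as_ bs E]]] := @second_difference A f x u v s oA Cf.
  by have [] := Br _ (near_x u v a b erefl as_ bs).
have [a' b' as' bs'|a' [b' [as' bs' E']]] := @second_difference A f x v u s oA Cf.
  by have [] := Br _ (near_x v u a' b' (addrC _ _) as' bs').
have [_ _ H2] := Br _ (near_x u v a b erefl as_ bs).
have [_ H1 _] := Br _ (near_x v u a' b' (addrC _ _) as' bs').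
have EE : 'D_v ('D_u f) (x + a *: u + b *: v) = 'D_u ('D_v f) (x + a' *: v + b' *: u).
  apply: (mulfI (lt0r_neq0 s0)); apply: (mulfI (lt0r_neq0 s0)).
  have swap (z1 z2 z3 z4 : R) : z1 - z2 - (z3 - z4) = z1 - z3 - (z2 - z4) by ring.
  refine (etrans (esym E) (etrans _ E')).
  rewrite [x + s *: v + s *: u]addrAC; exact: swap.
move: H1 H2; rewrite EE.
have tri (p q z : R) : `|p - z| <= e / 2 -> `|q - z| <= e / 2 -> `|p - q| <= e.
  move=> pz qz; rewrite distrC in qz; rewrite (splitr e); apply: le_trans (lerD pz qz).
  by apply: le_trans (ler_normD _ _); rewrite addrA subrK.
exact: tri.
Qed.

End Schwarz.

(** * The smooth inverse function theorem *)

Lemma near_forall (T : topologicalType) (x : T) (I : finType) (P : I -> T -> Prop) :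
  (forall i, \forall y \near x, P i y) -> \forall y \near x, forall i, P i y.
Proof. exact: (@filter_forall T I P (nbhs x) (nbhs_filter x)). Qed.

Lemma CkB (R : realType) (n : nat) (W : normedModType R) k (A : set 'rV[R]_n)
    (f g : 'rV[R]_n -> W) : open A -> Ck_on k A f -> Ck_on k A g ->
  Ck_on k A (fun x => f x - g x).
Proof.
move=> oA; elim: k f g => [|k IH] f g.
  by move=> cf cg x Ax; exact: (continuousB (cf x Ax) (cg x Ax)).
move=> [df Df] [dg Dg]; split=> [x Ax|v].
  by apply: differentiableB; [exact: df|exact: dg].
apply: (Ck_on_eq oA _ (IH _ _ (Df v) (Dg v))) => x Ax.
by rewrite deriveB //; apply: diff_derivable; [exact: df|exact: dg].
Qed.

Section InverseFunction.
Context {R : realType} {n : nat}.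
Implicit Types (A U V : set 'rV[R]_n) (F : 'rV[R]_n -> 'rV[R]_n).

Lemma smooth_id A : smooth_on A (id : 'rV[R]_n -> 'rV[R]_n).
Proof.
case=> [|k]; first by move=> x _; exact: cvg_id.
split=> [x _|v]; first by have [] := is_diff_id x.
have -> : 'D_v id = (fun=> v) :> ('rV[R]_n -> 'rV[R]_n).
  by apply/funext => x; exact: derive_id.
exact: Ck_cst.
Qed.

Lemma mulmxr_continuous p (M : 'M[R]_(n, p)) : continuous (mulmxr M : 'rV[R]_n -> 'rV[R]_p).
Proof.
move=> x; have C0 := Ck_mulmx openT (@smooth_id setT 0%N) (Ck_cst 0 setT M).
exact: (C0 x I).
Qed.

Lemma mulmxr_bounded p (M : 'M[R]_(n, p)) :
  exists2 k, 0 < k & forall v : 'rV[R]_n, `|v *m M| <= k * `|v|.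
Proof. exact: (linear_lipschitz (@mulmxr_continuous p M)). Qed.

Lemma entry_le_norm (v : 'rV[R]_n) i : `|v 0 i| <= `|v|.
Proof.
rewrite [leRHS]/Num.norm /= mx_normrE.
exact: (le_bigmax _ (fun ij : 'I_1 * 'I_n => `|v ij.1 ij.2|) (0, i)).
Qed.

Lemma norm_le_entries (v : 'rV[R]_n) e : 0 <= e -> (forall i, `|v 0 i| <= e) -> `|v| <= e.
Proof.
move=> e0 H; rewrite [leLHS]/Num.norm /= mx_normrE; apply: bigmax_le => // -[i j] _ /=.
by rewrite ord1.
Qed.

(** If the differential vanishes at x0, the partial derivatives are small near
    x0, and the mean value theorem applied to each entry gives a Lipschitz
    constant 1/2. *)
Lemma contraction_near A F x0 : open A -> A x0 -> Ck_on 1 A F ->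
  (forall v, 'D_v F x0 = 0) ->
  exists2 r, 0 < r & (forall x, `|x - x0| <= r -> A x) /\
    forall x y, `|x - x0| <= r -> `|y - x0| <= r -> `|F y - F x| <= 2^-1 * `|y - x|.
Proof.
move=> oA Ax0 CF F0.
(* Each entry of the increment is a sum of n terms, each at most e |y - x|. *)
pose e : R := (2 * n.+1%:R)^-1.
have e0 : 0 < e by rewrite invr_gt0 mulr_gt0.
have near_small : \forall x \near x0, forall j, `|'D_(delta_mx 0 j) F x| <= e.
  apply: near_forall => j.
  have c : {for x0, continuous ('D_(delta_mx 0 j) F)}.
    exact: (Ck_continuous (Ck_derive _ CF) Ax0).
  apply: filterS (near_dist c e0) => x.
  by rewrite F0 sub0r normrN.
have [r0 r00 H] := near_norm (filterI (near_open oA Ax0) near_small).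
exists (r0 / 2); first by rewrite divr_gt0.
have lt_r x : `|x - x0| <= r0 / 2 -> `|x - x0| < r0.
  by move=> h; apply: le_lt_trans h _; lra.
split=> [x /lt_r/H[]//|x y xr yr].
apply: norm_le_entries; first by rewrite mulr_ge0.
move=> i; pose f z : R^o := F z 0 i.
have inA t : 0 <= t <= 1 -> `|x + (t * 1) *: (y - x) - x0| < r0.
  move=> /andP[t0 t1]; apply: lt_r; rewrite mulr1.
  have -> : x + t *: (y - x) - x0 = (1 - t) *: (x - x0) + t *: (y - x0).
    rewrite !scalerBr !scalerBl !scale1r.
    apply/rowP => l; rewrite !mxE; ring.
  have -> : r0 / 2 = (1 - t) * (r0 / 2) + t * (r0 / 2) by ring.
  apply: (le_trans (ler_normD _ _)); rewrite !normrZ (ger0_norm t0) ger0_norm ?subr_ge0 //.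
  by apply: lerD; apply: ler_wpM2l => //; rewrite subr_ge0.
have dF z : `|z - x0| < r0 -> differentiable F z.
  by move=> /H[Az _]; exact: Ck_differentiable CF Az.
have df z : `|z - x0| < r0 -> differentiable f z.
  move=> /dF dFz; apply: (@differentiable_comp _ _ _ _ F (fun N : 'rV[R]_n => N 0 i : R^o)) => //.
  exact: differentiable_coord.
have [t t01|t t01] := @line_MVT R n f x (y - x) 1; first exact/df/inA.
rewrite scale1r (addrC x (y - x)) subrK mul1r /f => E.
have -> : (F y - F x) 0 i = F y 0 i - F x 0 i by rewrite !mxE.
rewrite E; set z := x + _; have zr : `|z - x0| < r0 by exact: inA.
rewrite -derive_entry; last exact: dF.
rewrite derive_coordE; last exact: dF.
rewrite summxE; apply: (le_trans (ler_norm_sum _ _ _)).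
have le_term (j : 'I_n) : `|((y - x) 0 j *: 'D_(delta_mx 0 j) F z) 0 i| <= `|y - x| * e.
  rewrite mxE normrM; apply: ler_pM => //; first exact: entry_le_norm.
  by apply: le_trans (entry_le_norm _ _) _; have [_] := H _ zr; exact.
apply: (@le_trans _ _ (\sum_(j < n) `|y - x| * e)); first by apply: ler_sum => j _; exact: le_term.
have -> : \sum_(j < n) `|y - x| * e = n%:R * e * `|y - x|.
  by rewrite sumr_const card_ord -[RHS]mulrA mulr_natl (mulrC e).
apply: ler_wpM2r => //; rewrite /e invfM mulrCA ler_piMr //.
by rewrite ler_pdivrMr // mul1r ler_nat leqnSn.
Qed.

Lemma open_neq0 A (g : 'rV[R]_n -> R^o) : open A -> Ck_on 0 A g ->
  open [set x | A x /\ g x != 0].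
Proof.
move=> oA Cg; rewrite openE => x [Ax gx0].
have gx : 0 < `|g x| / 2 by rewrite divr_gt0 // normr_gt0.
apply: filterS (filterI (near_open oA Ax) (near_dist (Cg x Ax) gx)) => y [Ay H]; split=> //.
apply/eqP => gy0; move: H; rewrite gy0 subr0 => H.
have half (a : R) : 0 < a / 2 -> a <= a / 2 -> False by lra.
exact: half gx H.
Qed.

(** Let G be F followed by the inverse of its differential at x0. Then x |-> x
    - G x has zero differential at x0, so it contracts by 1/2 on a closed
    ball; this makes F injective there, with a Lipschitz inverse. A
    preimage of a nearby value is found as a minimum of the defect on the
    compact ball: a step of the contraction would decrease a nonzero
    minimum. *)
Lemma local_inverse A F x0 : open A -> A x0 -> Ck_on 1 A F -> 'J F x0 \in unitmx ->
  exists U V (Psi : 'rV[R]_n -> 'rV[R]_n),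
    [/\ open U, U x0, U `<=` A & open V] /\
    [/\ forall x, U x -> V (F x) /\ Psi (F x) = x,
        forall y, V y -> U (Psi y) /\ F (Psi y) = y &
        exists2 C, 0 < C & forall y z, V y -> V z -> `|Psi y - Psi z| <= C * `|y - z|].
Proof.
move=> oA Ax0 CF uJ; set J := 'J F x0 in uJ *.
have dF x : A x -> differentiable F x by exact: Ck_differentiable CF.
pose G x := F x *m invmx J.
have CG : Ck_on 1 A G by apply: Ck_mulmx => //; exact: Ck_cst.
pose phi x := x - G x.
have Cphi : Ck_on 1 A phi.
  exact: (CkB oA (@smooth_id A 1%N) CG).
have phi0 v : 'D_v phi x0 = 0.
  have dG : differentiable G x0 by exact: Ck_differentiable CG Ax0.
  have -> : phi = id - G by apply/funext.
  rewrite deriveB; [|by apply: diff_derivable; have [] := is_diff_id x0|exact: diff_derivable].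
  rewrite derive_id.
  have -> : 'D_v G x0 = 'D_v F x0 *m invmx J.
    exact: (@derive_lin _ _ _ _ (mulmxr (invmx J)) F x0 v (@mulmxr_continuous _ _) (dF _ Ax0)).
  rewrite deriveEjacobian; last exact: dF.
  by rewrite -/J mulmxK // subrr.
have [r r0 [Br Lip]] := contraction_near oA Ax0 Cphi phi0.
have Gexp x y : `|x - x0| <= r -> `|y - x0| <= r -> `|y - x| <= 2 * `|G y - G x|.
  move=> xr yr; have := Lip _ _ xr yr.
  have E : y - x = (phi y - phi x) + (G y - G x).
    by rewrite /phi; apply/rowP => i; rewrite !mxE; ring.
  have := ler_normD (phi y - phi x) (G y - G x); rewrite -E; lra.
have Fexp x y : `|x - x0| <= r -> `|y - x0| <= r -> F x = F y -> x = y.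
  move=> xr yr FE; apply/eqP; rewrite -subr_eq0 -normr_le0.
  by apply: le_trans (Gexp _ _ yr xr) _; rewrite /G FE subrr normr0 mulr0.
pose V := [set y : 'rV[R]_n | `|y *m invmx J - G x0| < r / 4].
pose U := [set x | `|x - x0| < r /\ V (F x)].
have r4 : 0 < r / 4 by rewrite divr_gt0.
have surj y : V y -> exists x, U x /\ F x = y.
  move=> Vy; set y' := y *m invmx J.
  pose B := [set x : 'rV[R]_n | `|x - x0| <= r].
  have cB : compact B.
    apply: bounded_closed_compact.
      exists (`|x0| + r); split; first by rewrite num_real.
      move=> M hM x xB; apply/ltW/(le_lt_trans _ hM).
      rewrite -[x](subrK x0) addrC; apply: (le_trans (ler_normD _ _)).
      by rewrite lerD2l.
    have -> : B = closed_ball x0 r.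
      by rewrite closed_ballE //; apply/seteqP; split=> x; rewrite /B /closed_ball_ /= distrC.
    exact: closed_ball_closed.
  have B0 : B !=set0 by exists x0; rewrite /B /= subrr normr0 ltW.
  pose N x := `|G x - y'|.
  have cN : {within B, continuous N}.
    apply: continuous_in_subspaceT => x; rewrite inE => xB.
    have cG : {for x, continuous G} by exact: Ck_continuous CG (Br _ xB).
    have cGy : {for x, continuous (fun z => G z - y')}.
      exact: (Ck_continuous (CkB oA CG (Ck_cst 1 A y')) (Br _ xB)).
    exact: (continuous_comp cGy (@norm_continuous _ _ (G x - y'))).
  have [x xB xmin] := EVT_min_rV B0 cB cN.
  rewrite inE in xB.
  (* One step of the contraction from the minimum x: it stays in the ball and
     at least halves the defect |G x - y'|. *)
  pose x' := phi x + y'.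
  have x'x : x' - x0 = (phi x - phi x0) + (y' - G x0).
    by rewrite /x' /phi; apply/rowP => i; rewrite !mxE; ring.
  have x'r : `|x' - x0| < r.
    rewrite x'x; apply: (le_lt_trans (ler_normD _ _)).
    have := Lip x0 x; rewrite subrr normr0 => /(_ (ltW r0) xB) h1.
    have h2 : `|y' - G x0| < r / 4 by exact: Vy.
    have h3 : `|x - x0| <= r by exact: xB.
    lra.
  have e' : G x' - y' = phi x - phi x'.
    by rewrite {2}/phi /x'; apply/rowP => i; rewrite !mxE; ring.
  have e'' : x' - x = - (G x - y').
    by rewrite /x' /phi; apply/rowP => i; rewrite !mxE; ring.
  have Nx : N x <= 2^-1 * N x.
    have /(_ _)h := xmin x'; apply: le_trans (h _) _; first by rewrite inE; exact: ltW.
    by have := Lip _ _ (ltW x'r) xB; rewrite -e' (distrC x) e'' normrN.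
  have N0 : `|G x - y'| = 0.
    by apply/eqP; rewrite eq_le normr_ge0 andbT; move: Nx; rewrite /N; have := normr_ge0 (G x - y'); lra.
  have Gx : G x = y' by apply/eqP; rewrite -subr_eq0 -normr_eq0 N0.
  have Fx : F x = y by rewrite -[LHS](mulmxKV uJ) -/(G x) Gx /y' mulmxKV.
  exists x; split=> //; split; last by rewrite Fx.
  have -> : x = x' by apply/eqP; rewrite eq_sym -subr_eq0 e'' Gx subrr oppr0.
  exact: x'r.
pose Psi y := get [set x | U x /\ F x = y].
have PsiP y : V y -> U (Psi y) /\ F (Psi y) = y.
  by move=> /surj exx; exact: (getPex (P := [set x | U x /\ F x = y]) exx).
exists U, V, Psi; split; split.
- rewrite openE => x [xr Vx]; have Ax := Br _ (ltW xr).
  have cG : {for x, continuous G} by exact: Ck_continuous CG Ax.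
  have d1 : 0 < (r - `|x - x0|) / 2 by rewrite divr_gt0 // subr_gt0.
  have Vx' : `|G x - G x0| < r / 4 by exact: Vx.
  have d2 : 0 < (r / 4 - `|G x - G x0|) / 2 by rewrite divr_gt0 // subr_gt0.
  have near1 := near_dist (f := id) (x := x) cvg_id d1.
  apply: filterS (filterI near1 (near_dist cG d2)) => y [/= h1 h2]; split.
    have : `|y - x0| <= `|x - y| + `|x - x0|.
      by rewrite (distrC x y); apply: le_trans (ler_normD _ _); rewrite addrA subrK.
    by move: h1 d1; lra.
  rewrite /V /= -/(G y).
  have : `|G y - G x0| <= `|G x - G y| + `|G x - G x0|.
    by rewrite (distrC (G x) (G y)); apply: le_trans (ler_normD _ _); rewrite addrA subrK.
  by move: h2 d2; lra.
- by split; rewrite /V /= /G subrr normr0.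
- by move=> x [xr _]; apply: Br; exact: ltW.
- rewrite openE => y Vy; have Vy' : `|y *m invmx J - G x0| < r / 4 by exact: Vy.
  have d2 : 0 < (r / 4 - `|y *m invmx J - G x0|) / 2 by rewrite divr_gt0 // subr_gt0.
  apply: filterS (near_dist (@mulmxr_continuous _ (invmx J) y) d2) => z /= h2.
  rewrite /V /=.
  have : `|z *m invmx J - G x0| <= `|y *m invmx J - z *m invmx J| + `|y *m invmx J - G x0|.
    by rewrite (distrC (y *m _) (z *m _)); apply: le_trans (ler_normD _ _); rewrite addrA subrK.
  by move: h2 d2; lra.
- move=> x Ux; have Vx : V (F x) by case: Ux.
  split=> //; have [[h1 _] h2] := PsiP _ Vx.
  by apply: Fexp => //; apply: ltW => //; case: Ux.
- exact: PsiP.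
- have [k k0 kP] := mulmxr_bounded (invmx J).
  exists (2 * k); first by rewrite mulr_gt0.
  move=> y z Vy Vz; have [[h1 _] h2] := PsiP _ Vy; have [[h3 _] h4] := PsiP _ Vz.
  apply: le_trans (Gexp _ _ (ltW h3) (ltW h1)) _.
  by rewrite -mulrA ler_pM2l // /G h2 h4 -mulmxBl.
Qed.

End InverseFunction.

Lemma near0_norm (R : realType) (V : normedModType R) (r : R) :
  0 < r -> \forall h \near (0 : V), `|h| < r.
Proof.
move=> r0; apply/nbhs_ballP; exists r => //= h.
by rewrite -ball_normE /= sub0r normrN.
Qed.

Section SmoothInverse.
Context {R : realType} {n : nat}.
Implicit Types (A U V : set 'rV[R]_n) (F : 'rV[R]_n -> 'rV[R]_n).

(** A Lipschitz bound for the inverse turns the first-order expansion of F at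
    the point Psi y into the first-order expansion of Psi at y. *)
Lemma inverse_differentiable V F (Psi : 'rV[R]_n -> 'rV[R]_n) y C :
  open V -> V y -> 0 < C ->
  (forall y, V y -> F (Psi y) = y) ->
  (forall y z, V y -> V z -> `|Psi y - Psi z| <= C * `|y - z|) ->
  differentiable F (Psi y) -> 'J F (Psi y) \in unitmx ->
  differentiable Psi y /\ 'J Psi y = invmx ('J F (Psi y)).
Proof.
move=> oV Vy C0 FPsi Lip dF uJ; set x := Psi y in dF uJ *; set J := 'J F x in uJ *.
pose L := mulmxr (invmx J) : {linear 'rV[R]_n -> 'rV[R]_n}.
have [K K0 KP] := mulmxr_bounded (invmx J).
have [|dPsi dE] := @differentiable_eps R _ _ Psi y L (@mulmxr_continuous _ _ _ (invmx J)).
  move=> e e0; pose eta := e / (K * C).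
  have eta0 : 0 < eta by rewrite divr_gt0 // mulr_gt0.
  have /diff_locallyP[_ /eqaddoP/(_ eta eta0) dFe] := dF.
  have [r r0 Hr] := near_norm dFe.
  have [r' r'0 Hr'] := near_norm (near_open oV Vy).
  have nh : \forall h \near (0 : 'rV[R]_n), `|h| < r / C /\ `|h| < r'.
    have rC : 0 < r / C by rewrite divr_gt0.
    exact: (filterI (near0_norm 'rV[R]_n rC) (near0_norm 'rV[R]_n r'0)).
  apply: filterS nh => h [h1 h2].
  have Vh : V (h + y) by apply: Hr'; rewrite addrK.
  set k := Psi (h + y) - x.
  have kC : `|k| <= C * `|h|.
    by have := Lip _ _ Vh Vy; rewrite addrK.
  have kr : `|k - 0| < r.
    by rewrite subr0; apply: le_lt_trans kC _; rewrite mulrC -ltr_pdivlMr.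
  have := Hr k kr.
  rewrite [X in `|X|](_ : _ = h - k *m J); last first.
    transitivity (F (k + x) - (F x + 'd F x k)); first by [].
    have -> : 'd F x k = k *m J by rewrite -deriveEjacobian // deriveE.
    by rewrite /k subrK FPsi // /x FPsi // opprD addrA addrK.
  move=> Hk.
  have -> : k - L h = - ((h - k *m J) *m invmx J).
    by rewrite mulmxBl mulmxK // opprB.
  rewrite normrN; apply: le_trans (KP _) _.
  apply: (@le_trans _ _ (K * (eta * (C * `|h|)))).
    rewrite ler_pM2l //; apply: le_trans Hk _.
    by rewrite ler_pM2l.
  rewrite /eta -mulrA !mulrA [leLHS](_ : _ = e * `|h|) //.
  by field; rewrite ?gt_eqF.
split=> //; apply/row_matrixP => i; rewrite row_jacobian // deriveE // dE /=.
by rewrite rowE.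
Qed.

(** The neighbourhood is first shrunk so that the Jacobian matrix of F stays
    invertible. Smoothness of the inverse map Psi follows by induction,
    because its derivative is the inverse matrix of 'J F composed with Psi,
    hence as regular as Psi itself. *)
Theorem inverse_function A F x0 : open A -> A x0 -> smooth_on A F ->
  'J F x0 \in unitmx ->
  exists U V (Psi : 'rV[R]_n -> 'rV[R]_n),
    [/\ open U, U x0, U `<=` A & open V] /\
    [/\ forall x, U x -> V (F x) /\ Psi (F x) = x,
        forall y, V y -> U (Psi y) /\ F (Psi y) = y,
        smooth_on V Psi & forall y, V y -> 'J Psi y \in unitmx].
Proof.
move=> oA Ax0 sF uJ.
have CJ k : Ck_on k A (fun x => 'J F x) by apply: Ck_jacobian.
pose A' := [set x | A x /\ (\det ('J F x) : R^o) != 0].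
have oA' : open A'.
  by apply: open_neq0 => //; apply: Ck_det => // i j; exact: Ck_entry.
have A'A : A' `<=` A by move=> x [].
have uA' x : A' x -> 'J F x \in unitmx by case=> _; rewrite unitmxE unitfE.
have A'x0 : A' x0 by split=> //; rewrite -unitfE -unitmxE.
have [U [V [Psi [[oU Ux0 UA oV] [UP VP [C C0 Lip]]]]]] :=
  local_inverse oA' A'x0 (Ck_on_sub A'A (sF 1%N)) uJ.
have FPsi y : V y -> F (Psi y) = y by case/VP.
have PsiU y : V y -> U (Psi y) by case/VP.
have D y : V y -> differentiable Psi y /\ 'J Psi y = invmx ('J F (Psi y)).
  move=> Vy; apply: (inverse_differentiable oV Vy C0 FPsi Lip).
    by apply: (Ck_differentiable (sF 1%N)); apply/A'A/UA/PsiU.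
  by apply/uA'/UA/PsiU.
exists U, V, Psi; split.
  by split; [exact: oU|exact: Ux0|move=> x /UA/A'A|exact: oV].
split; [exact: UP|exact: VP| |].
- elim=> [|k IH].
    move=> y Vy; exact: (differentiable_continuous (proj1 (D y Vy))).
  split=> [y Vy|v]; first by case: (D y Vy).
  have E : forall y, V y -> v *m invmx ('J F (Psi y)) = 'D_v Psi y.
    by move=> y Vy; have [dP JP] := D y Vy; rewrite deriveEjacobian // JP.
  have CJP : Ck_on k V (fun y => 'J F (Psi y)).
    exact (Ck_comp_mx oV oA (fun y Vy => A'A _ (UA _ (PsiU _ Vy))) IH (CJ k)).
  have uJP y : V y -> 'J F (Psi y) \in unitmx by move=> /PsiU/UA/uA'.
  exact (Ck_on_eq oV E (Ck_mulmx oV (Ck_cst k V v) (Ck_invmx oV uJP CJP))).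
- by move=> y Vy; have [_ ->] := D y Vy; rewrite unitmx_inv; apply/uA'/UA/PsiU.
Qed.

End SmoothInverse.

(** * Contractions of 4-tensors with an inverse metric *)

Section Contraction.
Context {R : realFieldType}.

(** Contracting by K the image of a bilinear expression X under E is
    contracting X by E^T K E. All invariance properties of the second Weyl
    invariant come from this identity. *)
Lemma contract_push n p (K : 'M[R]_p) (E : 'M[R]_(p, n)) (X : 'I_n -> 'I_n -> R) :
  \sum_a \sum_a' K a a' * (\sum_i E a i * (\sum_i' E a' i' * X i i')) =
  \sum_i \sum_i' (E^T *m K *m E) i i' * X i i'.
Proof.
transitivity (\sum_a \sum_a' \sum_i \sum_i' (E a i * K a a' * E a' i') * X i i').
  apply: eq_bigr => a _; apply: eq_bigr => a' _; rewrite mulr_sumr; apply: eq_bigr => i _.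
  by rewrite !mulr_sumr; apply: eq_bigr => i' _; rewrite !mulrA (mulrC (K a a')).
under eq_bigr do rewrite exchange_big.
rewrite exchange_big; apply: eq_bigr => i _ /=.
transitivity (\sum_a \sum_i' \sum_a' (E a i * K a a' * E a' i') * X i i').
  by apply: eq_bigr => a _; rewrite exchange_big.
rewrite exchange_big; apply: eq_bigr => i' _ /=.
rewrite mxE mulr_suml exchange_big; apply: eq_bigr => a' _ /=.
by rewrite mxE !mulr_suml; apply: eq_bigr => a _; rewrite mxE.
Qed.

(** The number H^ac H^bd P_ab Q_cd for 2-tensors P and Q, that is, their inner
    product when H is the inverse of the metric. *)
Definition contract2 n (H P Q : 'M[R]_n) : R := \tr (P^T *m H *m Q *m H^T).

Lemma contract2_push n p (K : 'M[R]_p) (E : 'M[R]_(p, n)) (P Q : 'M[R]_n) :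
  contract2 K (E *m P *m E^T) (E *m Q *m E^T) = contract2 (E^T *m K *m E) P Q.
Proof.
rewrite /contract2 !trmx_mul !trmxK -!mulmxA mxtrace_mulC -!mulmxA.
by [].
Qed.

Lemma contract2_suml n (H Q : 'M[R]_n) I (r : seq I) (x : I -> R) (P : I -> 'M[R]_n) :
  contract2 H (\sum_(i <- r) x i *: P i) Q = \sum_(i <- r) x i * contract2 H (P i) Q.
Proof.
rewrite /contract2 linear_sum /= !mulmx_suml linear_sum; apply: eq_bigr => i _ /=.
by rewrite linearZ /= -!scalemxAl linearZ.
Qed.

Lemma contract2_sumr n (H P : 'M[R]_n) I (r : seq I) (x : I -> R) (Q : I -> 'M[R]_n) :
  contract2 H P (\sum_(i <- r) x i *: Q i) = \sum_(i <- r) x i * contract2 H P (Q i).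
Proof.
rewrite /contract2 mulmx_sumr !mulmx_suml linear_sum; apply: eq_bigr => i _ /=.
by rewrite -scalemxAr -!scalemxAl linearZ.
Qed.

Lemma exchange_contract n p (kap : 'I_p -> 'I_p -> R) (al al' : 'I_n -> R)
    (Y : 'I_p -> 'I_p -> 'I_n -> 'I_n -> R) :
  \sum_c \sum_c' kap c c' * (\sum_i al i * (\sum_i' al' i' * Y c c' i i')) =
  \sum_i al i * (\sum_i' al' i' * (\sum_c \sum_c' kap c c' * Y c c' i i')).
Proof.
transitivity (\sum_c \sum_c' \sum_i \sum_i' al i * al' i' * (kap c c' * Y c c' i i')).
  apply: eq_bigr => c _; apply: eq_bigr => c' _; rewrite mulr_sumr; apply: eq_bigr => i _.
  by rewrite !mulr_sumr; apply: eq_bigr => i' _; ring.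
transitivity (\sum_i \sum_c \sum_c' \sum_i' al i * al' i' * (kap c c' * Y c c' i i')).
  by rewrite [RHS]exchange_big /=; apply: eq_bigr => c _; rewrite exchange_big.
apply: eq_bigr => i _; rewrite mulr_sumr.
transitivity (\sum_c \sum_i' \sum_c' al i * al' i' * (kap c c' * Y c c' i i')).
  by apply: eq_bigr => c _; rewrite exchange_big.
rewrite exchange_big; apply: eq_bigr => i' _ /=.
rewrite mulrA mulr_sumr; apply: eq_bigr => c _; rewrite mulr_sumr.
by [].
Qed.

(** A 4-tensor is encoded as a matrix of matrices, T i k being the matrix with
    rows j and columns l of the components T_ijkl; with this grouping the
    Ricci contraction is a trace of each block. This is the inner product
    of S and T for the inverse metric H. *)
Definition contract4 n (H : 'M[R]_n) (S T : 'I_n -> 'I_n -> 'M[R]_n) : R :=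
  \sum_i \sum_i' H i i' * (\sum_k \sum_k' H k k' * contract2 H (S i k) (T i' k')).

(** The components of T evaluated on the vectors that are the rows of E. *)
Definition push4 n p (E : 'M[R]_(p, n)) (T : 'I_n -> 'I_n -> 'M[R]_n) (a c : 'I_p) : 'M[R]_p :=
  E *m (\sum_i E a i *: (\sum_k E c k *: T i k)) *m E^T.

Lemma contract4_push n p (K : 'M[R]_p) (E : 'M[R]_(p, n)) (S T : 'I_n -> 'I_n -> 'M[R]_n) :
  contract4 K (push4 E S) (push4 E T) = contract4 (E^T *m K *m E) S T.
Proof.
rewrite /contract4; set H := E^T *m K *m E.
rewrite -contract_push; apply: eq_bigr => a _; apply: eq_bigr => a' _; congr (_ * _).
transitivity (\sum_c \sum_c' K c c' * (\sum_i E a i * (\sum_i' E a' i' *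
   (\sum_k E c k * (\sum_k' E c' k' * contract2 H (S i k) (T i' k')))))).
  apply: eq_bigr => c _; apply: eq_bigr => c' _; congr (_ * _).
  rewrite /push4 contract2_push -/H contract2_suml; apply: eq_bigr => i _; congr (_ * _).
  rewrite contract2_sumr; apply: eq_bigr => i' _; congr (_ * _).
  rewrite contract2_suml; apply: eq_bigr => k _; congr (_ * _).
  by rewrite contract2_sumr.
rewrite exchange_contract; apply: eq_bigr => i _; congr (_ * _).
apply: eq_bigr => i' _; congr (_ * _).
by rewrite contract_push.
Qed.

(** Contraction of the second and fourth indices. *)
Definition ricci_contract n (H : 'M[R]_n) (T : 'I_n -> 'I_n -> 'M[R]_n) : 'M[R]_n :=
  \matrix_(i, k) \tr (H^T *m T i k).

Lemma trace_push n p (K : 'M[R]_p) (E : 'M[R]_(p, n)) (M : 'M[R]_n) :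
  \tr (K^T *m (E *m M *m E^T)) = \tr ((E^T *m K *m E)^T *m M).
Proof.
by rewrite !trmx_mul !trmxK !mulmxA mxtrace_mulC !mulmxA.
Qed.

Lemma ricci_contract_push n p (K : 'M[R]_p) (E : 'M[R]_(p, n)) T :
  ricci_contract K (push4 E T) = E *m ricci_contract (E^T *m K *m E) T *m E^T.
Proof.
apply/matrixP => a c; rewrite mxE trace_push; set H := _ *m K *m E.
rewrite mulmx_sumr linear_sum /= mxE.
transitivity (\sum_i \sum_k E a i * ricci_contract H T i k * E c k).
  apply: eq_bigr => i _; rewrite -scalemxAr mulmx_sumr linearZ linear_sum /= mulr_sumr.
  by apply: eq_bigr => k _; rewrite -scalemxAr linearZ mxE /=; ring.
rewrite exchange_big; apply: eq_bigr => k _ /=.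
by rewrite !mxE mulr_suml; apply: eq_bigr => i _.
Qed.

(** The coefficient 1/4 of the first term accounts for the restriction to i < j
    and k < l in the norm of the curvature: the sum over all indices counts
    every such pair of pairs four times. *)
Definition weyl_h4 n (H : 'M[R]_n) (T : 'I_n -> 'I_n -> 'M[R]_n) : R :=
  4^-1 * contract4 H T T - contract2 H (ricci_contract H T) (ricci_contract H T)
  + 4^-1 * (\tr (H^T *m ricci_contract H T)) ^+ 2.

(** The invariant of a tensor depends on the frame E and the inverse metric K
    in that frame only through E^T K E, which is the inverse metric in the
    original coordinates. The matrix E need not be square. *)
Lemma weyl_h4_push n p (K : 'M[R]_p) (E : 'M[R]_(p, n)) T :
  weyl_h4 K (push4 E T) = weyl_h4 (E^T *m K *m E) T.
Proof. by rewrite /weyl_h4 contract4_push ricci_contract_push contract2_push trace_push. Qed.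

Definition linform n (f : 'rV[R]_n -> R) := forall a x y, f (a *: x + y) = a * f x + f y.

Lemma linform0 n (f : 'rV[R]_n -> R) : linform f -> f 0 = 0.
Proof. by move=> lf; have := lf (-1) 0 0; rewrite scaler0 addr0; lra. Qed.

Lemma linform_expand n (f : 'rV[R]_n -> R) u : linform f -> f u = \sum_i u 0 i * f (delta_mx 0 i).
Proof.
move=> lf; rewrite {1}[u]row_sum_delta.
elim/big_rec2: _ => [|i y1 y2 _ <-]; first exact: linform0.
exact: lf.
Qed.

Lemma bilin_expand n (f : 'rV[R]_n -> 'rV[R]_n -> R) u v :
  (forall v, linform (f^~ v)) -> (forall u, linform (f u)) ->
  f u v = (u *m (\matrix_(i, j) f (delta_mx 0 i) (delta_mx 0 j)) *m v^T) 0 0.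
Proof.
move=> l1 l2; rewrite mxE (linform_expand v (l2 u)); apply: eq_bigr => j _.
rewrite mulrC (linform_expand u (l1 _)) !mxE; congr (_ * _).
by apply: eq_bigr => i _; rewrite mxE.
Qed.

Definition components n p (f : 'rV[R]_n -> 'rV[R]_n -> 'rV[R]_n -> 'rV[R]_n -> R)
    (E : 'M[R]_(p, n)) (a c : 'I_p) : 'M[R]_p :=
  \matrix_(b, d) f (row a E) (row b E) (row c E) (row d E).

Definition multilin4 n (f : 'rV[R]_n -> 'rV[R]_n -> 'rV[R]_n -> 'rV[R]_n -> R) :=
  [/\ forall v w z, linform (fun u => f u v w z), forall u w z, linform (fun v => f u v w z),
      forall u v z, linform (fun w => f u v w z) & forall u v w, linform (fun z => f u v w z)].

Lemma components_push n p f (E : 'M[R]_(p, n)) a c : multilin4 f ->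
  components f E a c = push4 E (components f 1%:M) a c.
Proof.
move=> [l1 l2 l3 l4]; apply/matrixP => b d.
rewrite mxE (@bilin_expand n (fun v z => f (row a E) v (row c E) z)) //.
rewrite /push4; set M := \matrix_(i, j) _.
have -> : \sum_i E a i *: (\sum_k E c k *: components f 1%:M i k) = M.
  apply/matrixP => j l; rewrite mxE (linform_expand (row a E) (l1 _ _ _)) summxE.
  apply: eq_bigr => i _; rewrite !mxE; congr (_ * _).
  rewrite (linform_expand (row c E) (l3 _ _ _)) summxE; apply: eq_bigr => k _.
  by rewrite !mxE !row1.
rewrite -row_mul [LHS]mxE [RHS]mxE; apply: eq_bigr => j _.
by rewrite !mxE.
Qed.

End Contraction.

Section InverseCongruence.
Context {R : realType}.

Lemma invmx_uniq n (M N : 'M[R]_n) : M *m N = 1%:M -> invmx M = N.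
Proof.
move=> MN; have [uM _] := mulmx1_unit MN.
by rewrite -[N](mulKmx uM) MN mulmx1.
Qed.

(** If J transforms the metric G into J G J^T, its transpose transforms the
    inverse metrics back; this is the hypothesis under which full
    contractions agree. *)
Lemma invmx_conj n (J G : 'M[R]_n) : J \in unitmx -> G \in unitmx ->
  J^T *m invmx (J *m G *m J^T) *m J = invmx G.
Proof.
move=> uJ uG.
have uP : J *m G *m J^T \in unitmx by rewrite !unitmx_mul uJ uG unitmx_tr uJ.
apply: esym; apply: invmx_uniq; rewrite !mulmxA; apply: mulmx1C.
by rewrite !mulmxA mulmxV.
Qed.
End InverseCongruence.

(** * The curvature tensor in terms of the 2-jet of the metric *)

Section RiemannForm.
Context {R : realType}.

Lemma bform_linl n (M : 'M[R]_n) w : linform (fun v => bform M v w).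
Proof. by move=> a x y; rewrite /bform !mulmxDl -!scalemxAl !mxE. Qed.

Lemma bform_linr n (M : 'M[R]_n) v : linform (bform M v).
Proof. by move=> a x y; rewrite /bform linearD linearZ /= mulmxDr -scalemxAr !mxE. Qed.

Lemma bform_linM n (M N : 'M[R]_n) a v w : bform (a *: M + N) v w = a * bform M v w + bform N v w.
Proof. by rewrite /bform mulmxDr mulmxDl -scalemxAr -scalemxAl !mxE. Qed.

Lemma bform_sym n (M : 'M[R]_n) v w : M^T = M -> bform M v w = bform M w v.
Proof.
move=> sM; rewrite /bform -[in LHS]sM -{1}[v]trmxK -!trmx_mul mulmxA [LHS]mxE.
by [].
Qed.

Lemma bform_delta n (M : 'M[R]_n) i j : bform M (delta_mx 0 i) (delta_mx 0 j) = M i j.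
Proof. by rewrite /bform -rowE trmx_delta -colE !mxE. Qed.

Lemma bform_row n (M : 'M[R]_n) v p : bform M v (delta_mx 0 p) = (v *m M) 0 p.
Proof. by rewrite /bform trmx_delta -colE mxE. Qed.

Lemma bform_push n p (E : 'M[R]_(p, n)) (M : 'M[R]_n) v w :
  bform (E *m M *m E^T) v w = bform M (v *m E) (w *m E).
Proof. by rewrite /bform trmx_mul !mulmxA. Qed.

(** The derivative of the metric in the direction u, evaluated on v and w, for
    D1 the family of its partial derivatives. *)
Definition jet1 n (D1 : 'I_n -> 'M[R]_n) (u v w : 'rV[R]_n) :=
  bform (\sum_c u 0 c *: D1 c) v w.

(** As [jet1], for second derivatives in the directions u and u'. *)
Definition jet2 n (D2 : 'I_n -> 'I_n -> 'M[R]_n) (u u' v w : 'rV[R]_n) :=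
  bform (\sum_c u 0 c *: \sum_d u' 0 d *: D2 c d) v w.

Lemma comb_lin n m (D : 'I_n -> 'M[R]_m) (a : R) (x y : 'rV[R]_n) :
  \sum_c (a *: x + y) 0 c *: D c = a *: (\sum_c x 0 c *: D c) + \sum_c y 0 c *: D c.
Proof.
rewrite scaler_sumr -big_split; apply: eq_bigr => c _ /=.
by rewrite !mxE scalerDl scalerA.
Qed.

Lemma comb_delta n m (D : 'I_n -> 'M[R]_m) i : \sum_c (delta_mx 0 i : 'rV[R]_n) 0 c *: D c = D i.
Proof.
rewrite (bigD1 i) //= mxE !eqxx scale1r big1 ?addr0 // => c ci.
by rewrite mxE (negbTE ci) andbF scale0r.
Qed.

Section D1D2.
Variables (n : nat) (D1 : 'I_n -> 'M[R]_n) (D2 : 'I_n -> 'I_n -> 'M[R]_n).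

Lemma jet1_lin1 v w : linform (fun u => jet1 D1 u v w).
Proof. by move=> a x y; rewrite /jet1 comb_lin bform_linM. Qed.
Lemma jet1_lin2 u w : linform (fun v => jet1 D1 u v w).
Proof. exact: bform_linl. Qed.
Lemma jet1_lin3 u v : linform (jet1 D1 u v).
Proof. exact: bform_linr. Qed.
Lemma jet2_lin1 u' v w : linform (fun u => jet2 D2 u u' v w).
Proof. by move=> a x y; rewrite /jet2 comb_lin bform_linM. Qed.
Lemma jet2_lin2 u v w : linform (fun u' => jet2 D2 u u' v w).
Proof.
move=> a x y; rewrite /jet2 -bform_linM; congr bform.
rewrite scaler_sumr -big_split; apply: eq_bigr => c _ /=.
by rewrite comb_lin scalerDr !scalerA (mulrC a).
Qed.
Lemma jet2_lin3 u u' w : linform (fun v => jet2 D2 u u' v w).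
Proof. exact: bform_linl. Qed.
Lemma jet2_lin4 u u' v : linform (jet2 D2 u u' v).
Proof. exact: bform_linr. Qed.

Lemma jet1_delta l i j : jet1 D1 (delta_mx 0 l) (delta_mx 0 i) (delta_mx 0 j) = D1 l i j.
Proof. by rewrite /jet1 comb_delta bform_delta. Qed.
Lemma jet2_delta k l i j :
  jet2 D2 (delta_mx 0 k) (delta_mx 0 l) (delta_mx 0 i) (delta_mx 0 j) = D2 k l i j.
Proof. by rewrite /jet2 comb_delta comb_delta bform_delta. Qed.

Lemma jet1_sym u v w : (forall c, (D1 c)^T = D1 c) -> jet1 D1 u v w = jet1 D1 u w v.
Proof.
move=> D1s; apply: bform_sym; rewrite linear_sum; apply: eq_bigr => c _ /=.
by rewrite linearZ /= D1s.
Qed.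
End D1D2.

Section AbstractForm.
Variables (n : nat) (T : 'rV[R]_n -> 'rV[R]_n -> 'rV[R]_n -> R)
  (Q : 'rV[R]_n -> 'rV[R]_n -> 'rV[R]_n -> 'rV[R]_n -> R) (H : 'M[R]_n).

(** Christoffel symbols of the first kind, for T the first derivative of the
    metric. They are used as a trilinear map so that changes of coordinates
    need not be written with indices. *)
Definition chr_low u v w := 2^-1 * (T u v w + T v u w - T w u v).

(** The pairing of two linear forms by the inverse metric H. *)
Definition pairing (f g : 'rV[R]_n -> R) :=
  \sum_p \sum_q H p q * (f (delta_mx 0 p) * g (delta_mx 0 q)).

(** The curvature tensor with all indices lowered, for T and Q the first and
    second derivatives of the metric and H its inverse. Only the metric is
    differentiated in this formula, never its inverse, so it is visibly a
    continuous function of the 2-jet. *)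
Definition riem_form u v w z :=
  2^-1 * (Q u z v w - Q u w v z - Q v z u w + Q v w u z)
  - pairing (chr_low u w) (chr_low v z) + pairing (chr_low v w) (chr_low u z).

Lemma pairing_linl (f f' g : 'rV[R]_n -> R) a :
  pairing (fun x => a * f x + f' x) g = a * pairing f g + pairing f' g.
Proof.
rewrite /pairing mulr_sumr -big_split; apply: eq_bigr => p _.
rewrite mulr_sumr -big_split; apply: eq_bigr => q _ /=; ring.
Qed.
Lemma pairing_linr (f g g' : 'rV[R]_n -> R) a :
  pairing f (fun x => a * g x + g' x) = a * pairing f g + pairing f g'.
Proof.
rewrite /pairing mulr_sumr -big_split; apply: eq_bigr => p _.
rewrite mulr_sumr -big_split; apply: eq_bigr => q _ /=; ring.
Qed.

Lemma pairing_ext (f f' g g' : 'rV[R]_n -> R) : f =1 f' -> g =1 g' -> pairing f g = pairing f' g'.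
Proof. by move=> ff gg; apply: eq_bigr => p _; apply: eq_bigr => q _; rewrite ff gg. Qed.

Lemma pairing_sym f g : H^T = H -> pairing f g = pairing g f.
Proof.
move=> sH; rewrite /pairing exchange_big; apply: eq_bigr => p _; apply: eq_bigr => q _.
by rewrite -[in LHS]sH mxE (mulrC (f _)).
Qed.

(** Raising an index and lowering it again is the identity; the hypothesis says
    that A and H are inverse to each other at k. *)
Lemma pairing_form (A : 'M[R]_n) k g : k *m A *m H = k -> linform g ->
  pairing (bform A k) g = g k.
Proof.
move=> kAH lg; rewrite (linform_expand k lg) /pairing exchange_big; apply: eq_bigr => q _ /=.
rewrite -[in RHS]kAH mxE mulr_suml; apply: eq_bigr => p _.
by rewrite bform_row; ring.
Qed.

Hypothesis T1 : forall v w, linform (fun u => T u v w).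
Hypothesis T2 : forall u w, linform (fun v => T u v w).
Hypothesis T3 : forall u v, linform (T u v).
Hypothesis Q1 : forall u' v w, linform (fun u => Q u u' v w).
Hypothesis Q2 : forall u v w, linform (fun u' => Q u u' v w).
Hypothesis Q3 : forall u u' w, linform (fun v => Q u u' v w).
Hypothesis Q4 : forall u u' v, linform (Q u u' v).

Lemma chr_low_lin1 v w : linform (fun u => chr_low u v w).
Proof. by move=> a x y; rewrite /chr_low T1 !T2; ring. Qed.
Lemma chr_low_lin2 u w : linform (fun v => chr_low u v w).
Proof. by move=> a x y; rewrite /chr_low T1 T2 T3; ring. Qed.
Lemma chr_low_lin3 u v : linform (chr_low u v).
Proof. by move=> a x y; rewrite /chr_low T1 !T3; ring. Qed.

Let ip1l a x y w g : pairing (chr_low (a *: x + y) w) g =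
  a * pairing (chr_low x w) g + pairing (chr_low y w) g.
Proof. by rewrite -pairing_linl; apply: pairing_ext => // t; exact: chr_low_lin1. Qed.
Let ip2l a x y w g : pairing (chr_low w (a *: x + y)) g =
  a * pairing (chr_low w x) g + pairing (chr_low w y) g.
Proof. by rewrite -pairing_linl; apply: pairing_ext => // t; exact: chr_low_lin2. Qed.
Let ip1r a x y w f : pairing f (chr_low (a *: x + y) w) =
  a * pairing f (chr_low x w) + pairing f (chr_low y w).
Proof. by rewrite -pairing_linr; apply: pairing_ext => // t; exact: chr_low_lin1. Qed.
Let ip2r a x y w f : pairing f (chr_low w (a *: x + y)) =
  a * pairing f (chr_low w x) + pairing f (chr_low w y).
Proof. by rewrite -pairing_linr; apply: pairing_ext => // t; exact: chr_low_lin2. Qed.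

Lemma riem_form_multilin : multilin4 riem_form.
Proof.
split=> [v w z|u w z|u v z|u v w] a x y; rewrite /riem_form.
- rewrite Q1 Q1 Q3 Q3 (ip1l a x y w) (ip1r a x y z).
  move: (pairing (chr_low x w)) (pairing (chr_low y w)) (pairing (chr_low v w)) => f1 f2 f3; ring.
- rewrite Q1 Q1 Q3 Q3 (ip1l a x y w) (ip1r a x y z).
  move: (pairing (chr_low x w)) (pairing (chr_low y w)) (pairing (chr_low u w)) => f1 f2 f3; ring.
- rewrite Q2 Q2 Q4 Q4 (ip2l a x y u) (ip2l a x y v).
  by move: (pairing (chr_low u x)) (pairing (chr_low u y)) (pairing (chr_low v x)) (pairing (chr_low v y)) => f1 f2 f3 f4; ring.
- rewrite Q2 Q2 Q4 Q4 (ip2r a x y u) (ip2r a x y v).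
  by move: (pairing (chr_low v w)) (pairing (chr_low u w)) => f1 f2; ring.
Qed.
End AbstractForm.

Lemma pairing_push n p (K : 'M[R]_p) (J : 'M[R]_(p, n)) (f g : 'rV[R]_n -> R) :
  linform f -> linform g ->
  pairing K (fun x => f (x *m J)) (fun x => g (x *m J)) = pairing (J^T *m K *m J) f g.
Proof.
move=> lf lg; rewrite /pairing -contract_push; apply: eq_bigr => a _; apply: eq_bigr => b _.
congr (_ * _); rewrite -!rowE (linform_expand (row a J) lf) (linform_expand (row b J) lg) mulr_suml.
apply: eq_bigr => i _; rewrite [LHS]mulr_sumr [RHS]mulr_sumr; apply: eq_bigr => j _.
by rewrite !mxE; ring.
Qed.

Lemma jet_multilin n (D1 : 'I_n -> 'M[R]_n) (D2 : 'I_n -> 'I_n -> 'M[R]_n) H :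
  multilin4 (riem_form (jet1 D1) (jet2 D2) H).
Proof.
apply: riem_form_multilin.
- exact: jet1_lin1.
- exact: jet1_lin2.
- exact: jet1_lin3.
- exact: jet2_lin1.
- exact: jet2_lin2.
- exact: jet2_lin3.
- exact: jet2_lin4.
Qed.

Section Change.
Variables (n p : nat) (H : 'M[R]_n) (T : 'rV[R]_n -> 'rV[R]_n -> 'rV[R]_n -> R)
  (Q : 'rV[R]_n -> 'rV[R]_n -> 'rV[R]_n -> 'rV[R]_n -> R)
  (B : 'rV[R]_n -> 'rV[R]_n -> R)
  (H' : 'M[R]_p) (T' : 'rV[R]_p -> 'rV[R]_p -> 'rV[R]_p -> R)
  (Q' : 'rV[R]_p -> 'rV[R]_p -> 'rV[R]_p -> 'rV[R]_p -> R)
  (J : 'M[R]_(p, n)) (K : 'I_p -> 'I_p -> 'rV[R]_n) (L : 'I_p -> 'I_p -> 'I_p -> 'rV[R]_n).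
Local Notation j_ := (fun i => row i J).
Local Notation e_ := (fun i : 'I_p => delta_mx (0 : 'I_1) i).

Hypothesis Hs : H^T = H.
Hypothesis T1 : forall v w, linform (fun u => T u v w).
Hypothesis T3 : forall u v, linform (T u v).
Hypothesis Ts : forall u v w, T u v w = T u w v.
Hypothesis Br : forall u, linform (B u).
Hypothesis Bs : forall u v, B u v = B v u.
Hypothesis HJ : J^T *m H' *m J = H.
Hypothesis Ks : forall a b, K a b = K b a.
Hypothesis L1 : forall a b c, L a b c = L a c b.
Hypothesis L2 : forall a b c, L a b c = L b a c.
Hypothesis ipB : forall a b g, linform g -> pairing H (B (K a b)) g = g (K a b).
Hypothesis hT : forall l i j, T' (e_ l) (e_ i) (e_ j) =
  T (j_ l) (j_ i) (j_ j) + B (K l i) (j_ j) + B (j_ i) (K l j).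
Hypothesis hQ : forall k l i j, Q' (e_ k) (e_ l) (e_ i) (e_ j) =
  Q (j_ k) (j_ l) (j_ i) (j_ j) + T (K k l) (j_ i) (j_ j)
  + T (j_ l) (K k i) (j_ j) + T (j_ l) (j_ i) (K k j)
  + (T (j_ k) (K l i) (j_ j) + B (L k l i) (j_ j) + B (K l i) (K k j))
  + (T (j_ k) (j_ i) (K l j) + B (K k i) (K l j) + B (j_ i) (L k l j)).

(** The abstract situation of this part is the pullback of a metric B by a map
    with derivatives J (first), K (second) and L (third): [hT] and [hQ] are
    the product and chain rules for the first and second derivatives of the
    pulled back metric. The Christoffel symbols are not tensorial, and the
    defect is the second derivative paired with B. *)
Lemma chr_low_change i k q :
  chr_low T' (e_ i) (e_ k) (e_ q) = chr_low T (j_ i) (j_ k) (j_ q) + B (K i k) (j_ q).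
Proof.
rewrite /chr_low !hT (Ks k i) (Ks q i) (Ks q k) (Bs (j_ k) (K i q)) (Bs (j_ i) (K k q)).
lra.
Qed.

Lemma pairing_change i j k l :
  pairing H' (chr_low T' (e_ i) (e_ k)) (chr_low T' (e_ j) (e_ l)) =
  pairing H (chr_low T (j_ i) (j_ k)) (chr_low T (j_ j) (j_ l))
  + chr_low T (j_ i) (j_ k) (K j l) + chr_low T (j_ j) (j_ l) (K i k) + B (K i k) (K j l).
Proof.
have chr3 a b : linform (chr_low T (j_ a) (j_ b)) := chr_low_lin3 T1 T3 _ _.
pose f (a b : 'I_p) w := 1 * chr_low T (j_ a) (j_ b) w + B (K a b) w.
have lf a b : linform (f a b) by move=> t x y; rewrite /f chr3 Br; ring.
transitivity (pairing H' (fun x => f i k (x *m J)) (fun x => f j l (x *m J))).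
  apply: eq_bigr => a _; apply: eq_bigr => b _.
  by rewrite !chr_low_change /f -!rowE !mul1r.
rewrite pairing_push // HJ /f pairing_linl !pairing_linr.
rewrite (ipB _ _ (@chr3 j l)) (ipB _ _ (@Br (K j l))) (pairing_sym _ (B (K j l)) Hs) (ipB _ _ (@chr3 i k)).
by rewrite (Bs (K j l) (K i k)); move: (pairing H _ _) => t; ring.
Qed.

(** Tensoriality of the curvature. Third derivatives of the map cancel by the
    antisymmetry of the four second-derivative terms; the terms in K cancel
    between the second derivatives and the two pairings, because pairing
    with B (K a b) is evaluation at K a b. After the symmetries have been
    used it is a linear identity. *)
Lemma riem_form_change i j k l :
  riem_form T' Q' H' (e_ i) (e_ j) (e_ k) (e_ l) = riem_form T Q H (j_ i) (j_ j) (j_ k) (j_ l).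
Proof.
rewrite /riem_form !hQ !pairing_change.
move: (pairing H _ _) (pairing H _ _) => ip1 ip2; rewrite /chr_low.
rewrite (Ks j i) (Ks k i) (Ks l i) (Ks k j) (Ks l j) (Ks l k).
have -> : L i l j = L i j l by [].
have -> : L i l k = L i k l by [].
have -> : L i k j = L i j k by [].
have -> : L j l i = L i j l by rewrite L1 L2.
have -> : L j l k = L j k l by [].
have -> : L j k i = L i j k by rewrite L1 L2.
have := Ts (j_ i) (K j k) (j_ l); have := Ts (j_ i) (K j l) (j_ k).
have := Ts (j_ i) (K k l) (j_ j); have := Ts (j_ j) (K i k) (j_ l).
have := Ts (j_ j) (K i l) (j_ k); have := Ts (j_ j) (K k l) (j_ i).
have := Ts (j_ k) (K i j) (j_ l); have := Ts (j_ k) (K i l) (j_ j).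
have := Ts (j_ k) (K j l) (j_ i); have := Ts (j_ l) (K i j) (j_ k).
have := Ts (j_ l) (K i k) (j_ j); have := Ts (j_ l) (K j k) (j_ i).
have := Ts (K i j) (j_ k) (j_ l); have := Ts (K i k) (j_ j) (j_ l).
have := Ts (K i l) (j_ j) (j_ k); have := Ts (K j k) (j_ i) (j_ l).
have := Ts (K j l) (j_ i) (j_ k); have := Ts (K k l) (j_ i) (j_ j).
have := Bs (K i j) (K k l); have := Bs (K i k) (K j l).
have := Bs (K i l) (K j k).
have := Bs (L i j l) (j_ k); have := Bs (L i j k) (j_ l).
have := Bs (L i k l) (j_ j); have := Bs (L j k l) (j_ i).
lra.
Qed.
End Change.
End RiemannForm.

Section MultilinExpand.
Context {R : realFieldType} {n : nat}.
Lemma multilin4_expand (f : 'rV[R]_n -> 'rV[R]_n -> 'rV[R]_n -> 'rV[R]_n -> R) u v w z :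
  multilin4 f -> f u v w z = \sum_i \sum_j \sum_k \sum_l u 0 i * v 0 j * w 0 k * z 0 l *
    f (delta_mx 0 i) (delta_mx 0 j) (delta_mx 0 k) (delta_mx 0 l).
Proof.
move=> [l1 l2 l3 l4].
rewrite (linform_expand u (l1 _ _ _)); apply: eq_bigr => i _.
rewrite (linform_expand v (l2 _ _ _)) mulr_sumr; apply: eq_bigr => j _.
rewrite (linform_expand w (l3 _ _ _)) 2!mulr_sumr; apply: eq_bigr => k _.
rewrite (linform_expand z (l4 _ _ _)) 3!mulr_sumr; apply: eq_bigr => l _.
ring.
Qed.

(** Links the full sums of the contractions to the sums over i < j in the norm
    of the curvature tensor. *)
Lemma sum_lt_half (s : 'I_n -> 'I_n -> R) : (forall i j, s i j = s j i) ->
  (forall i, s i i = 0) ->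
  \sum_i \sum_j s i j = 2 * \sum_(i < n) \sum_(j < n | (i < j)%N) s i j.
Proof.
move=> ss s0.
have -> : \sum_i \sum_j s i j = \sum_(i < n) \sum_(j < n | (i < j)%N) s i j +
    \sum_(i < n) \sum_(j < n | (j < i)%N) s i j.
  rewrite -big_split; apply: eq_bigr => i _ /=.
  rewrite (bigID (fun j : 'I_n => (i < j)%N)) /=; congr (_ + _).
  rewrite [LHS](bigID (fun j : 'I_n => (j < i)%N)) /= [X in _ + X]big1 ?addr0.
    by apply: eq_bigl => j; case: ltngtP.
  move=> j; rewrite -!leqNgt -eqn_leq => /eqP ij.
  by have -> : i = j by exact: val_inj.
rewrite [X in _ + X](exchange_big_dep xpredT) //=.
rewrite mulr_natl mulr2n; congr (_ + _).
by apply: eq_bigr => i _; apply: eq_bigr => j _; rewrite ss.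
Qed.
End MultilinExpand.

Section FrameFormula.
Context {R : realFieldType} {n : nat}.
Variable f : 'rV[R]_n -> 'rV[R]_n -> 'rV[R]_n -> 'rV[R]_n -> R.
Hypothesis f12 : forall u v w z, f v u w z = - f u v w z.
Hypothesis f34 : forall u v w z, f u v z w = - f u v w z.

(** In an orthonormal frame the inverse metric is the identity matrix, and the
    contractions become the sums of squares in the definition of h_4. *)
Lemma weyl_h4_frame p (E : 'M[R]_(p, n)) : weyl_h4 1%:M (components f E) =
  \sum_(i < p) \sum_(j < p | (i < j)%N) \sum_(k < p) \sum_(l < p | (k < l)%N)
    f (row i E) (row j E) (row k E) (row l E) ^+ 2
  - \sum_i \sum_j (\sum_k f (row i E) (row k E) (row j E) (row k E)) ^+ 2
  + 4^-1 * (\sum_i \sum_k f (row i E) (row k E) (row i E) (row k E)) ^+ 2.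
Proof.
have sum1 (X : 'I_p -> 'I_p -> R) : \sum_i \sum_i' (1%:M : 'M[R]_p) i i' * X i i' = \sum_i X i i.
  apply: eq_bigr => i _; rewrite (bigD1 i) //= mxE eqxx mul1r big1 ?addr0 // => j ji.
  by rewrite mxE eq_sym (negbTE ji) mul0r.
have f21 (P Q : 'M[R]_p) : contract2 1%:M P Q = \sum_b \sum_d P b d * Q b d.
  rewrite /contract2 trmx1 !mulmx1 /mxtrace exchange_big; apply: eq_bigr => d _ /=.
  by rewrite mxE; apply: eq_bigr => b _; rewrite mxE.
have ricE a c : ricci_contract 1%:M (components f E) a c = \sum_k f (row a E) (row k E) (row c E) (row k E).
  by rewrite mxE trmx1 mul1mx; apply: eq_bigr => k _; rewrite mxE.
rewrite /weyl_h4; congr (_ - _ + _).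
- rewrite /contract4 sum1.
  transitivity (4^-1 * \sum_a \sum_b \sum_c \sum_d f (row a E) (row b E) (row c E) (row d E) ^+ 2).
    congr (_ * _); apply: eq_bigr => a _; rewrite sum1 [RHS]exchange_big; apply: eq_bigr => c _ /=.
    rewrite f21; apply: eq_bigr => b _; apply: eq_bigr => d _.
    by rewrite mxE expr2.
  rewrite (@sum_lt_half _ _ (fun a b => \sum_c \sum_d f (row a E) (row b E) (row c E) (row d E) ^+ 2)).
  + have -> : \sum_(i < p) \sum_(j < p | (i < j)%N) \sum_c \sum_d f (row i E) (row j E) (row c E) (row d E) ^+ 2 =
      2 * (\sum_(i < p) \sum_(j < p | (i < j)%N) \sum_(k < p) \sum_(l < p | (k < l)%N)
            f (row i E) (row j E) (row k E) (row l E) ^+ 2).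
      rewrite mulr_sumr; apply: eq_bigr => i _; rewrite mulr_sumr; apply: eq_bigr => j _.
      apply: sum_lt_half => [k l|k]; first by rewrite f34 sqrrN.
      have := f34 (row i E) (row j E) (row k E) (row k E) => h.
      have -> : f (row i E) (row j E) (row k E) (row k E) = 0 by lra.
      by rewrite expr0n.
    lra.
  + by move=> i j; apply: eq_bigr => k _; apply: eq_bigr => l _; rewrite f12 sqrrN.
  + move=> i; rewrite big1 // => k _; rewrite big1 // => l _.
    have := f12 (row i E) (row i E) (row k E) (row l E) => h.
    have -> : f (row i E) (row i E) (row k E) (row l E) = 0 by lra.
    by rewrite expr0n.
- by rewrite f21; apply: eq_bigr => i _; apply: eq_bigr => j _; rewrite ricE expr2.
- rewrite trmx1 mul1mx; congr (_ * _ ^+ 2).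
  by apply: eq_bigr => i _; rewrite ricE.
Qed.
End FrameFormula.

Section RVsym.
Context {R : realType} {n : nat}.
Variables (T : 'rV[R]_n -> 'rV[R]_n -> 'rV[R]_n -> R)
  (Q : 'rV[R]_n -> 'rV[R]_n -> 'rV[R]_n -> 'rV[R]_n -> R) (H : 'M[R]_n).
Lemma riem_form_swap12 u v w z : riem_form T Q H v u w z = - riem_form T Q H u v w z.
Proof. by rewrite /riem_form; ring. Qed.
Lemma riem_form_swap34 u v w z : H^T = H -> riem_form T Q H u v z w = - riem_form T Q H u v w z.
Proof.
move=> Hs; rewrite /riem_form (pairing_sym (chr_low T u z) _ Hs) (pairing_sym (chr_low T v z) _ Hs); ring.
Qed.
End RVsym.

(** * The second Weyl invariant in coordinates *)

Section PartialRules.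
Context {R : realType} {n : nat}.
Implicit Types (f g : 'rV[R]_n -> R^o).

Lemma partialM i f g x : differentiable f x -> differentiable g x ->
  partial i (fun y => f y * g y) x = f x * partial i g x + partial i f x * g x.
Proof.
move=> df dg; rewrite /partial [LHS]deriveM; try exact: diff_derivable.
by rewrite /GRing.scale /= (mulrC (g x)).
Qed.

Lemma partialD i f g x : differentiable f x -> differentiable g x ->
  partial i (fun y => f y + g y) x = partial i f x + partial i g x.
Proof. by move=> df dg; rewrite /partial [LHS]deriveD; try exact: diff_derivable. Qed.

Lemma partialB i f g x : differentiable f x -> differentiable g x ->
  partial i (fun y => f y - g y) x = partial i f x - partial i g x.
Proof. by move=> df dg; rewrite /partial [LHS]deriveB; try exact: diff_derivable. Qed.

Lemma derive_sumE (W : normedModType R) m (h : 'I_m -> 'rV[R]_n -> W) x v :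
  (forall i, differentiable (h i) x) ->
  'D_v (fun y => \sum_i h i y) x = \sum_i 'D_v (h i) x.
Proof.
move=> dh; have -> : (fun y => \sum_i h i y) = \sum_i h i.
  by apply/funext => y; rewrite fct_sumE.
by rewrite derive_sum // => i; exact: diff_derivable.
Qed.

Lemma partial_sum m i (h : 'I_m -> 'rV[R]_n -> R^o) x :
  (forall j, differentiable (h j) x) ->
  partial i (fun y => \sum_j h j y) x = \sum_j partial i (h j) x.
Proof. exact: derive_sumE. Qed.

Lemma partial_near i f g x : (\forall y \near x, f y = g y) -> partial i f x = partial i g x.
Proof. exact: near_eq_derive. Qed.

End PartialRules.

HB.lock Definition dmetric (R : realType) (n : nat) (G : 'rV[R]_n -> 'M[R]_n) (x : 'rV[R]_n)
  (c : 'I_n) : 'M[R]_n := \matrix_(i, j) partial c (fun y => G y i j) x.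

HB.lock Definition ddmetric (R : realType) (n : nat) (G : 'rV[R]_n -> 'M[R]_n) (x : 'rV[R]_n)
  (c d : 'I_n) : 'M[R]_n :=
  \matrix_(i, j) partial c (partial d (fun y => G y i j)) x.

Section Riemann.
Context {R : realType} {n : nat}.
Implicit Types (G : 'rV[R]_n -> 'M[R]_n).

Lemma dmetricE G x c i j : dmetric G x c i j = partial c (fun y => G y i j) x.
Proof. by rewrite dmetric.unlock mxE. Qed.

Lemma ddmetricE G x c d i j :
  ddmetric G x c d i j = partial c (partial d (fun y => G y i j)) x.
Proof. by rewrite ddmetric.unlock mxE. Qed.

Definition riem_metric G x := riem_form (jet1 (dmetric G x)) (jet2 (ddmetric G x)) (invmx (G x)).

Lemma riem_metric_multilin G x : multilin4 (riem_metric G x).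
Proof. exact: jet_multilin. Qed.

Variables (A : set 'rV[R]_n) (G : 'rV[R]_n -> 'M[R]_n) (x : 'rV[R]_n).
Hypothesis oA : open A.
Hypothesis Ax : A x.
Hypothesis CG : Ck_on 2 A G.
Hypothesis uG : forall y, A y -> G y \in unitmx.
Hypothesis sG : forall y, A y -> (G y)^T = G y.

Let nearA : \forall y \near x, A y := near_open oA Ax.

Lemma dmetric_sym y c : A y -> (dmetric G y c)^T = dmetric G y c.
Proof.
move=> Ay; apply/matrixP => i j; rewrite mxE !dmetricE; apply: partial_near.
by apply: filterS (near_open oA Ay) => z /sG h; rewrite -[in LHS]h mxE.
Qed.

Let CGe i j : Ck_on 2 A (fun y => G y i j : R^o).
Proof. exact: (Ck_entry i j oA CG). Qed.

Let CdG c i j : Ck_on 1 A (partial c (fun y => G y i j)).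
Proof. exact: (Ck_derive _ (CGe i j)). Qed.

Let dCk1 (f : 'rV[R]_n -> R^o) : Ck_on 1 A f -> differentiable f x.
Proof. by move=> Cf; exact: Ck_differentiable Cf Ax. Qed.

Let lowchr i j k (y : 'rV[R]_n) : R^o := 2^-1 * (partial i (fun z => G z j k) y
  + partial j (fun z => G z i k) y - partial k (fun z => G z i j) y).

Let Clow i j k : Ck_on 1 A (lowchr i j k).
Proof.
apply: CkM => //; first exact: Ck_cst.
by apply: CkB => //; apply: CkD.
Qed.

Let christoffel_low k i j y : christoffel G k i j y = \sum_l invmx (G y) k l * lowchr i j l y.
Proof.
rewrite /christoffel mulr_sumr; apply: eq_bigr => l _.
by rewrite /lowchr; ring.
Qed.

Let Cchr k i j : Ck_on 1 A (christoffel G k i j : 'rV[R]_n -> R^o).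
Proof.
have E : forall y, A y -> \sum_l invmx (G y) k l * lowchr i j l y = christoffel G k i j y.
  by move=> y _; rewrite christoffel_low.
apply: (Ck_on_eq oA E); apply: Ck_sum => // l; apply: CkM => //.
exact: (Ck_entry k l oA (Ck_invmx oA uG (Ck_onS CG))).
Qed.

Let lower_chr k i j y : A y -> \sum_p G y k p * christoffel G p i j y = lowchr i j k y.
Proof.
move=> Ay; transitivity (\sum_p \sum_l G y k p * invmx (G y) p l * lowchr i j l y).
  apply: eq_bigr => p _; rewrite christoffel_low mulr_sumr.
  by apply: eq_bigr => l _; rewrite mulrA.
rewrite exchange_big /= (bigD1 k) //= [X in _ + X]big1 ?addr0 => [|l lk].
  rewrite -mulr_suml; have := mulmxV (uG Ay) => /matrixP/(_ k k); rewrite !mxE => ->.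
  by rewrite eqxx mul1r.
rewrite -mulr_suml; have := mulmxV (uG Ay) => /matrixP/(_ k l); rewrite !mxE => ->.
by rewrite eq_sym (negbTE lk) mul0r.
Qed.

Let dlower i k j l : \sum_p G x k p * partial i (christoffel G p j l) x =
  partial i (lowchr j l k) x - \sum_p partial i (fun y => G y k p) x * christoffel G p j l x.
Proof.
have -> : partial i (lowchr j l k) x =
    partial i (fun y => \sum_p G y k p * christoffel G p j l y) x.
  by apply: partial_near; apply: filterS nearA => y Ay; rewrite lower_chr.
rewrite partial_sum; last first.
  move=> p; apply: dCk1; apply: CkM => //; exact: Ck_onS.
rewrite -sumrB; apply: eq_bigr => p _.
have -> := partialM i (dCk1 (Ck_onS (CGe k p))) (dCk1 (Cchr p j l)).
by rewrite addrK.
Qed.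

Let partial_low i j l k : partial i (lowchr j l k) x =
  2^-1 * (ddmetric G x i j l k + ddmetric G x i l j k - ddmetric G x i k j l).
Proof.
have C2 := CkD oA (CdG j l k) (CdG l j k).
have e1 := partialD i (dCk1 (CdG j l k)) (dCk1 (CdG l j k)).
have e2 := partialB i (dCk1 C2) (dCk1 (CdG k j l)).
have e3 := partialM i (differentiable_cst (2^-1 : R^o) x) (dCk1 (CkB oA C2 (CdG k j l))).
have c0 : partial i (cst (2^-1 : R^o)) x = 0 by rewrite /partial derive_cst.
rewrite (ddmetricE G x i j l k).
rewrite (ddmetricE G x i l j k).
rewrite (ddmetricE G x i k j l).
refine (etrans e3 _).
rewrite c0.
rewrite mul0r.
rewrite addr0.
refine (congr1 (fun t => 2^-1 * t) _).
refine (etrans e2 _).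
exact (congr1 (fun t => t - _) e1).
Qed.

Lemma ddmetric_comm c d : ddmetric G x c d = ddmetric G x d c.
Proof. apply/matrixP => i j; rewrite (ddmetricE G x c d) (ddmetricE G x d c); exact (derive_comm _ _ oA Ax (CGe i j)). Qed.

Let dG_split i k q : partial i (fun y => G y k q) x = lowchr i q k x + lowchr i k q x.
Proof.
have e1 : partial i (fun z => G z q k) x = partial i (fun z => G z k q) x.
  by have := dmetric_sym i Ax => /matrixP/(_ k q); rewrite mxE !dmetricE.
by rewrite /lowchr e1; lra.
Qed.

Let lowchrE i j k : lowchr i j k x =
  chr_low (jet1 (dmetric G x)) (delta_mx 0 i) (delta_mx 0 j) (delta_mx 0 k).
Proof. by rewrite /chr_low !jet1_delta !dmetricE. Qed.

Let quad i k j l : \sum_q lowchr i k q x * christoffel G q j l x =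
  pairing (invmx (G x)) (chr_low (jet1 (dmetric G x)) (delta_mx 0 i) (delta_mx 0 k))
                   (chr_low (jet1 (dmetric G x)) (delta_mx 0 j) (delta_mx 0 l)).
Proof.
rewrite /pairing; apply: eq_bigr => q _; rewrite christoffel_low mulr_sumr.
by apply: eq_bigr => r _; rewrite -!lowchrE; ring.
Qed.

(** Lowering the index of the definition of the curvature operator. The inverse
    metric is never differentiated: differentiating the identity g_kp
    Gamma^p_jl = Gamma_jl,k instead gives g_kp d_i Gamma^p_jl, and the
    derivatives of g in the correction terms are sums of two Christoffel
    symbols of the first kind, one of which cancels against the quadratic
    terms. *)
Lemma riemann_comp i j k l : \sum_p G x k p * curvature_op G i j l p x =
  riem_metric G x (delta_mx 0 i) (delta_mx 0 j) (delta_mx 0 k) (delta_mx 0 l).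
Proof.
transitivity ((\sum_p G x k p * partial i (christoffel G p j l) x)
  - (\sum_p G x k p * partial j (christoffel G p i l) x)
  + ((\sum_q lowchr i q k x * christoffel G q j l x)
  - (\sum_q lowchr j q k x * christoffel G q i l x))).
  have up a b c : \sum_q lowchr a q k x * christoffel G q b c x =
      \sum_p \sum_q G x k p * (christoffel G q b c x * christoffel G p a q x).
    rewrite [RHS]exchange_big; apply: eq_bigr => q _; rewrite -lower_chr // mulr_suml.
    by apply: eq_bigr => p _; ring.
  rewrite !up -!sumrB -big_split; apply: eq_bigr => p _ /=.
  rewrite /curvature_op mulrDr mulrBr; congr (_ + _).
  by rewrite sumrB mulrBr !mulr_sumr.
(* The first of the two sums cancels against the quadratic terms of the
   curvature operator; the second is a pairing by the inverse metric. *)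
have sp a b c : \sum_p partial a (fun y => G y k p) x * christoffel G p b c x =
    \sum_q lowchr a q k x * christoffel G q b c x +
    \sum_q lowchr a k q x * christoffel G q b c x.
  rewrite -big_split; apply: eq_bigr => p _ /=.
  exact (etrans (congr1 (fun t => t * _) (dG_split a k p)) (mulrDl _ _ _)).
have X a b c := etrans (dlower a k b c) (congr2 (fun s t => s - t) (partial_low a b c k)
  (etrans (sp a b c) (congr1 (fun t => _ + t) (quad a k b c)))).
refine (etrans (congr2 (fun s t => s - t + _) (X i j l) (X j i l)) _).
rewrite (ddmetric_comm j i) /riem_metric /riem_form !jet2_delta.
have final (a b c b' c' s1 s2 t1 t2 : R) :
  2^-1 * (a + b - c) - (s1 + t1) - (2^-1 * (a + b' - c') - (s2 + t2)) + (s1 - s2) =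
  2^-1 * (b - c - b' + c') - t1 + t2 by lra.
exact: final.
Qed.

Lemma riemannE u v w z : riemann G x u v w z = riem_metric G x u v w z.
Proof.
rewrite (multilin4_expand _ _ _ _ (riem_metric_multilin G x)) /riemann.
apply: eq_bigr => i _; apply: eq_bigr => j _; apply: eq_bigr => k _; apply: eq_bigr => l _.
by rewrite riemann_comp.
Qed.

(** The second Weyl invariant without a choice of an orthonormal basis. *)
Definition h4_coord G x : R := weyl_h4 (invmx (G x)) (components (riem_metric G x) 1%:M).

Lemma invmx_sym (M : 'M[R]_n) : M^T = M -> (invmx M)^T = invmx M.
Proof. by move=> sM; rewrite trmx_inv sM. Qed.

(** For E orthonormal, E^T E is the inverse of the Gram matrix, so the
    invariant computed in the frame E is the contraction by the inverse
    metric. *)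
Lemma h4_orthonormal E : orthonormal_basis (G x) E -> h4 G x E = h4_coord G x.
Proof.
move=> oE.
have f12 u v w z : riemann G x v u w z = - riemann G x u v w z.
  by rewrite !riemannE; exact: riem_form_swap12.
have f34 u v w z : riemann G x u v z w = - riemann G x u v w z.
  by rewrite !riemannE; apply: riem_form_swap34; apply: invmx_sym; exact: sG.
have := weyl_h4_frame f12 f34 E; rewrite /h4 /scal /ricci => <-.
have EE : E^T *m 1%:M *m E = invmx (G x).
  rewrite mulmx1.
  have uE : E \in unitmx by have /mulmx1_unit[] : E *m (G x *m E^T) = 1%:M by rewrite mulmxA.
  have h1 : G x *m E^T *m E = 1%:M.
    by apply: (mulmx1C); rewrite mulmxA.
  apply: (can_inj (mulKmx (uG Ax))).
  by rewrite mulmxA h1 mulmxV //; exact: uG.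
rewrite /h4_coord -EE -weyl_h4_push.
have -> : components (riemann G x) E = components (riem_metric G x) E.
  by apply/funext => a; apply/funext => c; apply/matrixP => b d; rewrite !mxE riemannE.
congr (weyl_h4 _ _); apply/funext => a; apply/funext => c.
by apply: components_push; exact: riem_metric_multilin.
Qed.

End Riemann.

(** * Invariance under changes of coordinates *)

Lemma derive_mul (R : realType) (n : nat) (f g : 'rV[R]_n -> R^o) x v :
  differentiable f x -> differentiable g x ->
  'D_v (fun y => f y * g y : R^o) x = 'D_v f x * g x + f x * 'D_v g x.
Proof.
move=> df dg; rewrite [LHS]deriveM; try exact: diff_derivable.
by rewrite /GRing.scale /= addrC (mulrC (g x)).
Qed.

Section MatrixRules.
Context {R : realType} {p : nat}.
Variables (B : set 'rV[R]_p).
Hypothesis oB : open B.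

Let dCk (W : normedModType R) (F : 'rV[R]_p -> W) y : Ck_on 1 B F -> B y -> differentiable F y.
Proof. by move=> CF By; exact: (Ck_differentiable CF By). Qed.

Lemma derive_mulmx m n q (F : 'rV[R]_p -> 'M[R]_(m, n)) (G : 'rV[R]_p -> 'M[R]_(n, q)) y u :
  B y -> Ck_on 1 B F -> Ck_on 1 B G ->
  'D_u (fun y => F y *m G y) y = 'D_u F y *m G y + F y *m 'D_u G y.
Proof.
move=> By CF CG; apply/matrixP => i j.
have dF := dCk CF By; have dG := dCk CG By.
have dFG : differentiable (fun y => F y *m G y) y.
  by apply: dCk => //; exact: Ck_mulmx.
have dFe a b : differentiable (fun y => F y a b : R^o) y by apply: dCk => //; exact: Ck_entry.
have dGe a b : differentiable (fun y => G y a b : R^o) y by apply: dCk => //; exact: Ck_entry.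
refine (etrans (derive_entry u i j dFG) _).
have -> : (fun y => (F y *m G y) i j : R^o) = fun y => \sum_l F y i l * G y l j.
  by apply/funext => z; rewrite mxE.
refine (etrans (derive_sumE u _) _).
  by move=> l; apply: differentiableM; [exact: dFe|exact: dGe].
rewrite !mxE -big_split; apply: eq_bigr => l _ /=.
refine (etrans (derive_mul u (dFe i l) (dGe l j)) _).
by rewrite -(derive_entry u i l dF) -(derive_entry u l j dG).
Qed.

Lemma derive_trmx m n (F : 'rV[R]_p -> 'M[R]_(m, n)) y u :
  B y -> Ck_on 1 B F -> 'D_u (fun y => (F y)^T) y = ('D_u F y)^T.
Proof.
move=> By CF; apply/matrixP => i j.
have dF := dCk CF By.
have dFT : differentiable (fun y => (F y)^T) y by apply: dCk => //; exact: Ck_trmx.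
refine (etrans (derive_entry u i j dFT) _).
have -> : (fun y => (F y)^T i j : R^o) = fun y => F y j i by apply/funext => z; rewrite mxE.
by rewrite mxE (derive_entry u j i dF).
Qed.

Lemma derive_bform n (M : 'rV[R]_p -> 'M[R]_n) (v w : 'rV[R]_p -> 'rV[R]_n) y u :
  B y -> Ck_on 1 B M -> Ck_on 1 B v -> Ck_on 1 B w ->
  'D_u (fun y => bform (M y) (v y) (w y) : R^o) y =
  bform ('D_u M y) (v y) (w y) + bform (M y) ('D_u v y) (w y) + bform (M y) (v y) ('D_u w y).
Proof.
move=> By CM Cv Cw.
have CvM := Ck_mulmx oB Cv CM; have CwT := Ck_trmx oB Cw.
have CvMw := Ck_mulmx oB CvM CwT.
refine (etrans (esym (derive_entry u 0 0 (dCk CvMw By))) _).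
refine (etrans (congr1 (fun X : 'M[R]_1 => X 0 0) (derive_mulmx u By CvM CwT)) _).
rewrite (derive_mulmx u By Cv CM) (derive_trmx u By Cw).
rewrite mulmxDl /bform mxE [X in X + _]mxE.
by rewrite [X in X + _ = _]addrC.
Qed.

Lemma Ck_bform k n (M : 'rV[R]_p -> 'M[R]_n) (v w : 'rV[R]_p -> 'rV[R]_n) :
  Ck_on k B M -> Ck_on k B v -> Ck_on k B w ->
  Ck_on k B (fun y => bform (M y) (v y) (w y) : R^o).
Proof.
move=> CM Cv Cw.
exact: (Ck_entry 0 0 oB (Ck_mulmx oB (Ck_mulmx oB Cv CM) (Ck_trmx oB Cw))).
Qed.

Lemma Ck_scale k m n (s : 'rV[R]_p -> R^o) (M : 'rV[R]_p -> 'M[R]_(m, n)) :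
  Ck_on k B s -> Ck_on k B M -> Ck_on k B (fun y => s y *: M y).
Proof.
move=> Cs CM; apply: Ck_mx => // i j.
have -> : (fun y => (s y *: M y) i j : R^o) = fun y => s y * M y i j.
  by apply/funext => y; rewrite mxE.
by apply: CkM => //; exact: Ck_entry.
Qed.

Lemma derive_scale m n (s : 'rV[R]_p -> R^o) (M : 'rV[R]_p -> 'M[R]_(m, n)) y u :
  B y -> Ck_on 1 B s -> Ck_on 1 B M ->
  'D_u (fun y => s y *: M y) y = 'D_u s y *: M y + s y *: 'D_u M y.
Proof.
move=> By Cs CM; apply/matrixP => i j.
have dsM := dCk (Ck_scale Cs CM) By.
refine (etrans (derive_entry u i j dsM) _).
have -> : (fun y => (s y *: M y) i j : R^o) = fun y => s y * M y i j.
  by apply/funext => z; rewrite mxE.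
have dMe := dCk (Ck_entry i j oB CM) By.
refine (etrans (derive_mul u (dCk Cs By) dMe) _).
by rewrite -(derive_entry u i j (dCk CM By)) !mxE.
Qed.

End MatrixRules.

Section JetDerive.
Context {R : realType} {n : nat}.
Variables (A : set 'rV[R]_n) (G : 'rV[R]_n -> 'M[R]_n).
Hypothesis oA : open A.
Hypothesis CG : Ck_on 2 A G.

Lemma dmetric_derive x c : A x -> dmetric G x c = 'D_(delta_mx 0 c) G x.
Proof.
move=> Ax; apply/matrixP => i j; rewrite dmetricE.
by rewrite (derive_entry _ i j (Ck_differentiable CG Ax)).
Qed.

Lemma ddmetric_derive x c d : A x -> ddmetric G x c d = 'D_(delta_mx 0 c) ('D_(delta_mx 0 d) G) x.
Proof.
move=> Ax; apply/matrixP => i j; rewrite ddmetricE.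
rewrite (derive_entry _ i j (Ck_differentiable (Ck_derive _ CG) Ax)).
apply: partial_near; apply: filterS (near_open oA Ax) => y Ay.
by rewrite (derive_entry _ i j (Ck_differentiable CG Ay)).
Qed.

Variables (p : nat) (B : set 'rV[R]_p) (phi : 'rV[R]_p -> 'rV[R]_n).
Hypothesis oB : open B.
Hypothesis BA : forall y, B y -> A (phi y).
Hypothesis Cphi : Ck_on 3 B phi.

Let dphi y : B y -> differentiable phi y.
Proof. by move=> By; exact: (Ck_differentiable Cphi By). Qed.

Let CGphi : Ck_on 1 B (fun y => G (phi y)).
Proof. exact: (Ck_comp_mx oB oA BA (Ck_onS (Ck_onS Cphi)) (Ck_onS CG)). Qed.

Let CDGphi c : Ck_on 1 B (fun y => dmetric G (phi y) c).
Proof.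
have H := Ck_comp_mx oB oA BA (Ck_onS (Ck_onS Cphi)) (Ck_derive (delta_mx 0 c) CG).
by apply: (Ck_on_eq oB _ H) => y By; rewrite dmetric_derive //; exact: BA.
Qed.

Lemma derive_metric_comp y u : B y ->
  'D_u (fun y => G (phi y)) y = \sum_c ('D_u phi y) 0 c *: dmetric G (phi y) c.
Proof.
move=> By; have Ay := BA By.
rewrite (derive_comp_rV u (dphi By) (Ck_differentiable CG Ay)).
by apply: eq_bigr => c _; rewrite dmetric_derive.
Qed.

Lemma derive_dmetric_comp y u c : B y ->
  'D_u (fun y => dmetric G (phi y) c) y = \sum_d ('D_u phi y) 0 d *: ddmetric G (phi y) d c.
Proof.
move=> By; have Ay := BA By.
have -> : 'D_u (fun y => dmetric G (phi y) c) y = 'D_u (fun y => 'D_(delta_mx 0 c) G (phi y)) y.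
  apply: near_eq_derive; apply: filterS (near_open oB By) => z Bz.
  by rewrite dmetric_derive //; exact: BA.
rewrite (derive_comp_rV u (dphi By) (Ck_differentiable (Ck_derive _ CG) Ay)).
by apply: eq_bigr => d _; rewrite ddmetric_derive.
Qed.

Lemma derive_metric_form (f g : 'rV[R]_p -> 'rV[R]_n) y u : B y ->
  Ck_on 1 B f -> Ck_on 1 B g ->
  'D_u (fun y => bform (G (phi y)) (f y) (g y) : R^o) y =
  jet1 (dmetric G (phi y)) ('D_u phi y) (f y) (g y)
  + bform (G (phi y)) ('D_u f y) (g y) + bform (G (phi y)) (f y) ('D_u g y).
Proof.
move=> By Cf Cg; rewrite (derive_bform oB u By CGphi Cf Cg).
by rewrite (derive_metric_comp _ By).
Qed.

(** Product and chain rule for the first derivative of the metric along phi,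
    evaluated on three moving vectors; differentiating the derivative of a
    pullback leads to such expressions. *)
Lemma derive_d1_form (h f g : 'rV[R]_p -> 'rV[R]_n) y u : B y ->
  Ck_on 1 B h -> Ck_on 1 B f -> Ck_on 1 B g ->
  'D_u (fun y => jet1 (dmetric G (phi y)) (h y) (f y) (g y) : R^o) y =
  jet2 (ddmetric G (phi y)) ('D_u phi y) (h y) (f y) (g y)
  + jet1 (dmetric G (phi y)) ('D_u h y) (f y) (g y)
  + jet1 (dmetric G (phi y)) (h y) ('D_u f y) (g y)
  + jet1 (dmetric G (phi y)) (h y) (f y) ('D_u g y).
Proof.
move=> By Ch Cf Cg.
have Che c := Ck_entry 0 c oB Ch.
have Csc c := Ck_scale oB (Che c) (CDGphi c).
have CM : Ck_on 1 B (fun y => \sum_c h y 0 c *: dmetric G (phi y) c).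
  by apply: Ck_sum.
refine (etrans (derive_bform oB u By CM Cf Cg) _); congr (_ + _ + _).
have -> : 'D_u (fun y => \sum_c h y 0 c *: dmetric G (phi y) c) y =
    1 *: (\sum_c ('D_u phi y) 0 c *: \sum_d h y 0 d *: ddmetric G (phi y) c d) +
    \sum_c ('D_u h y) 0 c *: dmetric G (phi y) c.
  refine (etrans (derive_sumE u _) _).
    by move=> c; exact: (Ck_differentiable (Csc c) By).
  rewrite scale1r.
  transitivity (\sum_c ('D_u h y) 0 c *: dmetric G (phi y) c +
     \sum_c h y 0 c *: \sum_d ('D_u phi y) 0 d *: ddmetric G (phi y) d c).
    rewrite -big_split; apply: eq_bigr => c _ /=.
    refine (etrans (derive_scale oB u By (Che c) (CDGphi c)) _).
    rewrite (derive_dmetric_comp _ _ By).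
    by rewrite (derive_entry u 0 c (Ck_differentiable Ch By)).
  rewrite addrC; congr (_ + _).
  transitivity (\sum_c \sum_d (h y 0 c * ('D_u phi y) 0 d) *: ddmetric G (phi y) d c).
    by apply: eq_bigr => c _; rewrite scaler_sumr; apply: eq_bigr => d _; rewrite scalerA.
  rewrite exchange_big; apply: eq_bigr => d _ /=.
  by rewrite scaler_sumr; apply: eq_bigr => c _; rewrite scalerA mulrC.
by rewrite bform_linM mul1r.
Qed.
End JetDerive.

Lemma derive_comm_mx (R : realType) (p m q : nat) (B : set 'rV[R]_p)
    (F : 'rV[R]_p -> 'M[R]_(m, q)) y u v : open B -> B y -> Ck_on 2 B F ->
  'D_u ('D_v F) y = 'D_v ('D_u F) y.
Proof.
move=> oB By CF; apply/matrixP => i j.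
have aux a b : ('D_a ('D_b F) y) i j = 'D_a ('D_b (fun z => F z i j : R^o)) y.
  rewrite (derive_entry a i j (Ck_differentiable (Ck_derive b CF) By)).
  apply: near_eq_derive; apply: filterS (near_open oB By) => z Bz.
  by rewrite (derive_entry b i j (Ck_differentiable CF Bz)).
refine (etrans (aux u v) (etrans _ (esym (aux v u)))).
exact (derive_comm u v oB By (Ck_entry i j oB CF)).
Qed.

Section PullbackJets.
Context {R : realType} {n p : nat}.
Variables (A : set 'rV[R]_n) (G : 'rV[R]_n -> 'M[R]_n).
Variables (B : set 'rV[R]_p) (phi : 'rV[R]_p -> 'rV[R]_n).
Hypothesis oA : open A.
Hypothesis CG : Ck_on 2 A G.
Hypothesis oB : open B.
Hypothesis BA : forall y, B y -> A (phi y).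
Hypothesis Cphi : Ck_on 3 B phi.

Variables (P : 'I_p -> 'rV[R]_p -> 'rV[R]_n) (K : 'I_p -> 'I_p -> 'rV[R]_p -> 'rV[R]_n)
  (L : 'I_p -> 'I_p -> 'I_p -> 'rV[R]_p -> 'rV[R]_n).
Hypothesis hP : forall i, P i = 'D_(delta_mx 0 i) phi.
Hypothesis hK : forall k i, K k i = 'D_(delta_mx 0 k) (P i).
Hypothesis hL : forall k l i, L k l i = 'D_(delta_mx 0 k) (K l i).

Let hPy i y : 'D_(delta_mx 0 i) phi y = P i y. Proof. by rewrite hP. Qed.
Let hKy k i y : 'D_(delta_mx 0 k) (P i) y = K k i y. Proof. by rewrite hK. Qed.
Let hLy k l i y : 'D_(delta_mx 0 k) (K l i) y = L k l i y. Proof. by rewrite hL. Qed.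

Lemma CP i : Ck_on 2 B (P i).
Proof. by rewrite hP; exact: Ck_derive. Qed.
Lemma CK k i : Ck_on 1 B (K k i).
Proof. by rewrite hK; exact: (Ck_derive _ (CP i)). Qed.

Lemma row_JP y i : B y -> row i ('J phi y) = P i y.
Proof. by move=> By; rewrite (row_jacobian i (Ck_differentiable Cphi By)) hP. Qed.

(** Here and below, P, K and L are names for the first, second and third
    partial derivatives of phi. They are variables with defining equations,
    so that computations with the long expressions below treat them as
    opaque vectors. *)
Lemma pullback_entry y i j : B y ->
  pullback phi G y i j = bform (G (phi y)) (P i y) (P j y).
Proof.
move=> By; rewrite -!row_JP // /pullback !rowE -bform_push bform_delta.
by [].
Qed.

Lemma dmetric_pullback y l i j : B y -> dmetric (pullback phi G) y l i j =
  jet1 (dmetric G (phi y)) (P l y) (P i y) (P j y)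
  + bform (G (phi y)) (K l i y) (P j y) + bform (G (phi y)) (P i y) (K l j y).
Proof.
move=> By; rewrite dmetricE.
have E : partial l (fun y => pullback phi G y i j) y =
    'D_(delta_mx 0 l) (fun y => bform (G (phi y)) (P i y) (P j y) : R^o) y.
  by apply: partial_near; apply: filterS (near_open oB By) => z; exact: pullback_entry.
refine (etrans E (etrans (derive_metric_form oA CG oB BA Cphi (delta_mx 0 l) By
  (Ck_onS (CP i)) (Ck_onS (CP j))) _)).
by rewrite hPy !hKy.
Qed.

(** The terms and their grouping are those of the hypothesis [hQ] of
    [riem_form_change]. *)
Lemma ddmetric_pullback y k l i j : B y -> ddmetric (pullback phi G) y k l i j =
  jet2 (ddmetric G (phi y)) (P k y) (P l y) (P i y) (P j y)
  + jet1 (dmetric G (phi y)) (K k l y) (P i y) (P j y)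
  + jet1 (dmetric G (phi y)) (P l y) (K k i y) (P j y)
  + jet1 (dmetric G (phi y)) (P l y) (P i y) (K k j y)
  + (jet1 (dmetric G (phi y)) (P k y) (K l i y) (P j y)
     + bform (G (phi y)) (L k l i y) (P j y) + bform (G (phi y)) (K l i y) (K k j y))
  + (jet1 (dmetric G (phi y)) (P k y) (P i y) (K l j y)
     + bform (G (phi y)) (K k i y) (K l j y) + bform (G (phi y)) (P i y) (L k l j y)).
Proof.
move=> By; rewrite ddmetricE.
pose F1 z : R^o := jet1 (dmetric G (phi z)) (P l z) (P i z) (P j z).
pose F2 z : R^o := bform (G (phi z)) (K l i z) (P j z).
pose F3 z : R^o := bform (G (phi z)) (P i z) (K l j z).
have E : partial k (partial l (fun y => pullback phi G y i j)) y =
    partial k (fun z => F1 z + F2 z + F3 z) y.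
  apply: partial_near; apply: filterS (near_open oB By) => z Bz.
  exact (etrans (esym (dmetricE _ _ _ _ _)) (dmetric_pullback l i j Bz)).
have CP1 a := Ck_onS (CP a).
have CGphi : Ck_on 1 B (fun y => G (phi y)).
  exact: (Ck_comp_mx oB oA BA (Ck_onS (Ck_onS Cphi)) (Ck_onS CG)).
have C2 : Ck_on 1 B F2 by exact: (Ck_bform oB CGphi (CK l i) (CP1 j)).
have C3 : Ck_on 1 B F3 by exact: (Ck_bform oB CGphi (CP1 i) (CK l j)).
have C1 : Ck_on 1 B F1.
  have CDGphi c : Ck_on 1 B (fun y => dmetric G (phi y) c).
    have H := Ck_comp_mx oB oA BA (Ck_onS (Ck_onS Cphi)) (Ck_derive (delta_mx 0 c) CG).
    by apply: (Ck_on_eq oB _ H) => z Bz; rewrite (dmetric_derive CG) //; exact: BA.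
  have CM : Ck_on 1 B (fun y => \sum_c P l y 0 c *: dmetric G (phi y) c).
    have Csc c := Ck_scale oB (Ck_entry 0 c oB (CP1 l)) (CDGphi c).
    by apply: Ck_sum.
  exact: (Ck_bform oB CM (CP1 i) (CP1 j)).
have dd (F : 'rV[R]_p -> R^o) : Ck_on 1 B F -> differentiable F y.
  by move=> CF; exact: (Ck_differentiable CF By).
have e1 := derive_d1_form oA CG oB BA Cphi (delta_mx 0 k) By (CP1 l) (CP1 i) (CP1 j).
have e2 := derive_metric_form oA CG oB BA Cphi (delta_mx 0 k) By (CK l i) (CP1 j).
have e3 := derive_metric_form oA CG oB BA Cphi (delta_mx 0 k) By (CP1 i) (CK l j).
refine (etrans E (etrans (partialD k (dd _ (CkD oB C1 C2)) (dd _ C3)) _)).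
refine (etrans (congr1 (fun t => t + _) (partialD k (dd _ C1) (dd _ C2))) _).
refine (etrans (congr2 (fun s t => s + t + _) e1 e2) _).
refine (etrans (congr1 (fun t => _ + t) e3) _).
by rewrite hPy !hKy !hLy.
Qed.

Lemma K_sym y a b : B y -> K a b y = K b a y.
Proof.
move=> By; rewrite !hK !hP.
exact (derive_comm_mx _ _ oB By (Ck_onS Cphi)).
Qed.

Lemma L_sym1 y a b c : B y -> L a b c y = L a c b y.
Proof.
move=> By; rewrite !hL; apply: near_eq_derive.
by apply: filterS (near_open oB By) => z Bz; exact: K_sym.
Qed.

Lemma L_sym2 y a b c : B y -> L a b c y = L b a c y.
Proof.
move=> By; rewrite !hL (hK b c) (hK a c).
exact (derive_comm_mx _ _ oB By (CP c)).
Qed.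

Hypothesis uG : forall x, A x -> G x \in unitmx.
Hypothesis sG : forall x, A x -> (G x)^T = G x.

Lemma riem_metric_pullback y i j k l : B y ->
  ('J phi y)^T *m invmx (pullback phi G y) *m 'J phi y = invmx (G (phi y)) ->
  riem_metric (pullback phi G) y (delta_mx 0 i) (delta_mx 0 j) (delta_mx 0 k) (delta_mx 0 l) =
  riem_metric G (phi y) (row i ('J phi y)) (row j ('J phi y)) (row k ('J phi y)) (row l ('J phi y)).
Proof.
move=> By HJ; have Ay := BA By.
refine (@riem_form_change R n p (invmx (G (phi y))) (jet1 (dmetric G (phi y))) (jet2 (ddmetric G (phi y)))
  (bform (G (phi y))) (invmx (pullback phi G y)) _ _ ('J phi y) (fun a b => K a b y)
  (fun a b c => L a b c y) _ _ _ _ _ _ HJ _ _ _ _ _ _ i j k l).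
- by apply: invmx_sym; exact: sG.
- exact: jet1_lin1.
- exact: jet1_lin3.
- by move=> u v w; apply: jet1_sym => c; exact: (dmetric_sym oA sG).
- exact: bform_linr.
- by move=> u v; apply: bform_sym; exact: sG.
- by move=> a b; exact: K_sym.
- by move=> a b c; exact: L_sym1.
- by move=> a b c; exact: L_sym2.
- move=> a b g lg; apply: pairing_form => //.
  by rewrite mulmxK //; exact: uG.
- by move=> l' i' j'; rewrite jet1_delta !row_JP // dmetric_pullback.
- by move=> k' l' i' j'; rewrite jet2_delta !row_JP // ddmetric_pullback.
Qed.
End PullbackJets.

(** Tensoriality of the curvature and the contraction identity combine. Class
    C^3 of phi is what makes the pulled back metric of class C^2. *)
Theorem h4_coord_pullback (R : realType) (n : nat) (A B : set 'rV[R]_n) (G : 'rV[R]_n -> 'M[R]_n)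
    (phi : 'rV[R]_n -> 'rV[R]_n) y :
  open A -> Ck_on 2 A G -> open B -> (forall y, B y -> A (phi y)) -> Ck_on 3 B phi ->
  (forall x, A x -> G x \in unitmx) -> (forall x, A x -> (G x)^T = G x) ->
  B y -> 'J phi y \in unitmx -> h4_coord (pullback phi G) y = h4_coord G (phi y).
Proof.
move=> oA CG oB BA Cphi uG sG By uJ; set J := 'J phi y in uJ.
have HJ : J^T *m invmx (pullback phi G y) *m J = invmx (G (phi y)).
  by apply: invmx_conj => //; exact: uG (BA _ By).
rewrite /h4_coord -HJ -weyl_h4_push; congr (weyl_h4 _ _).
apply/funext => a; apply/funext => c; rewrite -components_push; last exact: riem_metric_multilin.
apply/matrixP => b d; rewrite !mxE !row1.
exact: (riem_metric_pullback oA CG oB BA Cphi (fun=> erefl) (fun=> fun=> erefl)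
  (fun=> fun=> fun=> erefl) uG sG a b c d By HJ).
Qed.

(** * Positive definite matrices and orthonormal bases *)

Section Orthonormal.
Context {R : realType}.

Definition posdef n (A : 'M[R]_n) := forall v : 'rV[R]_n, v != 0 -> 0 < bform A v v.

Lemma posdef_unit n (A : 'M[R]_n) : posdef A -> A \in unitmx.
Proof.
move=> pA; rewrite -row_free_unit -kermx_eq0; apply/eqP/row_matrixP => i; rewrite row0.
apply/eqP/negPn/negP => /pA; rewrite /bform -row_mul mulmx_ker row0 mul0mx mxE.
by rewrite ltxx.
Qed.

(** Gram-Schmidt by induction on the dimension: one step of symmetric
    elimination splits off the first vector and leaves the Schur
    complement, which is again positive definite. *)
Lemma orthonormal_exists n (A : 'M[R]_n) : A^T = A -> posdef A ->
  exists E, orthonormal_basis A E.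
Proof.
elim: n A => [|n IH] A sA pA; first by exists 1%:M; apply/matrixP => -[].
pose k : 'M[R]_(1 + n) := A.
pose a0 := k 0 0; pose b := ursubmx k; pose d := drsubmx k.
have ul : ulsubmx k = a0%:M.
  apply/matrixP => i j; rewrite !ord1 !mxE eqxx /= mulr1n /a0.
  by congr (k _ _); exact: val_inj.
have dl : dlsubmx k = b^T.
  by rewrite /b trmx_ursub; congr dlsubmx; exact: esym.
have kE : k = block_mx a0%:M b b^T d by rewrite -ul -dl submxK.
have a0P : 0 < a0.
  have := pA (delta_mx 0 0); rewrite bform_delta; apply.
  by apply/eqP => /matrixP/(_ 0 0); rewrite !mxE eqxx => /eqP; rewrite oner_eq0.
pose al := (Num.sqrt a0)^-1.
have al2 : al * a0 * al = 1.
  rewrite mulrAC -expr2 /al exprVn sqr_sqrtr ?ltW // mulVf //; exact: lt0r_neq0.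
(* Normalizes the first basis vector and makes the others orthogonal to it. *)
pose E0 : 'M[R]_(1 + n) := block_mx al%:M 0 (- (a0^-1 *: b^T)) 1%:M.
pose k' := d - a0^-1 *: (b^T *m b).
have a0N : a0 != 0 by exact: lt0r_neq0.
have E0k1 : E0 *m k = block_mx (al * a0)%:M (al *: b) 0 k'.
  rewrite kE /E0 mulmx_block !mul0mx !addr0 !mul1mx !mul_scalar_mx scale_scalar_mx.
  rewrite !mulNmx mul_mx_scalar scalerA mulfV // scale1r addNr.
  by rewrite /k' -scalemxAl addrC.
have E0T : E0^T = block_mx al%:M (- (a0^-1 *: b)) 0 1%:M.
  by rewrite /E0 tr_block_mx !tr_scalar_mx trmx0 linearN linearZ /= trmxK.
have E0k : E0 *m k *m E0^T = block_mx 1%:M 0 0 k'.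
  rewrite E0k1 E0T mulmx_block !mul0mx !mulmx0 !mulmx1 !addr0 !add0r.
  rewrite -scalar_mxM al2 mul_scalar_mx scalerN scalerA mulfK // addNr.
  by [].
have sk' : k'^T = k'.
  have sd : d^T = d by rewrite /d trmx_drsub; congr drsubmx.
  by rewrite /k' linearB linearZ /= trmx_mul trmxK sd.
have pk' : posdef k'.
  move=> v v0; pose w := row_mx (0 : 'rV[R]_1) v *m E0.
  have w0 : w != 0.
    apply: contraNneq v0 => w0; have := congr1 rsubmx w0.
    by rewrite /w /E0 mul_row_block row_mxKr mulmx0 mulmx1 add0r => ->; rewrite linear0.
  have := pA w w0; rewrite -[A]/k -bform_push E0k.
  rewrite /bform mul_row_block !mul0mx mulmx0 !add0r ?addr0 tr_row_mx mul_row_col.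
  by rewrite mul0mx add0r.
have [E' oE'] := IH _ sk' pk'.
pose E1 : 'M[R]_(1 + n) := block_mx 1%:M 0 0 E'.
exists (E1 *m E0 : 'M[R]_(1 + n)); rewrite /orthonormal_basis -[A]/k.
have -> : E1 *m E0 *m k *m (E1 *m E0)^T = E1 *m (E0 *m k *m E0^T) *m E1^T.
  by rewrite trmx_mul !mulmxA.
rewrite E0k /E1 tr_block_mx !trmx0 trmx1 !mulmx_block !mul0mx !mulmx0 !addr0 !add0r.
by rewrite !mul1mx !mulmx1 !mul0mx oE' -scalar_mx_block.
Qed.
End Orthonormal.

(** * Continuity of the invariant in the 2-jet *)

Section JetInvariant.
Context {R : realType}.

(** The second Weyl invariant of a metric with Gram matrix A, first derivatives
    D1 and second derivatives D2 at a point. It makes sense for jets that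
    come from no metric, such as the limit of the rescaled jets. *)
Definition h4jet n (A : 'M[R]_n) (D1 : 'I_n -> 'M[R]_n) (D2 : 'I_n -> 'I_n -> 'M[R]_n) : R :=
  weyl_h4 (invmx A) (components (riem_form (jet1 D1) (jet2 D2) (invmx A)) 1%:M).

(** Two jets related by a constant linear map J as under a linear change of
    coordinates have the same invariant. The map may be degenerate: J may
    be rectangular, and the only link between the metrics themselves is
    through their inverses. With J diagonal this is the rescaling of a
    frame; with J the projection onto the fibre directions it forgets the
    base. *)
Lemma h4jet_change n p (A : 'M[R]_n) D1 D2 (A' : 'M[R]_p)
    (D1' : 'I_p -> 'M[R]_p) (D2' : 'I_p -> 'I_p -> 'M[R]_p) (J : 'M[R]_(p, n)) :
  A^T = A -> (forall c, (D1 c)^T = D1 c) -> J^T *m invmx A' *m J = invmx A ->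
  (forall l i j, D1' l i j = jet1 D1 (row l J) (row i J) (row j J)) ->
  (forall k l i j, D2' k l i j = jet2 D2 (row k J) (row l J) (row i J) (row j J)) ->
  h4jet A' D1' D2' = h4jet A D1 D2.
Proof.
move=> sA sD1 HJ h1 h2; rewrite /h4jet -HJ -weyl_h4_push; congr (weyl_h4 _ _).
apply/funext => a; apply/funext => c; rewrite -components_push; last exact: jet_multilin.
apply/matrixP => b d; rewrite !mxE !row1 HJ.
have lin_0 n' : linform (fun _ : 'rV[R]_n' => 0 : R) by move=> t x y; rewrite mulr0 addr0.
refine (@riem_form_change R n p (invmx A) (jet1 D1) (jet2 D2) (fun _ _ => 0) (invmx A') _ _ J
  (fun _ _ => 0) (fun _ _ _ => 0) _ _ _ _ _ _ HJ _ _ _ _ _ _ a b c d) => //.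
- exact: invmx_sym.
- exact: jet1_lin1.
- exact: jet1_lin3.
- by move=> u v w; exact: jet1_sym.
- move=> _ _ g lg; rewrite (linform0 lg) /pairing big1 // => q _; rewrite big1 // => q' _.
  by rewrite mul0r mulr0.
- by move=> l i j; rewrite jet1_delta h1 !addr0.
- move=> k l i j; rewrite jet2_delta h2 !addr0.
  rewrite (linform0 (jet1_lin1 _ _ _)) (linform0 (jet1_lin2 _ _ _)) (linform0 (jet1_lin3 _ _ _)).
  by rewrite (linform0 (jet1_lin2 _ _ _)) (linform0 (jet1_lin3 _ _ _)) !addr0.
Qed.

(** The invariant is a polynomial in the entries of the jet and of the inverse
    matrix; the proof names the entries and follows the formula. *)
Lemma h4jet_continuous m n (B : set 'rV[R]_m) (A : 'rV[R]_m -> 'M[R]_n)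
    (D1 : 'I_n -> 'rV[R]_m -> 'M[R]_n) (D2 : 'I_n -> 'I_n -> 'rV[R]_m -> 'M[R]_n) :
  open B -> (forall q, B q -> A q \in unitmx) ->
  Ck_on 0 B A -> (forall c, Ck_on 0 B (D1 c)) -> (forall c d, Ck_on 0 B (D2 c d)) ->
  Ck_on 0 B (fun q => h4jet (A q) (fun c => D1 c q) (fun c d => D2 c d q) : R^o).
Proof.
move=> oB uA CA CD1 CD2.
have CH : Ck_on 0 B (fun q => invmx (A q)) by exact: Ck_invmx.
have CHT : Ck_on 0 B (fun q => (invmx (A q))^T) by exact: Ck_trmx.
have CHe i j : Ck_on 0 B (fun q => invmx (A q) i j : R^o) by exact: Ck_entry.
have CHTe i j : Ck_on 0 B (fun q => (invmx (A q))^T i j : R^o) by exact: Ck_entry.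
have CD1e c i j : Ck_on 0 B (fun q => D1 c q i j : R^o) by exact: Ck_entry.
have CD2e c d i j : Ck_on 0 B (fun q => D2 c d q i j : R^o) by exact: Ck_entry.
pose ch i j k (q : 'rV[R]_m) : R^o := 2^-1 * (D1 i q j k + D1 j q i k - D1 k q i j).
have Cch i j k : Ck_on 0 B (ch i j k).
  by apply: CkM => //; [exact: Ck_cst|exact: (CkB oB (CkD oB (CD1e _ _ _) (CD1e _ _ _)) (CD1e _ _ _))].
pose ipq i k j l (q : 'rV[R]_m) : R^o := \sum_s \sum_t invmx (A q) s t * (ch i k s q * ch j l t q).
have Cip i k j l : Ck_on 0 B (ipq i k j l).
  apply: Ck_sum => // s; apply: Ck_sum => // t.
  exact: (CkM oB (CHe s t) (CkM oB (Cch i k s) (Cch j l t))).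
pose T (q : 'rV[R]_m) := components (riem_form (jet1 (fun c => D1 c q)) (jet2 (fun c d => D2 c d q)) (invmx (A q))) 1%:M.
have TE i k j l q : T q i k j l = 2^-1 * (D2 i l q j k - D2 i k q j l - D2 j l q i k + D2 j k q i l)
    - ipq i k j l q + ipq j k i l q.
  rewrite /T mxE !row1 /riem_form !jet2_delta /pairing /ipq /ch /chr_low.
  by under eq_bigr do under eq_bigr do rewrite !jet1_delta;
     under [X in _ + X]eq_bigr do under eq_bigr do rewrite !jet1_delta.
have CTe i k j l : Ck_on 0 B (fun q => T q i k j l : R^o).
  rewrite (_ : (fun q => _) = fun q => 2^-1 * (D2 i l q j k - D2 i k q j l - D2 j l q i k + D2 j k q i l)
    - ipq i k j l q + ipq j k i l q); last by apply/funext => q; exact: TE.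
  have Cq := CkM oB (Ck_cst 0 B (2^-1 : R^o)) (CkD oB (CkB oB (CkB oB (CD2e i l j k)
    (CD2e i k j l)) (CD2e j l i k)) (CD2e j k i l)).
  exact: (CkD oB (CkB oB Cq (Cip i k j l)) (Cip j k i l)).
have CT i k : Ck_on 0 B (fun q => T q i k) by apply: Ck_mx.
have Ctr p (F : 'rV[R]_m -> 'M[R]_p) : Ck_on 0 B F -> Ck_on 0 B (fun q => \tr (F q) : R^o).
  by move=> CF; apply: Ck_sum => // i; exact: Ck_entry.
have Cf2 (P Q : 'rV[R]_m -> 'M[R]_n) : Ck_on 0 B P -> Ck_on 0 B Q ->
    Ck_on 0 B (fun q => contract2 (invmx (A q)) (P q) (Q q) : R^o).
  move=> CP CQ; apply: Ctr.
  exact: (Ck_mulmx oB (Ck_mulmx oB (Ck_mulmx oB (Ck_trmx oB CP) CH) CQ) CHT).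
have Cric : Ck_on 0 B (fun q => ricci_contract (invmx (A q)) (T q)).
  apply: Ck_mx => // i k.
  rewrite (_ : (fun q => _) = fun q => \tr ((invmx (A q))^T *m T q i k)); last by apply/funext => q; rewrite mxE.
  by apply: Ctr; exact: (Ck_mulmx oB CHT (CT i k)).
have Cin i i' : Ck_on 0 B (fun q => \sum_k \sum_k' invmx (A q) k k' *
    contract2 (invmx (A q)) (T q i k) (T q i' k') : R^o).
  apply: (Ck_sum _ _ oB) => k; apply: (Ck_sum _ _ oB) => k'.
  exact (CkM oB (CHe k k') (Cf2 _ _ (CT i k) (CT i' k'))).
have Cnv : Ck_on 0 B (fun q => contract4 (invmx (A q)) (T q) (T q) : R^o).
  apply: (Ck_sum _ _ oB) => i; apply: (Ck_sum _ _ oB) => i'.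
  exact (CkM oB (CHe i i') (Cin i i')).
have Csc : Ck_on 0 B (fun q => \tr ((invmx (A q))^T *m ricci_contract (invmx (A q)) (T q)) : R^o).
  by apply: Ctr; exact: (Ck_mulmx oB CHT Cric).
have C4 := Ck_cst 0 B (4^-1 : R^o).
exact: (CkD oB (CkB oB (CkM oB C4 Cnv) (Cf2 _ _ Cric Cric)) (CkM oB C4 (CkM oB Csc Csc))).
Qed.
End JetInvariant.

(** * Stretching the base in adapted coordinates *)

Section Aux.
Context {R : realType}.

Lemma linform_scale n (f : 'rV[R]_n -> R) a x : linform f -> f (a *: x) = a * f x.
Proof. by move=> lf; rewrite -[a *: x]addr0 lf (linform0 lf) addr0. Qed.

Lemma jet1_scale n (D : 'I_n -> 'M[R]_n) a b c u v w :
  jet1 D (a *: u) (b *: v) (c *: w) = a * b * c * jet1 D u v w.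
Proof.
rewrite (linform_scale a u (jet1_lin1 _ _ _)) (linform_scale b v (jet1_lin2 _ _ _)).
by rewrite (linform_scale c w (jet1_lin3 _ _ _)) !mulrA.
Qed.

Lemma jet2_scale n (D : 'I_n -> 'I_n -> 'M[R]_n) a b c d t u v w :
  jet2 D (a *: t) (b *: u) (c *: v) (d *: w) = a * b * c * d * jet2 D t u v w.
Proof.
rewrite (linform_scale a t (jet2_lin1 _ _ _ _)) (linform_scale b u (jet2_lin2 _ _ _ _)).
by rewrite (linform_scale c v (jet2_lin3 _ _ _ _)) (linform_scale d w (jet2_lin4 _ _ _ _)) !mulrA.
Qed.

Lemma smooth_lsubmx n1 n2 (A : set 'rV[R]_(n1 + n2)) : open A ->
  smooth_on A (lsubmx : 'rV[R]_(n1 + n2) -> 'rV[R]_n1).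
Proof.
move=> oA k; apply: Ck_mx => // i j.
have -> : (fun q : 'rV[R]_(n1 + n2) => lsubmx q i j : R^o) = fun q => q i (lshift n2 j).
  by apply/funext => q; rewrite mxE.
exact: (Ck_entry i (lshift n2 j) oA (smooth_id A k)).
Qed.

(** Stated without a differentiability hypothesis: the difference quotients are
    identically zero. *)
Lemma derive_const_along (W : normedModType R) n (f : 'rV[R]_n -> W) x v :
  (forall h : R, f (h *: v + x) = f x) -> 'D_v f x = 0.
Proof.
move=> H; rewrite /derive.
have -> : (fun h : R => h^-1 *: ((f \o shift x) (h *: v) - f x)) = fun=> 0.
  by apply/funext => h /=; rewrite H subrr scaler0.
exact: lim_cst.
Qed.

Lemma derive_slice n1 n2 (f : 'rV[R]_(n1 + n2) -> R^o) a y v :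
  'D_v (fun y => f (row_mx a y)) y = 'D_(row_mx 0 v) f (row_mx a y).
Proof.
rewrite /derive.
have -> : (fun h : R => h^-1 *: (((fun y => f (row_mx a y)) \o shift y) (h *: v) - f (row_mx a y))) =
    (fun h => h^-1 *: ((f \o shift (row_mx a y)) (h *: row_mx 0 v) - f (row_mx a y))).
  by apply/funext => h /=; rewrite scale_row_mx scaler0 add_row_mx add0r.
by [].
Qed.

Lemma delta_rshift n1 n2 (l : 'I_n2) :
  row_mx (0 : 'rV[R]_n1) (delta_mx 0 l) = delta_mx 0 (rshift n1 l).
Proof.
apply/rowP => j; case: (split_ordP j) => j' ->.
  by rewrite row_mxEl !mxE eq_sym eq_rlshift andbF.
by rewrite row_mxEr !mxE eq_rshift.
Qed.

End Aux.

Section LinearJets.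
Context {R : realType} {n : nat}.
Variables (A : set 'rV[R]_n) (G P : 'rV[R]_n -> 'M[R]_n) (s : R).
Hypothesis oA : open A.
Hypothesis CG : Ck_on 2 A G.
Hypothesis CP : Ck_on 2 A P.

Let partialZ i (f : 'rV[R]_n -> R^o) x : differentiable f x ->
  partial i (fun y => s * f y) x = s * partial i f x.
Proof.
move=> df; refine (etrans (partialM i (differentiable_cst (s : R^o) x) df) _).
have -> : partial i (cst (s : R^o)) x = 0 by rewrite /partial derive_cst.
by rewrite mul0r addr0.
Qed.

Let diffe (F : 'rV[R]_n -> 'M[R]_n) i j x : A x -> Ck_on 2 A F ->
  differentiable (fun y => F y i j : R^o) x.
Proof. by move=> Ax CF; exact: (Ck_differentiable (Ck_entry i j oA CF) Ax). Qed.

Lemma dmetric_addZ x c : A x ->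
  dmetric (fun y => G y + s *: P y) x c = dmetric G x c + s *: dmetric P x c.
Proof.
move=> Ax; apply/matrixP => i j; rewrite dmetricE !mxE !dmetricE.
have -> : (fun y => (G y + s *: P y) i j) = fun y => G y i j + s * P y i j.
  by apply/funext => y; rewrite !mxE.
have dP := diffe i j Ax CP.
refine (etrans (partialD c (diffe i j Ax CG) (differentiableM (differentiable_cst (s : R^o) x) dP)) _).
by congr (_ + _); exact: partialZ.
Qed.

Lemma ddmetric_addZ x c d : A x ->
  ddmetric (fun y => G y + s *: P y) x c d = ddmetric G x c d + s *: ddmetric P x c d.
Proof.
move=> Ax; apply/matrixP => i j; rewrite ddmetricE !mxE !ddmetricE.
have E : partial c (partial d (fun y => (G y + s *: P y) i j)) x =
    partial c (fun y => partial d (fun y => G y i j) y + s * partial d (fun y => P y i j) y) x.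
  apply: partial_near; apply: filterS (near_open oA Ax) => y Ay.
  by have := dmetric_addZ d Ay => /matrixP/(_ i j); rewrite dmetricE !mxE !dmetricE.
have dG := Ck_differentiable (Ck_derive (delta_mx 0 d) (Ck_entry i j oA CG)) Ax.
have dP := Ck_differentiable (Ck_derive (delta_mx 0 d) (Ck_entry i j oA CP)) Ax.
refine (etrans E (etrans (partialD c dG (differentiableM (differentiable_cst (s : R^o) x) dP)) _)).
refine (congr1 (fun t => _ + t) _).
exact: (partialZ c dP).
Qed.
End LinearJets.

Section Adapted.
Context {R : realType} {b m : nat}.
Local Notation N := (b + m)%N.
Variables (V : set 'rV[R]_N) (G : 'rV[R]_N -> 'M[R]_N) (W : set 'rV[R]_b)
  (gB : 'rV[R]_b -> 'M[R]_b).
Hypothesis oV : open V.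
Hypothesis CG : Ck_on 2 V G.
Hypothesis sG : forall z, V z -> (G z)^T = G z.
Hypothesis pG : forall z, V z -> posdef (G z).
Hypothesis oW : open W.
Hypothesis CgB : Ck_on 2 W gB.
Hypothesis sgB : forall x, W x -> (gB x)^T = gB x.
Hypothesis pgB : forall x, W x -> posdef (gB x).
Hypothesis VW : forall z, V z -> W (lsubmx z).

(** The Gram matrix of the pullback of the metric of the base, in coordinates
    where the submersion is the projection onto the first b coordinates. *)
Definition base_block (z : 'rV[R]_N) : 'M[R]_N := block_mx (gB (lsubmx z)) 0 0 0.
Local Notation P := base_block.

(** The factors by which the coordinate vectors are rescaled: tau for base
    directions, 1 for fibre directions. *)
Definition weight (tau : R) (i : 'I_N) : R := if (i < b)%N then tau else 1.

Lemma weight_l tau i : weight tau (lshift m i) = tau.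
Proof. by rewrite /weight /= ltn_ord. Qed.
Lemma weight_r tau i : weight tau (rshift b i) = 1.
Proof. by rewrite /weight /= ltnNge leq_addr. Qed.

(** An entry of the base block is either a coefficient of the metric of the
    base, with both indices in base directions, or identically zero. *)
Lemma base_block_entry i j : (exists i' j', [/\ i = lshift m i', j = lshift m j' &
    forall z, P z i j = gB (lsubmx z) i' j']) \/
  ((forall z, P z i j = 0) /\ forall tau, weight tau i = 1 \/ weight tau j = 1).
Proof.
case: (split_ordP i) => i' ->; case: (split_ordP j) => j' ->.
- by left; exists i', j'; split=> // z; rewrite block_mxEul.
- by right; split=> [z|tau]; [rewrite block_mxEur mxE|right; exact: weight_r].
- by right; split=> [z|tau]; [rewrite block_mxEdl mxE|left; exact: weight_r].
- by right; split=> [z|tau]; [rewrite block_mxEdr mxE|left; exact: weight_r].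
Qed.

Lemma Ck_base_block : Ck_on 2 V P.
Proof.
apply: Ck_mx => // i j; have [[i' [j' [_ _ PE]]]|[P0 _]] := base_block_entry i j.
  have -> : (fun z => P z i j : R^o) = fun z => gB (lsubmx z) i' j'.
    by apply/funext => z; rewrite PE.
  exact: (Ck_entry i' j' oV (Ck_comp_mx oV oW VW (smooth_lsubmx oV 2) CgB)).
have -> : (fun z => P z i j : R^o) = fun=> 0 by apply/funext => z; rewrite P0.
exact: Ck_cst.
Qed.

Lemma base_block_weight tau i j z : weight tau i * weight tau j * P z i j = tau ^+ 2 * P z i j.
Proof.
have [[i' [j' [-> -> PE]]]|[P0 _]] := base_block_entry i j; last by rewrite P0 !mulr0.
by rewrite !weight_l expr2.
Qed.

Let shift_inv l (h : R) (z : 'rV[R]_N) :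
  lsubmx (h *: delta_mx 0 (rshift b l) + z) = lsubmx z :> 'rV[R]_b.
Proof.
apply/rowP => j; rewrite !mxE /= eq_lrshift mulr0 add0r.
by [].
Qed.

(** A nonzero derivative of the base block has all three indices in base
    directions, so rescaling the frame multiplies it by tau^3. The factor
    tau^-2 of the stretched metric leaves one power of tau, which tends to
    zero. *)
Lemma dbase_block_weight tau l i j z :
  weight tau l * weight tau i * weight tau j * dmetric P z l i j = tau ^+ 3 * dmetric P z l i j.
Proof.
have [[i' [j' [-> -> PE]]]|[P0 _]] := base_block_entry i j; last first.
  have -> : dmetric P z l i j = 0.
    rewrite dmetricE; apply: derive_const_along => h; by rewrite !P0.
  by rewrite !mulr0.
case: (split_ordP l) => l' ->; first by rewrite !weight_l; congr (_ * _); ring.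
have -> : dmetric P z (rshift b l') (lshift m i') (lshift m j') = 0.
  rewrite dmetricE; apply: derive_const_along => h.
  by rewrite /P !block_mxEul shift_inv.
by rewrite !mulr0.
Qed.

Lemma ddbase_block_weight tau k l i j z :
  weight tau k * weight tau l * weight tau i * weight tau j * ddmetric P z k l i j =
  tau ^+ 4 * ddmetric P z k l i j.
Proof.
have z0 : ddmetric P z k l i j = 0 ->
    weight tau k * weight tau l * weight tau i * weight tau j * ddmetric P z k l i j = tau ^+ 4 * ddmetric P z k l i j.
  by move=> ->; rewrite !mulr0.
have [[i' [j' [ei ej PE]]]|[P0 _]] := base_block_entry i j; last first.
  apply: z0; rewrite ddmetricE; apply: derive_const_along => h.
  have Z y : partial l (fun y => P y i j) y = 0.
    by apply: derive_const_along => t; rewrite !P0.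
  by rewrite !Z.
case: (split_ordP l) => l' el; last first.
  apply: z0; rewrite ddmetricE; apply: derive_const_along => h.
  have Z y : partial l (fun y => P y i j) y = 0.
    by apply: derive_const_along => t; rewrite !PE el shift_inv.
  by rewrite !Z.
case: (split_ordP k) => k' ek; last first.
  apply: z0; rewrite ddmetricE; apply: derive_const_along => h.
  pose f y : R^o := P y i j; pose c : 'rV[R]_N := h *: delta_mx 0 k.
  have fE : (fun y => f (y + c)) = f.
    by apply/funext => y; rewrite /f /c !PE ek addrC shift_inv.
  refine (etrans (congr1 (partial l f) (addrC c z)) _).
  refine (etrans (esym (derive_translate f (delta_mx 0 l) c z)) _).
  exact (congr1 (fun g : 'rV[R]_N -> R^o => 'D_(delta_mx 0 l) g z) fE).
by rewrite ei ej el ek !weight_l; congr (_ * _); ring.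
Qed.

(** The 2-jet of the stretched metric along the rescaled frame, written without
    negative powers of tau; this form makes sense, and is continuous, at
    tau = 0. *)
Definition scaled_metric tau z : 'M[R]_N :=
  \matrix_(i, j) (weight tau i * weight tau j * G z i j) + P z.
Definition scaled_D1 tau z l : 'M[R]_N :=
  \matrix_(i, j) (weight tau l * weight tau i * weight tau j * dmetric G z l i j) + tau *: dmetric P z l.
Definition scaled_D2 tau z k l : 'M[R]_N :=
  \matrix_(i, j) (weight tau k * weight tau l * weight tau i * weight tau j * ddmetric G z k l i j)
  + tau ^+ 2 *: ddmetric P z k l.

(** The metric g + s f^*g_B for s = tau^-2. *)
Definition stretched tau z := G z + tau^-2 *: P z.

Lemma bform_base_block z v : bform (P z) v v = bform (gB (lsubmx z)) (lsubmx v) (lsubmx v).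
Proof.
rewrite /bform -{1 2}[v]hsubmxK mul_row_block !mulmx0 !addr0 tr_row_mx mul_row_col.
by rewrite mul0mx addr0.
Qed.

Lemma posdef_stretched tau z : V z -> posdef (stretched tau z).
Proof.
move=> Vz v v0; rewrite /stretched addrC bform_linM bform_base_block.
apply: ltr_wpDl; last exact: pG.
apply: mulr_ge0; first by rewrite invr_ge0 exprn_even_ge0.
have [->|u0] := eqVneq (lsubmx v) 0; last by apply/ltW/pgB/u0/VW.
by rewrite /bform !mul0mx mxE.
Qed.

Lemma sym_base_block z : V z -> (P z)^T = P z.
Proof. by move=> Vz; rewrite tr_block_mx !trmx0 sgB //; exact: VW. Qed.

Lemma sym_stretched tau z : V z -> (stretched tau z)^T = stretched tau z.
Proof. by move=> Vz; rewrite /stretched linearD linearZ /= sG // sym_base_block. Qed.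

Let addE (M M' : 'M[R]_N) i j : (M + M') i j = M i j + M' i j.
Proof. by rewrite mxE. Qed.
Let scaleE a (M : 'M[R]_N) i j : (a *: M) i j = a * M i j.
Proof. by rewrite mxE. Qed.

(** For tau > 0 the rescaled jet is the jet of the stretched metric transformed
    by an invertible diagonal matrix. *)
Lemma scaled_h4 tau z : 0 < tau -> V z ->
  h4jet (scaled_metric tau z) (scaled_D1 tau z) (scaled_D2 tau z) = h4_coord (stretched tau) z.
Proof.
move=> t0 Vz; pose D : 'M[R]_N := diag_mx (\row_i weight tau i).
have tN : tau != 0 by exact: lt0r_neq0.
have t2 : tau ^+ 2 * tau^-2 = 1 by rewrite mulfV // expf_neq0.
have rowD i : row i D = weight tau i *: delta_mx 0 i by rewrite row_diag_mx mxE.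
have ME : scaled_metric tau z = D *m stretched tau z *m D^T.
  have DMD (M : 'M[R]_N) i j : (D *m M *m D^T) i j = weight tau i * M i j * weight tau j.
    by rewrite tr_diag_mx mul_diag_mx mul_mx_diag !mxE.
  apply/matrixP => i j; rewrite DMD /scaled_metric /stretched !addE scaleE [X in X + _]mxE.
  have := base_block_weight tau i j z; move: t2; set x := P z i j; set t := tau^-2 => t2 Px.
  rewrite mulrDr mulrDl; congr (_ + _); first by ring.
  transitivity (t * (weight tau i * weight tau j * x)); last by ring.
  by rewrite Px mulrA (mulrC t) t2 mul1r.
have uD : D \in unitmx.
  rewrite unitmxE det_diag unitfE; apply/prodf_neq0 => i _; rewrite mxE /weight.
  by case: ifP => // _; exact: oner_neq0.
have sGs c : (dmetric (stretched tau) z c)^T = dmetric (stretched tau) z c.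
  by apply: (dmetric_sym oV _ c Vz) => y Vy; exact: sym_stretched.
apply: (h4jet_change (J := D)) => //.
- exact: sym_stretched.
- by rewrite ME invmx_conj //; apply: posdef_unit; exact: posdef_stretched.
- move=> l i j; rewrite !rowD jet1_scale jet1_delta (dmetric_addZ _ oV CG Ck_base_block l Vz) /scaled_D1.
  rewrite !addE !scaleE [X in X + _]mxE.
  rewrite mulrDr; congr (_ + _).
  have := dbase_block_weight tau l i j z; move: t2; set x := dmetric P z l i j; set t := tau^-2 => t2 Px.
  transitivity (t * (weight tau l * weight tau i * weight tau j * x)); last by ring.
  rewrite Px (exprS tau 2); transitivity ((tau ^+ 2 * t) * (tau * x)); last by ring.
  by rewrite t2 mul1r.
- move=> k l i j; rewrite !rowD jet2_scale jet2_delta (ddmetric_addZ _ oV CG Ck_base_block k l Vz) /scaled_D2.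
  rewrite !addE !scaleE [X in X + _]mxE.
  rewrite mulrDr; congr (_ + _).
  have := ddbase_block_weight tau k l i j z; move: t2; set x := ddmetric P z k l i j; set t := tau^-2 => t2 Px.
  transitivity (t * (weight tau k * weight tau l * weight tau i * weight tau j * x)); last by ring.
  rewrite Px (exprD tau 2 2); transitivity ((tau ^+ 2 * t) * (tau ^+ 2 * x)); last by ring.
  by rewrite t2 mul1r.
Qed.

Section Fibre.
Variable z0 : 'rV[R]_N.
Hypothesis Vz0 : V z0.

(** The metric induced on the slice through z0 on which the base coordinates
    are constant. *)
Definition fibre_metric (y : 'rV[R]_m) : 'M[R]_m := drsubmx (G (row_mx (lsubmx z0) y)).
Local Notation kf := fibre_metric.
Local Notation y0 := (rsubmx z0).

Let P0 : 'M[R]_(N, m) := col_mx 0 1%:M.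

Let rowP0l i : row (lshift m i) P0 = 0.
Proof. by apply/rowP => j; rewrite mxE col_mxEu !mxE. Qed.
Let rowP0r i : row (rshift b i) P0 = delta_mx 0 i.
Proof. by apply/rowP => j; rewrite mxE col_mxEd !mxE eq_sym. Qed.

Let kf_entry i j : (fun y => kf y i j : R^o) =
  fun y => G (row_mx (lsubmx z0) y) (rshift b i) (rshift b j).
Proof. by apply/funext => y; rewrite /kf !mxE. Qed.

Let dmetric_kf y l i j : dmetric kf y l i j =
  dmetric G (row_mx (lsubmx z0) y) (rshift b l) (rshift b i) (rshift b j).
Proof.
rewrite dmetricE dmetricE kf_entry /partial -delta_rshift.
exact (derive_slice (fun z => G z (rshift b i) (rshift b j)) (lsubmx z0) y (delta_mx 0 l)).
Qed.

Let ddmetric_kf k l i j : ddmetric kf y0 k l i j =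
  ddmetric G z0 (rshift b k) (rshift b l) (rshift b i) (rshift b j).
Proof.
rewrite ddmetricE ddmetricE.
have E : partial l (fun y => kf y i j) =
    fun y => partial (rshift b l) (fun z => G z (rshift b i) (rshift b j)) (row_mx (lsubmx z0) y).
  apply/funext => y; exact (etrans (esym (dmetricE _ _ _ _ _)) (etrans (dmetric_kf y l i j) (dmetricE _ _ _ _ _))).
refine (etrans (congr1 (fun f : 'rV[R]_m -> R^o => partial k f y0) E) _).
refine (etrans (derive_slice (partial (rshift b l) (fun z => G z (rshift b i) (rshift b j)))
  (lsubmx z0) y0 (delta_mx 0 k)) _).
by rewrite hsubmxK delta_rshift.
Qed.

Let kf0 : kf y0 = drsubmx (G z0).
Proof. by rewrite /kf hsubmxK. Qed.

Let posdef_kf : posdef (kf y0).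
Proof.
move=> v v0; rewrite kf0.
have -> : bform (drsubmx (G z0)) v v = bform (G z0) (row_mx 0 v) (row_mx 0 v).
  rewrite /bform -[in RHS](submxK (G z0)) mul_row_block !mul0mx !add0r tr_row_mx mul_row_col.
  by rewrite trmx0 mulmx0 add0r.
apply: pG => //; apply: contraNneq v0 => /(congr1 rsubmx).
by rewrite row_mxKr linear0 => ->.
Qed.

Lemma scaled_metric0 : scaled_metric 0 z0 = block_mx (gB (lsubmx z0)) 0 0 (kf y0).
Proof.
rewrite kf0; apply/matrixP => i j; rewrite /scaled_metric addE [X in X + _]mxE.
case: (split_ordP i) => i' ->; case: (split_ordP j) => j' ->.
- by rewrite !weight_l !mul0r add0r !block_mxEul.
- by rewrite !weight_l !mul0r add0r !block_mxEur.
- by rewrite !weight_l mulr0 mul0r add0r !block_mxEdl.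
- by rewrite !weight_r !mul1r !block_mxEdr [X in _ + X]mxE addr0 !mxE.
Qed.

Lemma scaled_metric0_unit : scaled_metric 0 z0 \in unitmx.
Proof.
rewrite scaled_metric0 unitmxE det_ublock unitrM -!unitmxE.
by rewrite (posdef_unit posdef_kf) posdef_unit //; apply: pgB; exact: VW.
Qed.

(** At tau = 0 every component of the derivatives with an index in a base
    direction vanishes, and the metric is block diagonal. The jet is the
    pullback of the jet of the fibre metric by the projection onto the
    fibre directions, and pushing its inverse metric forward by that
    projection gives the inverse of the fibre metric. *)
Lemma fibre_h4 : h4jet (scaled_metric 0 z0) (scaled_D1 0 z0) (scaled_D2 0 z0) = h4_coord kf y0.
Proof.
have sk : (kf y0)^T = kf y0 by rewrite kf0 trmx_drsub sG.
apply: (h4jet_change (J := P0)) => //.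
- move=> c; apply/matrixP => i j; rewrite mxE !dmetric_kf hsubmxK.
  by have := dmetric_sym oV sG (rshift b c) Vz0 => /matrixP/(_ (rshift b i) (rshift b j)); rewrite mxE.
- have uk := posdef_unit posdef_kf; have ug : gB (lsubmx z0) \in unitmx.
    by apply/posdef_unit/pgB/VW.
  have -> : invmx (scaled_metric 0 z0) = block_mx (invmx (gB (lsubmx z0))) 0 0 (invmx (kf y0)).
    apply: invmx_uniq; rewrite scaled_metric0 mulmx_block !mul0mx !mulmx0 !addr0 !add0r.
    by rewrite !mulmxV // -scalar_mx_block.
  rewrite /P0 tr_col_mx trmx0 trmx1 mul_row_block !mul0mx !mulmx0 !add0r mul_row_col.
  by rewrite mulmx0 mul1mx mulmx1 add0r.
- move=> l i j; rewrite /scaled_D1 addE scaleE mul0r addr0 [LHS]mxE.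
  case: (split_ordP l) => l' ->; last case: (split_ordP i) => i' ->;
    last case: (split_ordP j) => j' ->.
  + by rewrite rowP0l (linform0 (jet1_lin1 _ _ _)) weight_l !mul0r.
  + by rewrite rowP0l (linform0 (jet1_lin2 _ _ _)) weight_l mulr0 !mul0r.
  + by rewrite rowP0l (linform0 (jet1_lin3 _ _ _)) weight_l mulr0 !mul0r.
  + by rewrite !rowP0r jet1_delta dmetric_kf hsubmxK !weight_r !mul1r.
- move=> k l i j; rewrite /scaled_D2 addE scaleE expr2 !mul0r addr0 [LHS]mxE.
  case: (split_ordP k) => k' ->; last case: (split_ordP l) => l' ->;
    last case: (split_ordP i) => i' ->; last case: (split_ordP j) => j' ->.
  + by rewrite rowP0l (linform0 (jet2_lin1 _ _ _ _)) weight_l !mul0r.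
  + by rewrite rowP0l (linform0 (jet2_lin2 _ _ _ _)) weight_l mulr0 !mul0r.
  + by rewrite rowP0l (linform0 (jet2_lin3 _ _ _ _)) weight_l mulr0 !mul0r.
  + by rewrite rowP0l (linform0 (jet2_lin4 _ _ _ _)) weight_l mulr0 !mul0r.
  + by rewrite !rowP0r jet2_delta ddmetric_kf !weight_r !mul1r.
Qed.

(** The invariant of the rescaled jet is a continuous function of the pair (z,
    tau), regarded as one point of a space of dimension b + m + 1, near
    (z0, 0), where its value is positive by [fibre_h4]. *)
Lemma stretched_positive : 0 < h4_coord kf y0 ->
  exists2 r, 0 < r & forall z tau, `|z - z0| < r -> 0 < tau < r ->
    V z /\ 0 < h4_coord (stretched tau) z.
Proof.
move=> h0; pose zq (q : 'rV[R]_(N + 1)) : 'rV[R]_N := lsubmx q.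
pose tq (q : 'rV[R]_(N + 1)) : R^o := q 0 (rshift N 0).
pose B0 := [set q | V (zq q)].
have oB0 : open B0.
  by apply: (@open_comp _ _ zq V) => // q _; exact: continuous_lsubmx.
have Czq : Ck_on 0 B0 zq by exact: smooth_lsubmx.
have Ctq : Ck_on 0 B0 tq by exact: (Ck_entry 0 (rshift N 0) oB0 (smooth_id B0 0)).
have Cwt i : Ck_on 0 B0 (fun q => weight (tq q) i : R^o).
  by rewrite /weight; case: (i < b)%N; [exact: Ctq|exact: Ck_cst].
have BV q : B0 q -> V (zq q) by [].
have Cpull (F : 'rV[R]_N -> 'M[R]_N) i j : Ck_on 0 V F -> Ck_on 0 B0 (fun q => F (zq q) i j : R^o).
  by move=> CF; exact: (Ck_entry i j oB0 (Ck_comp_mx oB0 oV BV Czq CF)).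
have CDG (F : 'rV[R]_N -> 'M[R]_N) c : Ck_on 2 V F -> Ck_on 0 V (fun z => dmetric F z c).
  move=> CF; apply: Ck_mx => // i j.
  have -> : (fun z => dmetric F z c i j : R^o) = partial c (fun z => F z i j).
    by apply/funext => z; rewrite dmetricE.
  exact (Ck_onS (Ck_derive (delta_mx 0 c) (Ck_entry i j oV CF))).
have CDDG (F : 'rV[R]_N -> 'M[R]_N) c d : Ck_on 2 V F -> Ck_on 0 V (fun z => ddmetric F z c d).
  move=> CF; apply: Ck_mx => // i j.
  have -> : (fun z => ddmetric F z c d i j : R^o) = partial c (partial d (fun z => F z i j)).
    by apply/funext => z; rewrite ddmetricE.
  exact (Ck_derive (delta_mx 0 c) (Ck_derive (delta_mx 0 d) (Ck_entry i j oV CF))).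
have CP0 := Ck_base_block.
have CA : Ck_on 0 B0 (fun q => scaled_metric (tq q) (zq q)).
  apply: Ck_mx => // i j.
  have -> : (fun q => scaled_metric (tq q) (zq q) i j : R^o) =
      fun q => weight (tq q) i * weight (tq q) j * G (zq q) i j + P (zq q) i j.
    by apply/funext => q; rewrite /scaled_metric addE [X in X + _]mxE.
  exact (CkD oB0 (CkM oB0 (CkM oB0 (Cwt i) (Cwt j)) (Cpull _ i j (Ck_onS (Ck_onS CG))))
    (Cpull _ i j (Ck_onS (Ck_onS CP0)))).
have CD1 l : Ck_on 0 B0 (fun q => scaled_D1 (tq q) (zq q) l).
  apply: Ck_mx => // i j.
  have -> : (fun q => scaled_D1 (tq q) (zq q) l i j : R^o) =
      fun q => weight (tq q) l * weight (tq q) i * weight (tq q) j * dmetric G (zq q) l i j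
               + tq q * dmetric P (zq q) l i j.
    by apply/funext => q; rewrite /scaled_D1 addE scaleE [X in X + _]mxE.
  exact (CkD oB0 (CkM oB0 (CkM oB0 (CkM oB0 (Cwt l) (Cwt i)) (Cwt j)) (Cpull _ i j (CDG G l CG)))
    (CkM oB0 Ctq (Cpull _ i j (CDG P l CP0)))).
have CD2 k l : Ck_on 0 B0 (fun q => scaled_D2 (tq q) (zq q) k l).
  apply: Ck_mx => // i j.
  have -> : (fun q => scaled_D2 (tq q) (zq q) k l i j : R^o) =
      fun q => weight (tq q) k * weight (tq q) l * weight (tq q) i * weight (tq q) j * ddmetric G (zq q) k l i j
               + (tq q * tq q) * ddmetric P (zq q) k l i j.
    by apply/funext => q; rewrite /scaled_D2 addE scaleE [X in X + _]mxE expr2.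
  exact (CkD oB0 (CkM oB0 (CkM oB0 (CkM oB0 (CkM oB0 (Cwt k) (Cwt l)) (Cwt i)) (Cwt j))
    (Cpull _ i j (CDDG G k l CG))) (CkM oB0 (CkM oB0 Ctq Ctq) (Cpull _ i j (CDDG P k l CP0)))).
pose B := [set q | B0 q /\ (\det (scaled_metric (tq q) (zq q)) : R^o) != 0].
have oB : open B by apply: open_neq0 => //; apply: Ck_det => // i j; exact: Ck_entry.
have BB0 : B `<=` B0 by move=> q [].
have uB q : B q -> scaled_metric (tq q) (zq q) \in unitmx.
  by move=> [_]; rewrite unitmxE unitfE.
pose Theta (q : 'rV[R]_(N + 1)) : R^o := h4jet (scaled_metric (tq q) (zq q))
  (fun c => scaled_D1 (tq q) (zq q) c) (fun c d => scaled_D2 (tq q) (zq q) c d).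
have CTheta : Ck_on 0 B Theta.
  exact (h4jet_continuous oB uB (Ck_on_sub BB0 CA) (fun c => Ck_on_sub BB0 (CD1 c))
    (fun c d => Ck_on_sub BB0 (CD2 c d))).
pose q0 : 'rV[R]_(N + 1) := row_mx z0 0.
have zq0 : zq q0 = z0 by rewrite /zq row_mxKl.
have tq0 : tq q0 = 0 by rewrite /tq row_mxEr mxE.
have Bq0 : B q0.
  split; first by rewrite /B0 /= zq0.
  by rewrite -unitfE -unitmxE tq0 zq0; exact: scaled_metric0_unit.
have Th0 : Theta q0 = h4_coord kf y0 by rewrite /Theta tq0 zq0; exact: fibre_h4.
have e0 : 0 < Theta q0 / 2 by rewrite Th0 divr_gt0.
have [r0 r00 H] := near_norm (filterI (near_open oB Bq0) (near_dist (CTheta q0 Bq0) e0)).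
exists (r0 / 2); first by rewrite divr_gt0.
move=> z tau zr /andP[t0 tr]; pose q : 'rV[R]_(N + 1) := row_mx z (const_mx tau).
have zqq : zq q = z by rewrite /zq row_mxKl.
have tqq : tq q = tau by rewrite /tq row_mxEr mxE.
have qr : `|q - q0| < r0.
  apply: (@le_lt_trans _ _ (r0 / 2)); last by move: r00; lra.
  apply: norm_le_entries; first by rewrite ltW // divr_gt0.
  move=> j; have -> : (q - q0) 0 j = q 0 j - q0 0 j by rewrite !mxE.
  rewrite /q /q0; case: (split_ordP j) => j' ->.
    rewrite !row_mxEl; have -> : z 0 j' - z0 0 j' = (z - z0) 0 j' by rewrite !mxE.
    exact: (le_trans (entry_le_norm _ _) (ltW zr)).
  by rewrite !row_mxEr !mxE subr0 gtr0_norm // ltW.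
have [Bq Hq] := H q qr.
have Vz : V z by have := BB0 _ Bq; rewrite /B0 /= zqq.
split=> //; rewrite -scaled_h4 //.
have -> : h4jet (scaled_metric tau z) (scaled_D1 tau z) (scaled_D2 tau z) = Theta q.
  by rewrite /Theta zqq tqq.
have pos (x y : R) : 0 < x / 2 -> `|x - y| <= x / 2 -> 0 < y.
  by rewrite ler_norml => ? /andP[? ?]; lra.
exact: pos e0 Hq.
Qed.
End Fibre.
End Adapted.

(** * Germs and pullbacks of metrics *)

Section Germs.
Context {R : realType}.

(** Regularity may be checked near each point, with neighbourhoods depending on
    the point; the deformed metric is given by a single chart of the base
    only near each point. *)
Lemma Ck_on_local n (W : normedModType R) k (A : set 'rV[R]_n) (f : 'rV[R]_n -> W) :
  (forall x, A x -> exists U, [/\ open U, U x & Ck_on k U f]) -> Ck_on k A f.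
Proof.
elim: k f => [|k IH] f H; first by move=> x /H [U [oU Ux CU]]; exact: CU.
split=> [x /H [U [oU Ux CU]]|v]; first exact: (Ck_differentiable CU Ux).
apply: IH => x /H [U [oU Ux CU]]; exists U; split=> //.
exact: (Ck_derive v CU).
Qed.

Lemma h4_coord_near n (G G' : 'rV[R]_n -> 'M[R]_n) x :
  (\forall y \near x, G y = G' y) -> h4_coord G x = h4_coord G' x.
Proof.
move=> GG'; rewrite /h4_coord /riem_metric (nbhs_singleton GG').
have E1 : dmetric G x = dmetric G' x.
  apply/funext => c; apply/matrixP => i j; rewrite !dmetricE; apply: partial_near.
  by apply: filterS GG' => y ->.
have E2 : ddmetric G x = ddmetric G' x.
  apply/funext => c; apply/funext => d; apply/matrixP => i j; rewrite !ddmetricE; apply: partial_near.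
  apply: filterS (nbhs_interior GG') => y yGG'; apply: partial_near.
  by apply: filterS yGG' => z ->.
by rewrite E1 E2.
Qed.

Lemma jacobian_near n p (f g : 'rV[R]_n -> 'rV[R]_p) x :
  (\forall y \near x, f y = g y) -> differentiable f x -> 'J f x = 'J g x.
Proof.
move=> fg df; apply/row_matrixP => i.
exact (etrans (row_jacobian i df) (etrans (near_eq_derive _ fg)
  (esym (row_jacobian i (near_eq_differentiable fg df))))).
Qed.

Lemma pullback_near n p (f g : 'rV[R]_n -> 'rV[R]_p) G x :
  (\forall y \near x, f y = g y) -> differentiable f x -> pullback f G x = pullback g G x.
Proof.
move=> fg df; exact (congr2 (fun J a => J *m G a *m J^T) (jacobian_near fg df) (nbhs_singleton fg)).
Qed.

Lemma pullback_comp n p q (f : 'rV[R]_n -> 'rV[R]_p) (g : 'rV[R]_p -> 'rV[R]_q) G x :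
  differentiable f x -> differentiable g (f x) ->
  pullback (fun y => g (f y)) G x = pullback f (pullback g G) x.
Proof.
move=> df dg; have E := jacobian_comp df dg.
refine (etrans (congr1 (fun J => J *m G (g (f x)) *m J^T) E) _).
by rewrite /pullback trmx_mul !mulmxA.
Qed.

Lemma pullbackD n p (f : 'rV[R]_n -> 'rV[R]_p) G G' s x :
  pullback f (fun y => G y + s *: G' y) x = pullback f G x + s *: pullback f G' x.
Proof. by rewrite /pullback mulmxDr mulmxDl -scalemxAr -scalemxAl. Qed.

Lemma Ck_pullback n p k (B : set 'rV[R]_n) (A : set 'rV[R]_p) (f : 'rV[R]_n -> 'rV[R]_p) G :
  open B -> open A -> (forall y, B y -> A (f y)) -> Ck_on k.+1 B f -> Ck_on k A G ->
  Ck_on k B (pullback f G).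
Proof.
move=> oB oA BA Cf CG; have CJ := Ck_jacobian oB Cf.
exact (Ck_mulmx oB (Ck_mulmx oB CJ (Ck_comp_mx oB oA BA (Ck_onS Cf) CG)) (Ck_trmx oB CJ)).
Qed.

Lemma pullback_sym n p (f : 'rV[R]_n -> 'rV[R]_p) G x :
  (G (f x))^T = G (f x) -> (pullback f G x)^T = pullback f G x.
Proof. by move=> sG; rewrite /pullback !trmx_mul trmxK sG mulmxA. Qed.

Lemma bform_pullback n p (f : 'rV[R]_n -> 'rV[R]_p) G x v w :
  bform (pullback f G x) v w = bform (G (f x)) (v *m 'J f x) (w *m 'J f x).
Proof. exact: bform_push. Qed.

Lemma posdef_pullback n p (f : 'rV[R]_n -> 'rV[R]_p) G x :
  posdef (G (f x)) -> row_free ('J f x) -> posdef (pullback f G x).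
Proof.
move=> pG fJ v v0; rewrite bform_pullback; apply: pG.
by apply: contraNneq v0 => vJ; rewrite -(mulmx_free_eq0 v fJ) vJ.
Qed.

Lemma posdef_ge0 n (A : 'M[R]_n) v : posdef A -> 0 <= bform A v v.
Proof.
move=> pA; have [->|v0] := eqVneq v 0; last exact/ltW/pA.
by rewrite /bform !mul0mx mxE.
Qed.

Lemma jacobian_lsubmx n1 n2 (x : 'rV[R]_(n1 + n2)) :
  'J (lsubmx : 'rV[R]_(n1 + n2) -> 'rV[R]_n1) x = col_mx 1%:M 0.
Proof.
apply/row_matrixP => i; rewrite row_jacobian; last exact: differentiable_lsubmx.
have -> : 'D_(delta_mx 0 i) (lsubmx : 'rV[R]_(n1 + n2) -> 'rV[R]_n1) x = lsubmx (delta_mx 0 i).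
  have := @derive_lin R _ _ _ (lsubmx : {linear 'rV[R]_(n1 + n2) -> 'rV[R]_n1}) id x (delta_mx 0 i)
    (@continuous_lsubmx _ _ _ _).
  by rewrite derive_id; apply; have [] := is_diff_id x.
apply/rowP => j; rewrite !mxE; case: (split_ordP i) => i' ->.
  by rewrite eq_lshift !mxE eq_sym.
by rewrite eq_lrshift /= mxE.
Qed.

Lemma jacobian_row_mx n n1 n2 (f : 'rV[R]_n -> 'rV[R]_n1) (g : 'rV[R]_n -> 'rV[R]_n2) x :
  differentiable f x -> differentiable g x ->
  differentiable (fun y => row_mx (f y) (g y)) x ->
  'J (fun y => row_mx (f y) (g y)) x = row_mx ('J f x) ('J g x).
Proof.
move=> df dg dfg; apply/matrixP => i j; rewrite (jacobianE i j dfg).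
case: (split_ordP j) => j' ->.
  rewrite row_mxEl (jacobianE i j' df); congr (partial i _ x); apply/funext => y.
  by rewrite row_mxEl.
rewrite row_mxEr (jacobianE i j' dg); congr (partial i _ x); apply/funext => y.
by rewrite row_mxEr.
Qed.

Lemma Ck_row_mx n n1 n2 k (A : set 'rV[R]_n)
    (f : 'rV[R]_n -> 'rV[R]_n1) (g : 'rV[R]_n -> 'rV[R]_n2) :
  open A -> Ck_on k A f -> Ck_on k A g -> Ck_on k A (fun y => row_mx (f y) (g y)).
Proof.
move=> oA Cf Cg; apply: Ck_mx => // i j; case: (split_ordP j) => j' ->.
  have -> : (fun y => row_mx (f y) (g y) i (lshift n2 j') : R^o) = fun y => f y i j'.
    by apply/funext => y; rewrite row_mxEl.
  exact: (Ck_entry i j' oA Cf).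
have -> : (fun y => row_mx (f y) (g y) i (rshift n1 j') : R^o) = fun y => g y i j'.
  by apply/funext => y; rewrite row_mxEr.
exact: (Ck_entry i j' oA Cg).
Qed.

Lemma jacobian_mulmxr n p (M : 'M[R]_(n, p)) x : 'J (fun y : 'rV[R]_n => y *m M) x = M.
Proof.
have dM : differentiable (fun y : 'rV[R]_n => y *m M) x.
  exact: (Ck_differentiable (Ck_mulmx openT (@smooth_id R n setT 1) (Ck_cst 1 setT M)) I).
apply/row_matrixP => i; refine (etrans (row_jacobian i dM) _).
have did : differentiable (id : 'rV[R]_n -> 'rV[R]_n) x by have [] := is_diff_id x.
refine (etrans (@derive_lin R n _ _ (mulmxr M) id x (delta_mx 0 i) (@mulmxr_continuous _ _ _ M) did) _).
by rewrite derive_id /= rowE.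
Qed.

(** A complement of the column space of the differential of the submersion
    supplies the fibre coordinates. *)
Lemma row_full_complement b m (J : 'M[R]_(b + m, b)) : row_full J ->
  exists L : 'M[R]_(b + m, m), row_mx J L \in unitmx.
Proof.
move=> fJ; have rJ : \rank J^T = b by rewrite mxrank_tr; exact: eqP fJ.
have rC : \rank (J^T)^C%MS = m by rewrite mxrank_compl rJ addKn.
pose C : 'M[R]_(m, b + m) := castmx (rC, erefl) (row_base (J^T)^C%MS).
exists C^T; rewrite -unitmx_tr tr_row_mx trmxK -row_full_unit.
have : (1%:M <= col_mx J^T C)%MS.
  have CE : (C :=: (J^T)^C)%MS.
    rewrite /C; apply: eqmx_trans (eq_row_base _).
    exact: eqmx_cast.
  rewrite -addsmxE (adds_eqmx (eqmx_refl _) CE).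
  by have := addsmx_compl_full J^T; rewrite -sub1mx.
by rewrite sub1mx.
Qed.
End Germs.

(** * The deformed metric on the total space *)

Lemma open_preimage (S T : topologicalType) (A : set S) (f : S -> T) (U : set T) :
  open A -> (forall x, A x -> {for x, continuous f}) -> open U ->
  open [set x | A x /\ U (f x)].
Proof.
move=> oA cf oU; rewrite openE => x [Ax Ux].
apply: filterS (filterI (near_open oA Ax) (cf x Ax _ (near_open oU Ux))) => y [Ay Uy].
by split.
Qed.

Section Charts.
Context {R : realType} {n : nat} {T : topologicalType}.
Implicit Types c d : chart R n T.

Lemma chart_imgP c x : chart_img c x ->
  chart_dom c (chart_inv c x) /\ chart_map c (chart_inv c x) = x.
Proof. by move=> [p dp <-]; rewrite chart_mapK. Qed.

Lemma chart_map_img c p : chart_dom c p -> chart_img c (chart_map c p).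
Proof. by move=> dp; exists p. Qed.

Lemma chart_map_for c p : chart_dom c p -> {for p, continuous (chart_map c)}.
Proof.
have := @chart_map_continuous _ _ _ c.
rewrite continuous_open_subspace; last exact: chart_dom_open.
by move=> H dp; apply: H; rewrite inE.
Qed.

Lemma chart_inv_for c x : chart_img c x -> {for x, continuous (chart_inv c)}.
Proof.
have := @chart_inv_continuous _ _ _ c.
rewrite continuous_open_subspace; last exact: chart_img_open.
by move=> H dp; apply: H; rewrite inE.
Qed.

Lemma overlap_open c d : open (overlap c d).
Proof.
apply: open_preimage; [exact: chart_img_open|exact: chart_inv_for|exact: chart_dom_open].
Qed.

Lemma transition_overlap c d x : overlap c d x -> overlap d c (transition c d x) /\
  chart_inv d (transition c d x) = chart_inv c x.
Proof.
move=> [cx dx]; have e : chart_inv d (transition c d x) = chart_inv c x by exact: chart_mapK.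
split=> //; split; first exact: chart_map_img.
by rewrite e; have [] := chart_imgP cx.
Qed.

Lemma transitionK c d x : overlap c d x -> transition d c (transition c d x) = x.
Proof.
move=> o; have [_ e] := transition_overlap o.
by rewrite {1}/transition e; have [] := chart_imgP o.1.
Qed.
End Charts.

Section Deformation.
Context {R : realType} {n b : nat}.
Variables (M : manifold R n) (B : manifold R b)
  (gM : riemannian_metric M) (gB : riemannian_metric B) (prj : M -> B).
Hypothesis smooth_prj : smooth_map prj.
Local Notation rep := (local_rep prj).
Local Notation dom := (local_rep_dom prj).
Local Notation tr := (fun i i' : atlas_index M => transition (atlas i) (atlas i')).
Local Notation ov := (fun i i' : atlas_index M => overlap (atlas i) (atlas i')).

Lemma rep_dom_open i j : open (dom i j).
Proof.
apply: (@open_preimage _ _ (chart_img (atlas i)) (fun x => prj (chart_inv (atlas i) x))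
  (chart_dom (atlas j))); [exact: chart_img_open| |exact: chart_dom_open].
move=> x ix; apply: (continuous_comp (chart_inv_for ix)).
by apply: (proj1 smooth_prj).
Qed.

Lemma rep_smooth i j k : Ck_on k (dom i j) (rep i j).
Proof. exact: (proj2 smooth_prj). Qed.

Lemma rep_diff i j x : dom i j x -> differentiable (rep i j) x.
Proof. by move=> dx; exact: (Ck_differentiable (rep_smooth i j 1) dx). Qed.

Lemma tr_diff i i' x : ov i i' x -> differentiable (tr i i') x.
Proof. by move=> ox; exact: (Ck_differentiable (@atlas_smooth _ _ M i i' 1%N) ox). Qed.

Lemma rep_img i j x : dom i j x -> chart_img (atlas j) (rep i j x).
Proof. by move=> [_ dx]; exact: chart_map_img. Qed.

Lemma rep_inv i j x : dom i j x -> chart_inv (atlas j) (rep i j x) = prj (chart_inv (atlas i) x).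
Proof. by move=> [_ dx]; exact: chart_mapK. Qed.

Definition baseform i j := pullback (rep i j) (metric gB j).

(** The metric of the base has compatible expressions in its charts, and
    pullbacks compose. *)
Lemma baseform_indep i j j' x : dom i j x -> dom i j' x -> baseform i j x = baseform i j' x.
Proof.
move=> dx dx'.
have o : overlap (atlas j) (atlas j') (rep i j x).
  by split; [exact: rep_img|rewrite rep_inv //; case: dx'].
have dt : differentiable (transition (atlas j) (atlas j')) (rep i j x).
  exact: (Ck_differentiable (@atlas_smooth _ _ B j j' 1%N) o).
have E1 : baseform i j x = pullback (rep i j) (pullback (transition (atlas j) (atlas j')) (metric gB j')) x.
  exact (congr1 (fun X => 'J (rep i j) x *m X *m ('J (rep i j) x)^T) (metric_compat gB o)).
refine (etrans E1 (etrans (esym (pullback_comp _ (rep_diff dx) dt)) _)).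
apply: pullback_near; last exact: (differentiable_comp (rep_diff dx) dt).
have nd := near_open (@rep_dom_open i j) dx.
apply: filterS nd => y dy.
by rewrite /transition rep_inv.
Qed.

Lemma dom_tr i i' j x : ov i i' x -> dom i j x -> dom i' j (tr i i' x).
Proof.
move=> ox dx; have [[ix' _] e] := transition_overlap ox.
by split=> //; rewrite e; case: dx.
Qed.

Lemma baseform_tr i i' j x : ov i i' x -> dom i j x ->
  baseform i j x = pullback (tr i i') (baseform i' j) x.
Proof.
move=> ox dx; have dx' := dom_tr ox dx.
refine (etrans _ (pullback_comp _ (tr_diff ox) (rep_diff dx'))).
apply: pullback_near; last exact: rep_diff.
apply: filterS (near_open (@overlap_open _ _ _ _ _) ox) => y oy.
by have [_ e] := transition_overlap oy; rewrite /local_rep e.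
Qed.

Lemma baseform_smooth i j : smooth_on (dom i j) (baseform i j).
Proof.
move=> k; apply: (@Ck_pullback _ _ _ k (dom i j) (chart_img (atlas j))).
- exact: rep_dom_open.
- exact: chart_img_open.
- exact: rep_img.
- exact: rep_smooth.
- exact: metric_smooth.
Qed.

Lemma baseform_sym i j x : dom i j x -> (baseform i j x)^T = baseform i j x.
Proof. by move=> dx; apply: pullback_sym; exact: (Defs.metric_sym gB (rep_img dx)). Qed.

Lemma baseform_ge0 i j x v : dom i j x -> 0 <= bform (baseform i j x) v v.
Proof.
move=> dx; rewrite bform_pullback; apply: posdef_ge0 => w.
exact: (metric_pos gB (rep_img dx)).
Qed.

(** Charts of the base are chosen pointwise. The choice is arbitrary, in
    particular not continuous, which is harmless because the result does
    not depend on the chart. *)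
Definition base_index (q : B) : atlas_index B := sval (cid (atlas_cover q)).

Lemma base_indexP q : chart_dom (atlas (base_index q)) q.
Proof. exact: (svalP (cid (atlas_cover q))). Qed.

Definition deformed s (i : atlas_index M) (x : 'rV[R]_n) : 'M[R]_n :=
  metric gM i x + s *: baseform i (base_index (prj (chart_inv (atlas i) x))) x.

Lemma dom_base_index i x : chart_img (atlas i) x ->
  dom i (base_index (prj (chart_inv (atlas i) x))) x.
Proof. by move=> ix; split=> //; exact: base_indexP. Qed.

Lemma deformedE s i j x : dom i j x -> deformed s i x = metric gM i x + s *: baseform i j x.
Proof.
move=> dx; have dx' := dom_base_index dx.1.
exact (congr1 (fun X => _ + s *: X) (baseform_indep dx' dx)).
Qed.

Lemma deformed_smooth s i : smooth_on (chart_img (atlas i)) (deformed s i).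
Proof.
move=> k; apply: Ck_on_local => x ix; have dx := dom_base_index ix.
set j := base_index _ in dx; exists (dom i j); split=> //; first exact: rep_dom_open.
have oD := @rep_dom_open i j.
have Cg : Ck_on k (dom i j) (metric gM i).
  by apply: Ck_on_sub (@metric_smooth _ _ _ gM i k) => y [].
have C := CkD oD Cg (Ck_scale oD (Ck_cst k (dom i j) (s : R^o)) (@baseform_smooth i j k)).
by apply: (Ck_on_eq oD _ C) => y dy; rewrite (deformedE s dy).
Qed.

Lemma deformed_sym s i x : chart_img (atlas i) x -> (deformed s i x)^T = deformed s i x.
Proof.
move=> ix; rewrite /deformed linearD linearZ /= (Defs.metric_sym gM ix) baseform_sym //.
exact: dom_base_index.
Qed.

Lemma deformed_pos s i x : 0 <= s -> chart_img (atlas i) x -> posdef (deformed s i x).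
Proof.
move=> s0 ix v v0; rewrite /deformed addrC bform_linM.
apply: ltr_wpDl; last exact: (metric_pos gM ix).
by apply: mulr_ge0 => //; apply: baseform_ge0; exact: dom_base_index.
Qed.

Lemma deformed_compat s i i' x : ov i i' x ->
  deformed s i x = pullback (tr i i') (deformed s i') x.
Proof.
move=> ox; have dx := dom_base_index ox.1; set j := base_index _ in dx.
have dx' := dom_tr ox dx.
rewrite (deformedE s dx) (metric_compat gM ox) (baseform_tr ox dx) -pullbackD.
exact (congr1 (fun X => 'J (tr i i') x *m X *m ('J (tr i i') x)^T) (esym (deformedE s dx'))).
Qed.

(** The pulled back term is only positive semidefinite; adding a nonnegative
    multiple of it to a metric gives a metric. *)
Definition deformed_metric s (s0 : 0 <= s) : riemannian_metric M :=
  RiemannianMetric (deformed_smooth s) (@deformed_sym s)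
    (fun i x ix => deformed_pos s0 ix) (@deformed_compat s).

Lemma tr_unit i i' x : ov i i' x -> 'J (tr i i') x \in unitmx.
Proof.
move=> ox; have [ox' _] := transition_overlap ox.
have E : 'J (tr i i') x *m 'J (tr i' i) (tr i i' x) = 1%:M.
  refine (etrans (esym (jacobian_comp (tr_diff ox) (tr_diff ox'))) _).
  have did : differentiable (fun y : 'rV[R]_n => y *m 1%:M) x.
    exact: (Ck_differentiable (Ck_mulmx openT (@smooth_id R n setT 1) (Ck_cst 1 setT 1%:M)) I).
  refine (etrans (jacobian_near _ _) (jacobian_mulmxr 1%:M x)).
    apply: filterS (near_open (@overlap_open _ _ _ _ _) ox) => y oy.
    by rewrite transitionK // mulmx1.
  exact: (differentiable_comp (tr_diff ox) (tr_diff ox')).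
exact (proj1 (mulmx1_unit E)).
Qed.

(** Positivity of the invariant at a point may thus be checked in any one chart
    around it, and transferred to all the others. *)
Lemma h4_coord_chart s i i' x : 0 <= s -> ov i i' x ->
  h4_coord (deformed s i) x = h4_coord (deformed s i') (tr i i' x).
Proof.
move=> s0 ox.
have near_pb : \forall y \near x, deformed s i y = pullback (tr i i') (deformed s i') y.
  by apply: filterS (near_open (@overlap_open _ _ _ _ _) ox) => y oy; exact: deformed_compat.
refine (etrans (h4_coord_near near_pb) _).
apply: (@h4_coord_pullback _ _ (chart_img (atlas i')) (ov i i')).
- exact: chart_img_open.
- exact: deformed_smooth.
- exact: overlap_open.
- by move=> y oy; have [[]] := transition_overlap oy.
- exact: (@atlas_smooth _ _ M i i' 3%N).
- by move=> y iy; apply: posdef_unit; exact: deformed_pos.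
- by move=> y iy; exact: deformed_sym.
- exact: ox.
- exact: tr_unit.
Qed.
End Deformation.

(** * The fibre through a point in adapted coordinates *)

Section Slices.
Context {R : realType}.

Lemma slice_diff b m (a : 'rV[R]_b) (y : 'rV[R]_m) :
  differentiable (fun y => row_mx a y) y.
Proof.
exact: (Ck_differentiable (Ck_row_mx openT (Ck_cst 1 setT a) (@smooth_id R m setT 1)) I).
Qed.

Lemma jacobian_slice b m (a : 'rV[R]_b) (y : 'rV[R]_m) :
  'J (fun y => row_mx a y) y = row_mx 0 1%:M.
Proof.
have did : differentiable (id : 'rV[R]_m -> 'rV[R]_m) y by have [] := is_diff_id y.
have dcst : differentiable (fun _ : 'rV[R]_m => a) y by exact: differentiable_cst.
refine (etrans (jacobian_row_mx dcst did (slice_diff a y)) _); congr row_mx.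
  apply/row_matrixP => i; refine (etrans (row_jacobian i dcst) _).
  by rewrite derive_cst row0.
apply/row_matrixP => i; refine (etrans (row_jacobian i did) _).
by rewrite derive_id row1.
Qed.

Lemma pullback_slice b m (a : 'rV[R]_b) (G : 'rV[R]_(b + m) -> 'M[R]_(b + m)) y :
  pullback (fun y => row_mx a y) G y = drsubmx (G (row_mx a y)).
Proof.
rewrite /pullback jacobian_slice -{1}[G _]submxK tr_row_mx trmx0 trmx1.
rewrite mul_row_block !mul0mx !add0r mul_row_col !mul1mx mulmx0 add0r mulmx1.
by [].
Qed.

Lemma pullback_proj b m (G : 'rV[R]_b -> 'M[R]_b) (z : 'rV[R]_(b + m)) :
  pullback lsubmx G z = block_mx (G (lsubmx z)) 0 0 0.
Proof.
rewrite /pullback jacobian_lsubmx tr_col_mx trmx0 trmx1 mul_col_mx mul1mx mul0mx.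
by rewrite mul_col_row !mulmx1 !mulmx0 ?mul0mx.
Qed.
End Slices.

Section Local.
Context {R : realType} {b m : nat}.
Variables (M : manifold R (b + m)) (B : manifold R b)
  (gM : riemannian_metric M) (gB : riemannian_metric B) (prj : M -> B).
Hypothesis smooth_prj : smooth_map prj.
Hypothesis subm : forall i j x, local_rep_dom prj i j x -> row_full ('J (local_rep prj i j) x).
Hypothesis hfib : forall q : B, submanifold_positive_h4 m gM (prj @^-1` [set q]).
Local Notation rep := (local_rep prj).
Local Notation dom := (local_rep_dom prj).

Section Coordinates.
Variables (i : atlas_index M) (j : atlas_index B) (L : 'M[R]_(b + m, m)).
Variables (U V : set 'rV[R]_(b + m)) (Psi : 'rV[R]_(b + m) -> 'rV[R]_(b + m)).
Let F x := row_mx (rep i j x) (x *m L).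
Hypothesis oU : open U.
Hypothesis oV : open V.
Hypothesis UD : U `<=` dom i j.
Hypothesis UP : forall x, U x -> V (F x) /\ Psi (F x) = x.
Hypothesis VP : forall z, V z -> U (Psi z) /\ F (Psi z) = z.
Hypothesis sPsi : smooth_on V Psi.
Hypothesis uPsi : forall z, V z -> 'J Psi z \in unitmx.
Local Notation G := (pullback Psi (metric gM i)).

Lemma adapted_img z : V z -> chart_img (atlas i) (Psi z).
Proof. by move=> /VP[/UD[]]. Qed.

Lemma adapted_rep z : V z -> rep i j (Psi z) = lsubmx z.
Proof. by move=> /VP[_ {2}<-]; rewrite row_mxKl. Qed.

Lemma adapted_diff z : V z -> differentiable Psi z.
Proof. by move=> Vz; exact: (Ck_differentiable (sPsi 1%N) Vz). Qed.

Lemma adapted_smooth k : Ck_on k V G.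
Proof.
exact: (Ck_pullback oV (@chart_img_open _ _ _ (atlas i)) adapted_img (sPsi k.+1)
  (@metric_smooth _ _ _ gM i k)).
Qed.

Lemma adapted_sym z : V z -> (G z)^T = G z.
Proof. by move=> Vz; apply: pullback_sym; exact: (Defs.metric_sym gM (adapted_img Vz)). Qed.

Lemma adapted_posdef z : V z -> posdef (G z).
Proof.
move=> Vz; apply: posdef_pullback; last by rewrite row_free_unit uPsi.
by move=> v; exact: (metric_pos gM (adapted_img Vz)).
Qed.

Lemma adapted_base z : V z -> chart_img (atlas j) (lsubmx z).
Proof. by move=> Vz; rewrite -adapted_rep //; apply: rep_img; have [/UD] := VP Vz. Qed.

(** In the coordinates (rep x, x L), whose inverse is Psi, the submersion is
    the projection onto the first b coordinates, and the deformed metric is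
    the stretched metric studied above. *)
Lemma adapted_deformed s z : V z -> pullback Psi (deformed gM gB prj s i) z =
  G z + s *: block_mx (metric gB j (lsubmx z)) 0 0 0.
Proof.
move=> Vz; have dz : dom i j (Psi z) by have [/UD] := VP Vz.
refine (etrans (congr1 (fun X => 'J Psi z *m X *m ('J Psi z)^T) (deformedE gM gB smooth_prj s dz)) _).
refine (etrans (pullbackD Psi (metric gM i) (baseform gB prj i j) s z) _).
refine (congr1 (fun X => _ + s *: X) _).
refine (etrans (esym (pullback_comp _ (adapted_diff Vz) (rep_diff smooth_prj dz))) _).
refine (etrans _ (pullback_proj (metric gB j) z)).
apply: pullback_near.
  by apply: filterS (near_open oV Vz) => z' Vz'; exact: adapted_rep.
exact: (differentiable_comp (adapted_diff Vz) (rep_diff smooth_prj dz)).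
Qed.

Variable p : M.
Hypothesis dp : chart_dom (atlas i) p.
Let x0 := chart_map (atlas i) p.
Hypothesis Ux0 : U x0.
Let z0 := F x0.
Let a := lsubmx z0.

Let fibre_dom := [set y : 'rV[R]_m | V (row_mx a y)].
Let fibre_par (y : 'rV[R]_m) := Psi (row_mx a y).

Let Vz0 : V z0. Proof. by have [] := UP Ux0. Qed.

Let oVa : open fibre_dom.
Proof.
apply: (@open_comp _ _ (fun y : 'rV[R]_m => row_mx a y) V) => // y _.
exact: (differentiable_continuous (slice_diff a y)).
Qed.

Let C_slice k : Ck_on k fibre_dom (fun y => row_mx a y).
Proof. exact: (Ck_row_mx oVa (Ck_cst k _ a) (@smooth_id R m _ k)). Qed.

Let C_par : smooth_on fibre_dom fibre_par.
Proof.
by move=> k; exact: (@Ck_comp_mx _ _ _ k fibre_dom V _ _ _ Psi oVa oV (fun y Vy => Vy) (C_slice k) (sPsi k)).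
Qed.

Let par_pullback y : fibre_dom y -> pullback fibre_par (metric gM i) y = fibre_metric G z0 y.
Proof.
move=> Vy; refine (etrans (pullback_comp _ (slice_diff a y) (adapted_diff Vy)) _).
exact: pullback_slice.
Qed.

Let par_free y : fibre_dom y -> row_free ('J fibre_par y).
Proof.
move=> Vy; rewrite (jacobian_comp (slice_diff a y) (adapted_diff Vy)).
rewrite /row_free mxrankMfree; last by rewrite row_free_unit uPsi.
rewrite jacobian_slice -/(row_free _) -kermx_eq0; apply/eqP.
have := mulmx_ker (row_mx 0 1%:M : 'M[R]_(m, b + m)).
by rewrite mul_mx_row mulmx1 mulmx0 -[0 in RHS]row_mx0 => /eq_row_mx[].
Qed.

Let par_local : local_parametrization (prj @^-1` [set prj p]) i fibre_dom fibre_par.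
Proof.
have x0P : chart_inv (atlas i) x0 = p by exact: chart_mapK.
have aE : a = rep i j x0 by rewrite /a /z0 /F row_mxKl.
have px0 : dom i j x0 by exact: UD.
split.
- exact: oVa.
- by move=> _ [y Vy <-]; exact: adapted_img.
- by split; [exact: C_par|exact: par_free].
(* The fibre coordinates of M restrict to a left inverse of the
   parametrization. *)
- exists (fun x => x *m L).
    move=> y Vy; have [_ e] := VP Vy; have := congr1 rsubmx e.
    by rewrite /F !row_mxKr.
  apply: continuous_subspaceT => x.
  exact: (@mulmxr_continuous R _ _ L x).
(* The part of the fibre that the slice covers is cut out by the domain of the
   adapted coordinates. *)
- exists [set q | chart_dom (atlas i) q /\ U (chart_map (atlas i) q)].
    apply: open_preimage => //; first exact: chart_dom_open.
    exact: chart_map_for.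
  apply/seteqP; split=> q /=.
    move=> [y Vy <-]; have [UPsi FPsi] := VP Vy; have dy := UD UPsi.
    have [diq miq] := chart_imgP (adapted_img Vy).
    split; last by split=> //; rewrite miq.
    rewrite -(rep_inv dy) (adapted_rep Vy) row_mxKl aE (rep_inv px0).
    by rewrite x0P.
  move=> [pq [dq Uq]]; set x := chart_map (atlas i) q in Uq.
  have xq : chart_inv (atlas i) x = q by exact: chart_mapK.
  have Fx : F x = row_mx a (x *m L).
    by rewrite /F aE; congr row_mx; rewrite /local_rep xq x0P pq.
  have [VF PF] := UP Uq; rewrite Fx in VF PF.
  by exists (x *m L) => //; rewrite /fibre_par PF.
Qed.

(** The slice of the adapted coordinates through the point parametrizes an open
    part of the fibre ([par_local]), and the metric it induces is the fibre
    metric of the coordinate computation; the hypothesis on the fibres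
    applies to it in an orthonormal basis, which exists by Gram-Schmidt. *)
Lemma fibre_positive : 0 < h4_coord (fibre_metric G z0) (rsubmx z0).
Proof.
have Vy : fibre_dom (rsubmx z0) by rewrite /fibre_dom /= /a hsubmxK.
set y0 := rsubmx z0 in Vy *; pose gs := pullback fibre_par (metric gM i).
have img y : fibre_dom y -> chart_img (atlas i) (fibre_par y) by exact: adapted_img.
have sgs y : fibre_dom y -> (gs y)^T = gs y.
  by move=> Vy'; apply: pullback_sym; exact: (Defs.metric_sym gM (img _ Vy')).
have pgs y : fibre_dom y -> posdef (gs y).
  move=> Vy'; apply: posdef_pullback; last exact: par_free.
  by move=> v; exact: (metric_pos gM (img _ Vy')).
have Cgs : Ck_on 2 fibre_dom gs.
  exact: (Ck_pullback oVa (@chart_img_open _ _ _ (atlas i)) img (C_par 3)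
    (@metric_smooth _ _ _ gM i 2)).
have [E oE] := orthonormal_exists (sgs _ Vy) (pgs _ Vy).
have := hfib par_local Vy oE.
have ugs y : fibre_dom y -> gs y \in unitmx by move=> Vy'; apply: posdef_unit; exact: pgs.
have e1 : h4 gs y0 E = h4_coord gs y0 := h4_orthonormal oVa Vy Cgs ugs sgs oE.
have e2 : h4_coord gs y0 = h4_coord (fibre_metric G z0) y0.
  apply: h4_coord_near; apply: filterS (near_open oVa Vy) => y Vy'; exact: par_pullback.
exact (eq_ind _ (fun t => 0 < t -> 0 < h4_coord (fibre_metric G z0) y0)
  (fun h => h) _ (esym (etrans e1 e2))).
Qed.

(** Combines the coordinate computation with the invariance under the change to
    the adapted coordinates. *)
Lemma positive_near : exists2 r, 0 < r & forall x tau, U x -> `|F x - z0| < r -> 0 < tau < r ->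
  0 < h4_coord (deformed gM gB prj (tau^-2) i) x.
Proof.
have [r r0 Hr] := stretched_positive oV (adapted_smooth 2) adapted_sym adapted_posdef
  (@chart_img_open _ _ _ (atlas j)) (@metric_smooth _ _ _ gB j 2)
  (fun x jx => Defs.metric_sym gB jx) (fun x jx v => metric_pos gB jx (v := v)) adapted_base
  Vz0 fibre_positive.
exists r => // x tau Ux xr tr; have [Vz Pz] := UP Ux.
have [_ h] := Hr _ _ xr tr; have t0 : 0 < tau by case/andP: tr.
have s0 : 0 <= tau^-2 by rewrite invr_ge0 sqr_ge0.
have near_pb : \forall z \near F x, pullback Psi (deformed gM gB prj (tau^-2) i) z =
    stretched G (metric gB j) tau z.
  by apply: filterS (near_open oV Vz) => z Vz'; exact: adapted_deformed.
have e2 : h4_coord (pullback Psi (deformed gM gB prj (tau^-2) i)) (F x) =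
    h4_coord (deformed gM gB prj (tau^-2) i) (Psi (F x)).
  apply: (@h4_coord_pullback _ _ (chart_img (atlas i)) V).
  - exact: chart_img_open.
  - exact: deformed_smooth.
  - exact: oV.
  - exact: adapted_img.
  - exact: sPsi.
  - by move=> y iy; apply: posdef_unit; exact: deformed_pos.
  - by move=> y iy; exact: deformed_sym.
  - exact: Vz.
  - exact: uPsi.
have e := etrans (esym (h4_coord_near near_pb)) (etrans e2 (congr1 _ Pz)).
exact (eq_ind _ (fun t => 0 < t) h _ e).
Qed.
End Coordinates.
End Local.

(** * Compactness and conclusion *)

Section Compactness.
Context {R : realType} {b m : nat}.
Variables (M : manifold R (b + m)) (B : manifold R b)
  (gM : riemannian_metric M) (gB : riemannian_metric B) (prj : M -> B).
Hypothesis smooth_prj : smooth_map prj.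
Hypothesis subm : forall i j x, local_rep_dom prj i j x -> row_full ('J (local_rep prj i j) x).
Hypothesis hfib : forall q : B, submanifold_positive_h4 m gM (prj @^-1` [set q]).

(** The conclusion speaks of all charts around q at once; it is obtained in one
    chart around p, used for all nearby q, and moved to the others by
    [h4_coord_chart]. *)
Lemma local_positive (p : M) :
  \forall q \near p & tau \near (0 : R)^'+, forall i, chart_dom (atlas i) q ->
    0 < h4_coord (deformed gM gB prj (tau^-2) i) (chart_map (atlas i) q).
Proof.
have [i dp] := atlas_cover p; set j := base_index (prj p).
pose x0 := chart_map (atlas i) p.
have dx0 : local_rep_dom prj i j x0.
  by split; [exact: chart_map_img|rewrite /x0 chart_mapK //; exact: base_indexP].
have [L uL] := row_full_complement (subm dx0).
pose F x := row_mx (local_rep prj i j x) (x *m L).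
have oD := @rep_dom_open _ _ _ _ _ _ smooth_prj i j.
have CL k : Ck_on k (local_rep_dom prj i j) (fun x : 'rV[R]_(b + m) => x *m L).
  exact: (Ck_mulmx oD (@smooth_id R _ _ k) (Ck_cst k _ L)).
have CF k : Ck_on k (local_rep_dom prj i j) F.
  exact: (Ck_row_mx oD (rep_smooth smooth_prj i j k) (CL k)).
have dF x : local_rep_dom prj i j x -> differentiable F x.
  by move=> dx; exact: (Ck_differentiable (CF 1%N) dx).
have uJ : 'J F x0 \in unitmx.
  rewrite (jacobian_row_mx (rep_diff smooth_prj dx0) (Ck_differentiable (CL 1%N) dx0) (dF _ dx0)).
  by rewrite jacobian_mulmxr.
have [U [V [Psi [[oU Ux0 UD oV] [UP VP sPsi uPsi]]]]] := inverse_function oD dx0 CF uJ.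
have [r r0 Hr] := positive_near gB smooth_prj hfib oU oV UD UP VP sPsi uPsi dp Ux0.
exists ([set q | chart_dom (atlas i) q /\ (U (chart_map (atlas i) q) /\
    `|F (chart_map (atlas i) q) - F x0| < r)], [set tau | 0 < tau < r]).
  split=> /=; last first.
    near=> t; apply/andP; split; near: t; [exact: nbhs_right_gt|exact: nbhs_right_lt].
  have cm := chart_map_for dp.
  apply: filterI; first exact: near_open (@chart_dom_open _ _ _ (atlas i)) dp.
  apply: filterI; first exact: (cm _ (near_open oU Ux0)).
  have cF : {for p, continuous (F \o chart_map (atlas i))}.
    by apply: continuous_comp => //; exact: (differentiable_continuous (dF _ dx0)).
  have /cvgr_distC_lt := cF; apply; exact: r0.
move=> [q tau] /= [[dq [Uq rq]] tr] i' dq'.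
have pos := Hr _ _ Uq rq tr.
have ox : overlap (atlas i) (atlas i') (chart_map (atlas i) q).
  by split; [exact: chart_map_img|rewrite chart_mapK].
have s0 : 0 <= tau^-2 by rewrite invr_ge0 sqr_ge0.
have e := h4_coord_chart gM gB smooth_prj s0 ox.
have tq : transition (atlas i) (atlas i') (chart_map (atlas i) q) = chart_map (atlas i') q.
  by rewrite /transition chart_mapK.
exact (eq_ind _ (fun t => 0 < t) pos _ (etrans e (congr1 _ tq))).
Unshelve. all: by end_near. Qed.

(** Finitely many of the neighbourhoods of [local_positive] cover the compact
    space, so one value of tau works at every point. *)
Lemma total_space_positive : compact [set: M] ->
  exists g : riemannian_metric M, positive_h4 g.
Proof.
move=> /compact_near_coveringP cM.
have pos := cM R (0 : R)^'+ (fun tau q => forall i, chart_dom (atlas i) q ->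
    0 < h4_coord (deformed gM gB prj (tau^-2) i) (chart_map (atlas i) q)) _
  (fun p _ => local_positive p).
have pos0 := pos (@filter_filter _ _ (at_right_proper_filter (0 : R))).
have [tau Htau] := @filter_ex _ _ (at_right_proper_filter (0 : R)) _ pos0.
have s0 : 0 <= tau^-2 by rewrite invr_ge0 sqr_ge0.
exists (deformed_metric gM gB smooth_prj s0) => i x ix E oE.
have e : h4 (deformed gM gB prj (tau^-2) i) x E = h4_coord (deformed gM gB prj (tau^-2) i) x.
  apply: (h4_orthonormal (@chart_img_open _ _ _ (atlas i)) ix _ _ _ oE).
  - exact: (deformed_smooth gM gB smooth_prj (tau^-2) i 2).
  - by move=> y iy; apply: posdef_unit; exact: deformed_pos.
  - by move=> y iy; exact: deformed_sym.
have [dq mq] := chart_imgP ix; have := Htau _ I i dq; rewrite mq => h.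
exact (eq_ind _ (fun t => 0 < t) h _ (esym e)).
Qed.
End Compactness.

Theorem theoremB (R : realType) (n b m : nat) (hn : n = (b + m)%N)
    (hm : (4 <= m)%N) (M : manifold R n) (B : manifold R b)
    (gM : riemannian_metric M) (gB : riemannian_metric B) (prj : M -> B)
    (hM : compact [set: M]) (hprj : riemannian_submersion gM gB prj)
    (hfib : forall q : B,
       submanifold_positive_h4 m gM (prj @^-1` [set q])) :
  exists g : riemannian_metric M, positive_h4 g.
Proof.
subst n; have [smooth_prj subm] := hprj.
by apply: (total_space_positive gB smooth_prj _ hfib hM) => i j x /subm[].
Qed.
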